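(* Let $m\ge 2$ and let $\psi:M^m\to\bar M^{n+1}=I\times_hP$ be a complete mean curvature flow soliton with respect to $X=h(t)\partial_t$ and constant $c<0$, with $M$ connected, and let $o\in M$ be fixed. Assume that $P$ has constant sectional curvature $\kappa$. Furthermore suppose that $$\mathrm{Ric}_M\le\Lambda\,g$$ for some constant $\Lambda$, where $g$ is the induced metric, and $$\sup_M\big(|II|^2-(m-1)\varkappa\big)<+\infty,$$ where $\varkappa$ is evaluated at $\pi\circ\psi$ and $$\varkappa(t)=\min\Big\{-\frac{h''(t)}{h(t)},\ \frac{\kappa}{h^2(t)}-\frac{h'(t)^2}{h^2(t)}\Big\},\qquad t\in I.$$ Then there is a constant $A$ such that $$|\nabla\eta(x)|\ge\frac1c\,\sup_M\big(|II|^2-(m-1)\varkappa\big)\,r(x)+\int_0^{r(x)}h'(\pi\circ\psi\circ\gamma(\tau))\,d\tau+A$$ for every $x\in M$, where $r(x)=\operatorname{dist}_M(o,x)$ and $\gamma:[0,r(x)]\to M$ is a unit speed minimizing geodesic from $o$ to $x$.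
   Context: $I\subset\mathbb R$ is an open interval, $h:I\to(0,\infty)$ is smooth, $(P^n,g_0)$ is a Riemannian manifold, and $\bar M^{n+1}=I\times_hP$ is $I\times P$ with metric $dt^2+h(t)^2g_0$; $\pi(t,p)=t$. An isometric immersion $\psi:M^m\to\bar M^{n+1}$ is a mean curvature flow soliton with respect to $X$ if $c\,X^\perp=\mathbf H$ along $\psi$ for some constant $c\in\mathbb R$, where $\perp$ is projection on the normal bundle, $II$ is the second fundamental form and $\mathbf H$ is the non-normalized mean curvature vector (the trace of $II$). It is complete if $M$ with the induced metric is complete. Fix $t_0\in I$; $\eta(x)=\int_{t_0}^{\pi(\psi(x))}h(s)\,ds$ for $x\in M$. *)

(* Defs.v *)
From HB Require Import structures.
From mathcomp Require Import all_boot all_order all_algebra.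
From mathcomp Require Import all_classical all_reals all_analysis.

Set Implicit Arguments.
Unset Strict Implicit.
Unset Printing Implicit Defensive.

Import Order.TTheory GRing.Theory Num.Theory.
Import numFieldNormedType.Exports.

Local Open Scope ring_scope.
Local Open Scope classical_set_scope.

(* Riemannian geometry in charts.  Tangent vectors at a point are represented
   by row vectors of components in a chart, a metric by its Gram matrix G, so
   that <v, w> = v G w^T; the differential of f acts on row vectors by right
   multiplication with the library Jacobian 'J f u. *)

Section Smooth.
Context {R : realType} {V W : normedModType R}.

(* meant for open U *)
Fixpoint Ck_on (k : nat) (U : set V) (f : V -> W) : Prop :=
  match k with
  | 0 => forall x, U x -> {for x, continuous f}
  | k'.+1 => (forall x, U x -> differentiable f x) /\
             forall v : V, Ck_on k' U ('D_v f)
  end.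

Definition smooth_on (U : set V) (f : V -> W) : Prop := forall k, Ck_on k U f.

End Smooth.

(* Oriented integral. *)
Definition oint {R : realType} (f : R -> R) (a b : R) : R :=
  if a <= b then \int[lebesgue_measure]_(t in `[a, b]) f t
  else - \int[lebesgue_measure]_(t in `[b, a]) f t.

Section Local.
Context {R : realType}.

Definition basis {n} (i : 'I_n) : 'rV[R]_n := delta_mx 0 i.

Definition inner {n} (G : 'M[R]_n) (v w : 'rV[R]_n) : R :=
  (v *m G *m w^T) 0 0.

Section Curvature.
Context {n : nat} (G : 'rV[R]_n -> 'M[R]_n).

Definition dG (i j k : 'I_n) (u : 'rV[R]_n) : R :=
  'D_(basis i) (fun y => G y j k) u.

(* christoffel i j k is Gamma^k_{ij}. *)
Definition christoffel (i j k : 'I_n) (u : 'rV[R]_n) : R :=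
  2^-1 * \sum_l invmx (G u) k l * (dG i j l u + dG j i l u - dG l i j u).

Definition christoffel_form (u v w : 'rV[R]_n) : 'rV[R]_n :=
  \row_k \sum_i \sum_j christoffel i j k u * v 0 i * w 0 j.

(* riem i j k l is the d_l component of R(d_i, d_j) d_k, with
   R(X, Y) = nabla_X nabla_Y - nabla_Y nabla_X - nabla_[X, Y]. *)
Definition riem (i j k l : 'I_n) (u : 'rV[R]_n) : R :=
  'D_(basis i) (christoffel j k l) u - 'D_(basis j) (christoffel i k l) u
  + \sum_a (christoffel j k a u * christoffel i a l u
            - christoffel i k a u * christoffel j a l u).

Definition riem_op (u v w z : 'rV[R]_n) : 'rV[R]_n :=
  \row_l \sum_i \sum_j \sum_k riem i j k l u * v 0 i * w 0 j * z 0 k.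

Definition sectional (u v w : 'rV[R]_n) : R :=
  inner (G u) (riem_op u v w w) v /
  (inner (G u) v v * inner (G u) w w - inner (G u) v w ^+ 2).

(* Ric(v, w) is the trace of z |-> R(z, v) w. *)
Definition ricci (u v w : 'rV[R]_n) : R :=
  \sum_i riem_op u (basis i) v w 0 i.

End Curvature.

(* Extrinsic geometry of an immersion f of an open set of R^m into R^k endowed
   with the metric G. *)
Section Immersion.
Context {m k : nat} (f : 'rV[R]_m -> 'rV[R]_k) (G : 'rV[R]_k -> 'M[R]_k).

Definition pullback (u : 'rV[R]_m) : 'M[R]_m :=
  'J f u *m G (f u) *m ('J f u)^T.

Definition tan_proj (u : 'rV[R]_m) (v : 'rV[R]_k) : 'rV[R]_k :=
  v *m G (f u) *m ('J f u)^T *m invmx (pullback u) *m 'J f u.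

Definition nor_proj (u : 'rV[R]_m) (v : 'rV[R]_k) : 'rV[R]_k :=
  v - tan_proj u v.

(* Ambient covariant derivative of the field d_j f along f, in direction d_i. *)
Definition ambient_nabla (u : 'rV[R]_m) (i j : 'I_m) : 'rV[R]_k :=
  'D_(basis i) ('D_(basis j) f) u
  + christoffel_form G (f u) ('D_(basis i) f u) ('D_(basis j) f u).

Definition loc_II (u : 'rV[R]_m) (i j : 'I_m) : 'rV[R]_k :=
  nor_proj u (ambient_nabla u i j).

Definition loc_H (u : 'rV[R]_m) : 'rV[R]_k :=
  \sum_i \sum_j invmx (pullback u) i j *: loc_II u i j.

Definition loc_normsq_II (u : 'rV[R]_m) : R :=
  \sum_i \sum_j \sum_a \sum_b
    invmx (pullback u) i a * invmx (pullback u) j b *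
    inner (G (f u)) (loc_II u i j) (loc_II u a b).

End Immersion.
End Local.

(* An atlas together with the Gram matrices of a metric in its charts.  As in
   the usual "junk value" style, chart i is only relevant on dom i, and inv i
   and metric i only on the image of dom i.  chart_at x is a chosen chart around
   x; chart-independent numbers such as |II|^2 are evaluated in it. *)
Record atlas_metric (R : realType) (n : nat) := AtlasMetric {
  pt :> topologicalType;
  idx : Type;
  dom : idx -> set pt;
  to : idx -> pt -> 'rV[R]_n;
  inv : idx -> 'rV[R]_n -> pt;
  metric : idx -> 'rV[R]_n -> 'M[R]_n;
  chart_at : pt -> idx }.

Arguments dom {R n} _ _.
Arguments to {R n} _ _ _.
Arguments inv {R n} _ _ _.
Arguments metric {R n} _ _ _.
Arguments chart_at {R n} _ _.

Record riemannian_manifold (R : realType) (n : nat) (M : atlas_metric R n) :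
    Prop := {
  rm_hausdorff : hausdorff_space M;
  rm_second_countable : @second_countable M;
  rm_dom_open : forall i, open (dom M i);
  rm_cod_open : forall i, open (to M i @` dom M i);
  rm_toK : forall i x, dom M i x -> inv M i (to M i x) = x;
  rm_to_cont : forall i x, dom M i x -> {for x, continuous (to M i)};
  rm_inv_cont : forall i u, (to M i @` dom M i) u ->
    {for u, continuous (inv M i)};
  rm_cover : forall x, dom M (chart_at M x) x;
  rm_transition : forall i j,
    smooth_on (to M i @` (dom M i `&` dom M j)) (to M j \o inv M i);
  rm_metric_smooth : forall i, smooth_on (to M i @` dom M i) (metric M i);
  rm_metric_sym : forall i u, (to M i @` dom M i) u ->
    (metric M i u)^T = metric M i u;
  rm_metric_pos : forall i u v, (to M i @` dom M i) u -> v != 0 ->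
    0 < inner (metric M i u) v v;
  rm_metric_change : forall i j x, dom M i x -> dom M j x ->
    metric M i (to M i x) =
      pullback (to M j \o inv M i) (metric M j) (to M i x) }.

Section Intrinsic.
Context {R : realType} {n : nat} (M : atlas_metric R n).

Definition Ck_curve (k : nat) (J : set R) (gamma : R -> M) : Prop :=
  (forall t, J t -> {for t, continuous gamma}) /\
  forall i, Ck_on k (J `&` gamma @^-1` dom M i) (to M i \o gamma).

Definition smooth_curve (J : set R) (gamma : R -> M) : Prop :=
  forall k, Ck_curve k J gamma.

Definition speed (gamma : R -> M) (t : R) : R :=
  let i := chart_at M (gamma t) in
  let v := (to M i \o gamma)^`() t in
  Num.sqrt (inner (metric M i (to M i (gamma t))) v v).

Definition curve_length (gamma : R -> M) (a b : R) : R :=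
  \int[lebesgue_measure]_(t in `[a, b]) speed gamma t.

(* path_length x y l: some piecewise C^1 path from x to y has length l.  A path
   is a finite concatenation of arcs, each C^1 on a compact interval, i.e.
   extending as C^1 curve to a neighbourhood of it. *)
Inductive path_length : M -> M -> R -> Prop :=
| path_nil x : path_length x x 0
| path_cons (gamma : R -> M) a b e y l :
    a <= b -> 0 < e -> Ck_curve 1 `]a - e, b + e[ gamma ->
    path_length (gamma b) y l ->
    path_length (gamma a) y (curve_length gamma a b + l).

(* The value is only meaningful when x and y can be joined, e.g. on a connected
   manifold (inf set0 = 0). *)
Definition rdist (x y : M) : R := inf [set l | path_length x y l].

Definition complete_manifold : Prop :=
  forall s : nat -> M,
    (forall e, 0 < e -> exists N, forall p q,
       (N <= p)%N -> (N <= q)%N -> rdist (s p) (s q) < e) ->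
    exists x : M, rdist (s p) x @[p --> \oo] --> (0 : R).

Definition geodesic (J : set R) (gamma : R -> M) : Prop :=
  smooth_curve J gamma /\
  forall i t, J t -> dom M i (gamma t) ->
    let u := to M i \o gamma in
    let du := u^`() in
    derive1 du t + christoffel_form (metric M i) (u t) (du t) (du t) = 0.

(* gamma restricted to [0, dist(o, x)] is a unit speed minimizing geodesic from
   o to x; "geodesic on a compact interval" means on a neighbourhood of it. *)
Definition unit_minimizing_geodesic (o x : M) (gamma : R -> M) : Prop :=
  let r := rdist o x in
  [/\ gamma 0 = o, gamma r = x,
      exists2 e, 0 < e & geodesic `]- e, r + e[ gamma,
      forall t, `[0, r] t -> speed gamma t = 1
    & curve_length gamma 0 r = r].

Definition constant_sectional_curvature (kappa : R) : Prop :=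
  forall i x (v w : 'rV[R]_n), dom M i x -> row_free (col_mx v w) ->
    sectional (metric M i) (to M i x) v w = kappa.

Definition ricci_le (Lambda : R) : Prop :=
  forall i x (v : 'rV[R]_n), dom M i x ->
    ricci (metric M i) (to M i x) v v
      <= Lambda * inner (metric M i (to M i x)) v v.

(* Components in chart i of the gradient at x of f : M -> R. *)
Definition grad (i : idx M) (f : M -> R) (x : M) : 'rV[R]_n :=
  (\row_k 'D_(basis k) (f \o inv M i : 'rV[R]_n -> R) (to M i x))
    *m invmx (metric M i (to M i x)).

Definition norm_grad (f : M -> R) (x : M) : R :=
  let i := chart_at M x in
  Num.sqrt (inner (metric M i (to M i x)) (grad i f x) (grad i f x)).

Definition vector_field : Type := idx M -> 'rV[R]_n -> 'rV[R]_n.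

End Intrinsic.

Section Immersed.
Context {R : realType} {m k : nat}.
Variables (M : atlas_metric R m) (N : atlas_metric R k) (psi : M -> N).

Definition loc_map (i : idx M) (j : idx N) : 'rV[R]_m -> 'rV[R]_k :=
  to N j \o psi \o inv M i.

Definition smooth_map : Prop :=
  continuous psi /\
  forall i j, smooth_on (to M i @` (dom M i `&` psi @^-1` dom N j))
                        (loc_map i j).

(* The pullback metric being positive definite, psi is an immersion. *)
Definition isometric_immersion : Prop :=
  smooth_map /\
  forall i j x, dom M i x -> dom N j (psi x) ->
    pullback (loc_map i j) (metric N j) (to M i x) = metric M i (to M i x).

Definition mcf_soliton (X : vector_field N) (c : R) : Prop :=
  forall i j x, dom M i x -> dom N j (psi x) ->
    c *: nor_proj (loc_map i j) (metric N j) (to M i x)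
           (X j (to N j (psi x)))
    = loc_H (loc_map i j) (metric N j) (to M i x).

Definition normsq_II (x : M) : R :=
  let i := chart_at M x in
  let j := chart_at N (psi x) in
  loc_normsq_II (loc_map i j) (metric N j) (to M i x).

End Immersed.

Section Warped.
Context {R : realType} {n : nat}.
Variables (I : set R) (h : R -> R) (P : atlas_metric R n).

(* I x_h P, realised on the open subset I x P of R x P covered by the product
   charts; these have coordinates (t, y), with y the coordinates of a chart of
   P. *)
Definition warped : atlas_metric R (1 + n) := {|
  pt := (R * P)%type;
  idx := idx P;
  dom := fun i => I `*` dom P i;
  to := fun i x => row_mx x.1%:M (to P i x.2);
  inv := fun i u => (lsubmx u 0 0, inv P i (rsubmx u));
  metric := fun i u =>
    block_mx 1%:M 0 0 (h (lsubmx u 0 0) ^+ 2 *: metric P i (rsubmx u));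
  chart_at := fun x => chart_at P x.2 |}.

(* X = h(t) d_t *)
Definition warped_field : vector_field warped :=
  fun _ u => row_mx (h (lsubmx u 0 0))%:M 0.

Definition varkappa (kappa t : R) : R :=
  let h' := h^`() in
  let h'' := h'^`() in
  Num.min (- (h'' t / h t)) (kappa / h t ^+ 2 - h' t ^+ 2 / h t ^+ 2).

End Warped.

Arguments warped_field {R n} I h P _ _.

(* Main.v *)
Require Import Defs.
From HB Require Import structures.
From mathcomp Require Import all_boot all_order all_algebra.
From mathcomp Require Import all_classical all_reals all_analysis.
From mathcomp Require Import ring lra.
Import Order.TTheory GRing.Theory Num.Theory.
Import numFieldNormedType.Exports.

Set Implicit Arguments.
Unset Strict Implicit.
Unset Printing Implicit Defensive.

Local Open Scope ring_scope.
Local Open Scope classical_set_scope.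

(* Along a unit speed geodesic u, put y = <grad eta, u'> = h(sigma) sigma', where
   sigma is the height of u.  As X = h d_t is a closed conformal field,
   y' = h'(sigma) + <II(u', u'), X>; the soliton equation turns the last term into
   <II(u', u'), H> / c, and the Gauss equation with the lower bound varkappa for
   the curvature of the warped product gives
     c (y' - h'(sigma)) <= Ric(u', u') + sup (|II|^2 - (m - 1) varkappa).
   Since u is minimizing, the second variation formula, traced over a frame and
   weighted by a cutoff phi vanishing at both ends, gives
     int phi^2 Ric(u', u') <= m int phi'^2;
   with Ric <= Lambda and phi close to 1 away from the ends this bounds
   int c (y' - h'(sigma)) - r sup (|II|^2 - (m - 1) varkappa) by a constant
   independent of r.  Finally y(r) <= |grad eta (x)| and y(0) >= - |grad eta (o)|.

   The second variation formula is needed only as an inequality, and it is proved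
   without parallel transport: by Cousin's lemma it suffices to bound the traced
   second variation on short arcs, where a frame that is parallel at a single
   point is good enough.  Variations on consecutive arcs are given in different
   charts; they agree to second order at their common end, so that they can be
   joined by segments of length o(s^2). *)

(** The obstacle is that frames and variations are carried along the geodesic only arc by arc, in
    changing charts. Full orthonormal frames are used, not frames adapted to [u']. The tangential
    direction then costs one more [phi'^2], whence [m] instead of [m - 1], and the first order terms
    [phi <e_k, u'>] do not vanish; they telescope from arc to arc and disappear because [phi] is
    zero at both ends. Tangential components do no harm because lengths are bounded through the
    energy. On each arc the frame at the left end is prescribed and the one at the right end is
    produced, and only the sum over the frame of the second order coefficients is controlled, the
    trace being what does not depend on the frame. Only 2-jets in [s] enter a second variation, so
    quadratic polynomials in a chart replace geodesics and no differential equation has to be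
    solved. The cutoff is a product of exponentials, so that one formula serves every [r >= 0],
    short geodesics included. It makes the error at most [2 (m + 2 |Lambda|)] after integration;
    division by [c < 0] reverses the inequality and produces the constant [A]. *)

Local Notation inv := Defs.inv.

(** * Differential calculus *)

Section Differentiation.
Context {R : realType}.
Implicit Types V W : normedModType R.

(** Chart maps carry arbitrary values off their domains, so functions are compared only near a
    point; this makes differentiability usable under such local agreement. *)
Lemma near_eq_diff V W (f g : V -> W) x : {near x, f =1 g} ->
  differentiable f x -> differentiable g x.
Proof.
move=> fg df.
have dfE := diff_locally df.
have gE : g \o shift x = cst (g x) + 'd f x +o_ 0 id.
  apply/eqaddoP => e e0.
  have /eqaddoP/(_ e e0) := dfE.
  apply: filter_app.
  have : \forall h \near 0, f (h + x) = g (h + x).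
    have := fg; rewrite (near_shift 0) /=; apply: filter_app; near=> y.
    by rewrite /= subr0.
  apply: filter_app; near=> h => fgh.
  have fgx : f x = g x by exact: nbhs_singleton fg.
  by rewrite /= !fctE /= /shift /= fgh fgx.
have dc : continuous ('d f x) by exact: diff_continuous.
have E : 'd g x = 'd f x :> (V -> W) by exact: diff_unique.
by apply/diff_locallyP; rewrite E; split.
Unshelve. all: by end_near. Qed.

Lemma differentiable_lin V W (f : {linear V -> W}) x :
  continuous f -> differentiable f x.
Proof. by move=> fc; apply: linear_differentiable. Qed.

Lemma derive_lin V W (f : {linear V -> W}) x v :
  continuous f -> 'D_v f x = f v.
Proof.
by move=> fc; rewrite deriveE ?diff_lin//; exact: linear_differentiable.
Qed.

Lemma derive_comp (U : normedModType R) V W (f : U -> V) (g : V -> W) x v :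
  differentiable f x -> differentiable g (f x) ->
  'D_v (g \o f) x = 'D_('D_v f x) g (f x).
Proof.
move=> df dg; rewrite deriveE; last exact: differentiable_comp.
by rewrite diff_comp// deriveE// deriveE.
Qed.

Lemma scale_bilinear W : bilinear_for
  (GRing.Scale.Law.clone _ _ ( *:%R ) _) (GRing.Scale.Law.clone _ _ ( *:%R ) _)
  (@GRing.scale R W).
Proof.
split=> [u|u] a x y /=; first by rewrite scalerDl scalerA.
by rewrite scalerDr !scalerA mulrC.
Qed.

HB.instance Definition _ W := bilinear_isBilinear.Build R R W W _ _
  (@GRing.scale R W) (@scale_bilinear W).

Lemma scale_continuous2 W : continuous (fun p : R * W => p.1 *: p.2).
Proof. by move=> p; exact: scale_continuous. Qed.

Lemma differentiable_scale V W (k : V -> R) (f : V -> W) x :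
  differentiable k x -> differentiable f x ->
  differentiable (fun y => k y *: f y) x.
Proof.
move=> dk df.
apply: (@differentiable_comp _ _ _ _ (fun y => (k y, f y)) (fun p : R * W => p.1 *: p.2)).
  exact: differentiable_pair.
apply: (@differentiable_bilin _ _ _ _ (@GRing.scale R W)).
exact: scale_continuous2.
Qed.

Lemma derive_scale V W (k : V -> R) (f : V -> W) x v :
  differentiable k x -> differentiable f x ->
  'D_v (fun y => k y *: f y) x = 'D_v k x *: f x + k x *: 'D_v f x.
Proof.
move=> dk df.
rewrite (@derive_comp _ _ _ (fun y => (k y, f y)) (fun p : R * W => p.1 *: p.2)); first last.
- by apply: (@differentiable_bilin _ _ _ _ (@GRing.scale R W)); exact: scale_continuous2.
- exact: differentiable_pair.
rewrite deriveE; last first.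
  by apply: (@differentiable_bilin _ _ _ _ (@GRing.scale R W)); exact: scale_continuous2.
rewrite (@diff_bilin _ _ _ _ (@GRing.scale R W)) /=; last exact: scale_continuous2.
rewrite (@deriveE _ _ _ (fun y => (k y, f y))); last exact: differentiable_pair.
by rewrite diff_pair//= !deriveE// addrC.
Qed.

Lemma derivable_derive_lin V W1 W2 (L : {linear W1 -> W2}) (f : V -> W1) x v :
  continuous L -> differentiable f x -> 'D_v (L \o f) x = L ('D_v f x).
Proof.
move=> Lc df; rewrite derive_comp//; first exact: derive_lin.
exact: differentiable_lin.
Qed.

Lemma derivel V W (f : V -> W) x a v w : differentiable f x ->
  'D_(a *: v + w) f x = a *: 'D_v f x + 'D_w f x.
Proof. by move=> df; rewrite !deriveE// linearP. Qed.

Lemma derive_sumr V W (f : V -> W) x n (a : 'I_n -> R) (v : 'I_n -> V) :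
  differentiable f x ->
  'D_(\sum_i a i *: v i) f x = \sum_i a i *: 'D_(v i) f x.
Proof.
move=> df; rewrite deriveE// linear_sum; apply: eq_bigr => i _.
by rewrite linearZ deriveE.
Qed.

End Differentiation.

Section Ck.
Context {R : realType}.
Implicit Types V W : normedModType R.

Lemma open_near_eq V W (U : set V) (f g : V -> W) : open U ->
  (forall x, U x -> f x = g x) -> forall x, U x -> {near x, f =1 g}.
Proof.
move=> oU fg x Ux; have : nbhs x U by exact: open_nbhs_nbhs.
by apply: filterS => y Uy; exact: fg.
Qed.

(** On an open set, agreement on the set is agreement near each of its points, which is all that
    derivatives see; hence the derivatives agree on the same set and the induction goes on. *)
Lemma Ck_on_ext k V W (U : set V) (f g : V -> W) : open U ->
  (forall x, U x -> f x = g x) -> Ck_on k U f -> Ck_on k U g.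
Proof.
move=> oU; elim: k f g => [|k IH] f g fg /=.
  move=> cf x Ux.
  have E := open_near_eq oU fg Ux.
  rewrite /prop_for /continuous_at -(fg _ Ux); apply: cvg_trans (cf _ Ux).
  by apply: near_eq_cvg; apply: filterS E.
move=> [df Df]; split=> [x Ux|v].
  by apply: near_eq_diff (df _ Ux); exact: open_near_eq oU fg _ Ux.
apply: IH (Df v) => x Ux; apply: near_eq_derive.
exact: open_near_eq oU fg _ Ux.
Unshelve. all: by end_near. Qed.

(** Each clause of [Ck_on] is a condition at single points of the full space, so it may be checked
    on any cover, for instance by the domains of charts. *)
Lemma Ck_on_local k V W (U : set V) (f : V -> W) :
  (forall x, U x -> exists2 U' : set V, U' x & Ck_on k U' f) -> Ck_on k U f.
Proof.
elim: k f => [|k IH] f H /=.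
  by move=> x /H[U' U'x]; apply.
split=> [x /H[U' U'x] [df _]|v]; first exact: df.
by apply: (IH ('D_v f)) => x /H[U' U'x Cf]; exists U' => //; exact: (Cf.2 v).
Qed.

Lemma Ck_on_sub k V W (U U' : set V) (f : V -> W) : U `<=` U' ->
  Ck_on k U' f -> Ck_on k U f.
Proof. by move=> UU' Cf; apply: Ck_on_local => x /UU' U'x; exists U'. Qed.

Lemma Ck_onS k V W (U : set V) (f : V -> W) : Ck_on k.+1 U f -> Ck_on k U f.
Proof.
elim: k f => [|k IH] f /=; first by move=> [df _] x Ux; exact: differentiable_continuous (df x Ux).
by move=> [df Df]; split=> // v; apply: IH; exact: Df.
Qed.

Lemma Ck_on_cst k V W (U : set V) (a : W) : Ck_on k U (fun=> a).
Proof.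
elim: k a => [|k IH] a /=; first by move=> x _; exact: cvg_cst.
split=> [x _|v]; first exact: differentiable_cst.
rewrite (_ : 'D_v _ = fun=> 0)//; apply/funext => x; exact: derive_cst.
Qed.

Lemma Ck_onD k V W (U : set V) (f g : V -> W) : open U ->
  Ck_on k U f -> Ck_on k U g -> Ck_on k U (fun x => f x + g x).
Proof.
move=> oU; elim: k f g => [|k IH] f g /=.
  by move=> cf cg x Ux; apply: cvgD; [exact: cf|exact: cg].
move=> [df Df] [dg Dg]; split=> [x Ux|v].
  by apply: (@differentiableD _ _ _ f g); [exact: df|exact: dg].
apply: (Ck_on_ext oU _ (IH _ _ (Df v) (Dg v))) => x Ux.
by rewrite (@deriveD _ _ _ f g)//; apply: diff_derivable; [exact: df|exact: dg].
Qed.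

Lemma Ck_on_lin k V W1 W2 (L : {linear W1 -> W2}) (U : set V) (f : V -> W1) :
  open U -> continuous L -> Ck_on k U f -> Ck_on k U (fun x => L (f x)).
Proof.
move=> oU Lc; elim: k f => [|k IH] f /=.
  by move=> cf x Ux; apply: continuous_comp; [exact: cf|exact: Lc].
move=> [df Df]; split=> [x Ux|v].
  by apply: (@differentiable_comp _ _ _ _ f L); [exact: df|exact: differentiable_lin].
apply: (Ck_on_ext oU _ (IH _ (Df v))) => x Ux.
by rewrite -derivable_derive_lin//; exact: df.
Qed.

Lemma Ck_on_scale k V W (U : set V) (a : V -> R) (f : V -> W) : open U ->
  Ck_on k U a -> Ck_on k U f -> Ck_on k U (fun x => a x *: f x).
Proof.
move=> oU; elim: k a f => [|k IH] a f /=.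
  by move=> ca cf x Ux; apply: cvgZ; [exact: ca|exact: cf].
move=> [da Da] [df Df]; split=> [x Ux|v].
  by apply: differentiable_scale; [exact: da|exact: df].
have Ca : Ck_on k U a by apply: Ck_onS; split.
have Cf : Ck_on k U f by apply: Ck_onS; split.
apply: (Ck_on_ext oU _ (Ck_onD oU (IH _ _ (Da v) Cf) (IH _ _ Ca (Df v)))) => x Ux.
by rewrite derive_scale//; [exact: da|exact: df].
Qed.

Lemma Ck_on_sum k V W (U : set V) I (s : seq I) (P : pred I) (f : I -> V -> W) :
  open U -> (forall i, Ck_on k U (f i)) ->
  Ck_on k U (fun x => \sum_(i <- s | P i) f i x).
Proof.
move=> oU Cf; elim: s => [|i s IH].
  by apply: (Ck_on_ext oU _ (Ck_on_cst k U 0)) => x _; rewrite big_nil.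
case Pi : (P i); last first.
  by apply: (Ck_on_ext oU _ IH) => x _; rewrite big_cons Pi.
by apply: (Ck_on_ext oU _ (Ck_onD oU (Cf i) IH)) => x _; rewrite big_cons Pi.
Qed.

Lemma Ck_onM k V (U : set V) (f g : V -> R) : open U ->
  Ck_on k U f -> Ck_on k U g -> Ck_on k U (fun x => f x * g x).
Proof. exact: Ck_on_scale. Qed.

Lemma Ck_onN k V W (U : set V) (f : V -> W) : open U ->
  Ck_on k U f -> Ck_on k U (fun x => - f x).
Proof.
move=> oU Cf; apply: (Ck_on_ext oU _ (Ck_on_scale oU (@Ck_on_cst k V R U (-1)) Cf)).
by move=> x _; rewrite scaleN1r.
Qed.

Lemma Ck_on_prod k V (U : set V) n (f : 'I_n -> V -> R) : open U ->
  (forall i, Ck_on k U (f i)) -> Ck_on k U (fun x => \prod_i f i x).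
Proof.
move=> oU Cf.
suff H (s : seq 'I_n) : Ck_on k U (fun x => \prod_(i <- s) f i x) by exact: H.
elim: s => [|i s IH].
  apply: (Ck_on_ext oU _ (@Ck_on_cst k V R U 1)) => x _; by rewrite big_nil.
by apply: (Ck_on_ext oU _ (Ck_onM oU (Cf i) IH)) => x _; rewrite big_cons.
Qed.

Lemma Ck_on_id k V (U : set V) : Ck_on k U (fun x => x).
Proof.
case: k => [|k] /=; first by move=> x _; exact: cvg_id.
split=> [x _|v].
  exact: ex_diff.
rewrite (_ : 'D_v _ = fun=> v); first exact: Ck_on_cst.
by apply/funext => x; exact: derive_id.
Qed.

Lemma Ck_on_linear k V W (L : {linear V -> W}) (U : set V) :
  open U -> continuous L -> Ck_on k U L.
Proof. by move=> oU Lc; apply: (Ck_on_lin (f := id)) => //; exact: Ck_on_id. Qed.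

(* The finite-dimensional middle space is presented by a basis [e] with
   coordinate forms [l]. *)
Lemma Ck_on_comp_fin k V V' W n (e : 'I_n -> V') (l : 'I_n -> {linear V' -> R})
    (U : set V) (U' : set V') (f : V -> V') (g : V' -> W) :
  (forall i, continuous (l i)) -> (forall y, y = \sum_i l i y *: e i) ->
  open U -> open U' -> (forall x, U x -> U' (f x)) ->
  Ck_on k U f -> Ck_on k U' g -> Ck_on k U (fun x => g (f x)).
Proof.
move=> lc le oU oU' UU'; elim: k g => [|k IH] g /=.
  by move=> cf cg x Ux; apply: continuous_comp; [exact: cf|exact/cg/UU'].
move=> [df Df] [dg Dg].
have Cf : Ck_on k U f by apply: Ck_onS; split.
split=> [x Ux|v].
  by apply: differentiable_comp; [exact: df|exact/dg/UU'].
have H : Ck_on k U (fun x => \sum_i l i ('D_v f x) *: 'D_(e i) g (f x)).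
  by apply: Ck_on_sum => // i; apply: Ck_on_scale => //; [exact: Ck_on_lin (Df v)|exact: (IH ('D_(e i) g))].
apply: (Ck_on_ext oU _ H) => x Ux.
rewrite (_ : (fun x => g (f x)) = g \o f)// derive_comp; [|exact: df|exact/dg/UU'].
by rewrite [in RHS](le ('D_v f x)) derive_sumr//; exact/dg/UU'.
Qed.

Definition coord_lin n (i : 'I_n) (v : 'rV[R]_n) : R := v 0 i.

Lemma coord_lin_is_linear n (i : 'I_n) : linear (coord_lin i).
Proof. by move=> a u v; rewrite /coord_lin !mxE. Qed.

HB.instance Definition _ n (i : 'I_n) :=
  GRing.isLinear.Build _ _ _ _ (coord_lin i) (@coord_lin_is_linear n i).

Lemma Ck_on_comp k V W n (U : set V) (U' : set 'rV[R]_n) (f : V -> 'rV[R]_n)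
    (g : 'rV[R]_n -> W) : open U -> open U' -> (forall x, U x -> U' (f x)) ->
  Ck_on k U f -> Ck_on k U' g -> Ck_on k U (fun x => g (f x)).
Proof.
apply: (@Ck_on_comp_fin k V _ W n (fun i => delta_mx 0 i) (fun i => coord_lin i)).
  by move=> i; exact: coord_continuous.
exact: row_sum_delta.
Qed.

Lemma Ck_on_comp1 k V W (U : set V) (U' : set R) (f : V -> R)
    (g : R -> W) : open U -> open U' -> (forall x, U x -> U' (f x)) ->
  Ck_on k U f -> Ck_on k U' g -> Ck_on k U (fun x => g (f x)).
Proof.
have H := @Ck_on_comp_fin k V R W 1 (fun=> 1) (fun=> idfun : {linear R -> R}).
apply: H.
  by move=> i x; exact: cvg_id.
by move=> y; rewrite big_ord1 /= [RHS]mulr1.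
Qed.

Lemma Ck_on_mx k V m n (U : set V) (f : V -> 'M[R]_(m, n)) : open U ->
  Ck_on k U f <-> forall i j, Ck_on k U (fun x => f x i j).
Proof.
move=> oU; split.
  move=> Cf i j.
  pose c (A : 'M[R]_(m, n)) := A i j.
  have cl : linear c by move=> a A B; rewrite /c !mxE.
  pose L := GRing.isLinear.Build _ _ _ _ c cl.
  pose cL : {linear _ -> _} := HB.pack c L.
  by apply: (Ck_on_lin (L := cL)) => //; exact: coord_continuous.
move=> Cf.
have H : Ck_on k U (fun x => \sum_i \sum_j f x i j *: delta_mx i j).
  apply: Ck_on_sum => // i; apply: Ck_on_sum => // j.
  by apply: Ck_on_scale => //; exact: Ck_on_cst.
by apply: (Ck_on_ext oU _ H) => x _; rewrite -matrix_sum_delta.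
Qed.

Lemma Ck_on_mulmx k V m n p (U : set V) (f : V -> 'M[R]_(m, n)) (g : V -> 'M[R]_(n, p)) :
  open U -> Ck_on k U f -> Ck_on k U g -> Ck_on k U (fun x => f x *m g x).
Proof.
move=> oU /(Ck_on_mx k _ oU) Cf /(Ck_on_mx k _ oU) Cg; apply/(Ck_on_mx k _ oU) => i j.
have H : Ck_on k U (fun x => \sum_l f x i l * g x l j).
  by apply: Ck_on_sum => // l; exact: Ck_onM.
by apply: (Ck_on_ext oU _ H) => x _; rewrite mxE.
Qed.

Lemma Ck_on_trmx k V m n (U : set V) (f : V -> 'M[R]_(m, n)) :
  open U -> Ck_on k U f -> Ck_on k U (fun x => (f x)^T).
Proof.
move=> oU /(Ck_on_mx k _ oU) Cf; apply/(Ck_on_mx k _ oU) => i j.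
by apply: (Ck_on_ext oU _ (Cf j i)) => x _; rewrite mxE.
Qed.

Lemma Ck_on_det k V n (U : set V) (f : V -> 'M[R]_n) :
  open U -> Ck_on k U f -> Ck_on k U (fun x => \det (f x)).
Proof.
move=> oU /(Ck_on_mx k _ oU) Cf; rewrite /determinant.
apply: Ck_on_sum => // p.
by apply: Ck_onM => //; [exact: Ck_on_cst|exact: Ck_on_prod].
Qed.

Lemma Ck_onV k V (U : set V) (f : V -> R) : open U ->
  (forall x, U x -> f x != 0) -> Ck_on k U f -> Ck_on k U (fun x => (f x)^-1).
Proof.
move=> oU f0; elim: k => [|k IH] /=.
  by move=> cf x Ux; apply: cvgV; [exact: f0|exact: cf].
move=> [df Df]; have Cf : Ck_on k U f by apply: Ck_onS; split.
split=> [x Ux|v]; first by apply: differentiableV; [exact: df|exact: f0].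
have H : Ck_on k U (fun x => - ((f x)^-1 * (f x)^-1) * 'D_v f x).
  apply: Ck_onM => //; apply: Ck_onN => //; apply: Ck_onM => //; exact: IH.
apply: (Ck_on_ext oU _ H) => x Ux.
rewrite (@deriveV _ _ f); [|exact: f0|exact: diff_derivable (df _ Ux)].
by rewrite -expr2 exprVn scaleNr mulNr.
Qed.

(** Cramer's rule: entries of the adjugate are polynomial in the entries of the matrix, and the
    determinant does not vanish. *)
Lemma Ck_on_invmx k V n (U : set V) (f : V -> 'M[R]_n) :
  open U -> (forall x, U x -> f x \in unitmx) ->
  Ck_on k U f -> Ck_on k U (fun x => invmx (f x)).
Proof.
move=> oU uf Cf.
have H : Ck_on k U (fun x => (\det (f x))^-1 *: \adj (f x)).
  apply: Ck_on_scale => //.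
    apply: Ck_onV => //; last exact: Ck_on_det.
    by move=> x Ux; have := uf x Ux; rewrite unitmxE unitfE.
  apply/(Ck_on_mx k _ oU) => i j.
  have H : Ck_on k U (fun x => (-1) ^+ (j + i) * \det (row' j (col' i (f x)))).
    apply: Ck_onM => //; first exact: Ck_on_cst.
    apply: Ck_on_det => //; apply/(Ck_on_mx k _ oU) => i' j'.
    have /(Ck_on_mx k _ oU) Cf' := Cf.
    by apply: (Ck_on_ext oU _ (Cf' (lift j i') (lift i j'))) => x _; rewrite !mxE.
  by apply: (Ck_on_ext oU _ H) => x _; rewrite !mxE.
by apply: (Ck_on_ext oU _ H) => x Ux; rewrite /invmx uf.
Qed.

End Ck.

Section LineDerivatives.
Context {R : realType}.
Implicit Types V W : normedModType R.

Lemma is_derive_line V W (f : V -> W) (v c : V) (s : R) :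
  derivable f (s *: v + c) v ->
  is_derive s 1 (fun t : R => f (t *: v + c)) ('D_v f (s *: v + c)).
Proof.
set y := s *: v + c => df.
have E : (fun h : R => h^-1 *: (((fun t => f (t *: v + c)) \o shift s) (h *: (1 : R))
    - f (s *: v + c))) = (fun h => h^-1 *: ((f \o shift y) (h *: v) - f y)).
  apply/funext => h /=; congr (_ *: (f _ - _)).
  by rewrite /y addrA -scalerDl [h *: 1]mulr1.
by split; rewrite /derivable /derive E.
Qed.

Lemma derive_mxE V m n (f : V -> 'M[R]_(m, n)) v x i j : differentiable f x ->
  'D_v f x i j = 'D_v (fun y => f y i j) x.
Proof. by move=> df; rewrite derive_mx ?mxE//; exact: diff_derivable. Qed.

Lemma smooth_on_derive V W (U : set V) (f : V -> W) v :
  smooth_on U f -> smooth_on U ('D_v f).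
Proof. by move=> Cf k; exact: (Cf k.+1).2. Qed.

Lemma smooth_on_diff V W (U : set V) (f : V -> W) x :
  smooth_on U f -> U x -> differentiable f x.
Proof. by move=> Cf Ux; exact: (Cf 1).1. Qed.

Lemma smooth_on_continuous V W (U : set V) (f : V -> W) x :
  smooth_on U f -> U x -> {for x, continuous f}.
Proof. by move=> Cf; exact: (Cf 0). Qed.

Lemma mvt (f df : R -> R) (a b : R) : a <= b ->
  (forall x, a <= x <= b -> is_derive x 1 f (df x)) ->
  exists2 c, a <= c <= b & f b - f a = df c * (b - a).
Proof.
move=> ab fd.
have [c cab E] : exists2 c, c \in `[a, b]%R & f b - f a = df c * (b - a).
  apply: MVT_segment => //.
    by move=> x /[!in_itv]/= /andP[ax xb]; apply: fd; rewrite !ltW.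
  apply: continuous_in_subspaceT => x; rewrite inE/= in_itv/= => /fd[dx _].
  by apply: differentiable_continuous; apply/derivable1_diffP.
by exists c => //; move: cab; rewrite in_itv.
Qed.

(* Both mixed derivatives are limits of the same second difference quotient. *)
Lemma schwarzR V (U : set V) (f : V -> R) v w x : open U -> U x -> Ck_on 2 U f ->
  'D_v ('D_w f) x = 'D_w ('D_v f) x.
Proof.
move=> oU Ux Cf.
have der v' w' : exists2 e : R, 0 < e & forall s, 0 < s < e ->
    exists2 p : R * R, (0 <= p.1 <= s) && (0 <= p.2 <= s) &
      f (s *: v' + (s *: w' + x)) - f (s *: v' + x) - f (s *: w' + x) + f x =
      s * s * 'D_w' ('D_v' f) (p.2 *: w' + (p.1 *: v' + x)).
  have cU : \forall p \near ((0 : R), (0 : R)), U (p.2 *: w' + (p.1 *: v' + x)).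
    have c : {for (0 : R, 0 : R), continuous (fun p : R * R => p.2 *: w' + (p.1 *: v' + x))}.
      apply: cvgD; first by apply: cvgZ; [exact: cvg_snd|exact: cvg_cst].
      apply: cvgD; last exact: cvg_cst.
      by apply: cvgZ; [exact: cvg_fst|exact: cvg_cst].
    apply: c; rewrite /= !scale0r !add0r; exact: open_nbhs_nbhs.
  have [[A B] [/= [a a0 Aa] [b b0 Bb]] AB] := cU.
  exists (Num.min a b); first by rewrite lt_min a0.
  move=> s /andP[s0]; rewrite lt_min => /andP[sa sb].
  have inU p q : 0 <= p <= s -> 0 <= q <= s -> U (q *: w' + (p *: v' + x)).
    move=> /andP[p0 ps] /andP[q0 qs]; apply: (AB (p, q)); split => /=.
      by apply: Aa; rewrite /ball_ /= sub0r normrN ger0_norm// (le_lt_trans ps).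
    by apply: Bb; rewrite /ball_ /= sub0r normrN ger0_norm// (le_lt_trans qs).
  pose g (p : R) := f (p *: v' + (s *: w' + x)) - f (p *: v' + x).
  pose dg (p : R) := 'D_v' f (p *: v' + (s *: w' + x)) - 'D_v' f (p *: v' + x).
  have ss : 0 <= s <= s by rewrite lexx ltW.
  have s00 : 0 <= (0 : R) <= s by rewrite lexx ltW.
  have gd p : 0 <= p <= s -> is_derive p 1 g (dg p).
    move=> ps; apply: is_deriveB; apply: is_derive_line; apply: diff_derivable; apply: Cf.1.
      by rewrite addrCA; exact: inU.
    by have := inU _ _ ps s00; rewrite scale0r add0r.
  have [p ps E1] := @mvt g dg 0 s (ltW s0) gd.
  pose k (q : R) := 'D_v' f (q *: w' + (p *: v' + x)).
  have kd q : 0 <= q <= s -> is_derive q 1 k ('D_w' ('D_v' f) (q *: w' + (p *: v' + x))).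
    move=> qs; apply: is_derive_line; apply: diff_derivable.
    by apply: (Cf.2 v').1; exact: inU.
  have [q qs E2] := @mvt k (fun q => 'D_w' ('D_v' f) (q *: w' + (p *: v' + x))) 0 s (ltW s0) kd.
  exists (p, q) => /=; first by rewrite ps.
  rewrite !subr0 in E1 E2.
  have -> : f (s *: v' + (s *: w' + x)) - f (s *: v' + x) - f (s *: w' + x) + f x = g s - g 0.
    by rewrite /g !scale0r !add0r; ring.
  have -> : g s - g 0 = s * (k s - k 0).
    by rewrite E1 mulrC /dg /k scale0r add0r addrCA.
  by rewrite E2 mulrCA mulrC.
(* If the mixed derivatives differed, both would lie within half their distance of one common value,
   contradicting the triangle inequality. *)
have close (A B C : R) : `|B - C| < `|A - B| / 2 -> `|A - C| < `|A - B| / 2 -> False.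
  by move=> H1 H2; have := ler_distD C A B; rewrite [`|C - B|]distrC; lra.
have diffq (k a b c d D D' : R) : k != 0 -> a - b - c + d = k * k * D ->
    a - c - b + d = k * k * D' -> D = D'.
  move=> k0 H1 H2; have kk : k * k != 0 by rewrite mulf_neq0.
  by apply: (mulfI kk); rewrite -H1 -H2; ring.
have neq_false (A B : R) : (A != B -> False) -> A = B by case: (eqVneq A B) => // ne /(_ isT).
apply: neq_false => ne.
set d := `|'D_v ('D_w f) x - 'D_w ('D_v f) x|; have d0 : 0 < d by rewrite normr_gt0 subr_eq0.
have near_close v' w' : exists2 e : R, 0 < e & forall s p q, 0 < s < e ->
    0 <= p <= s -> 0 <= q <= s ->
    `|'D_w' ('D_v' f) x - 'D_w' ('D_v' f) (q *: w' + (p *: v' + x))| < d / 2.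
  have c : {for (0 : R, 0 : R), continuous (fun p : R * R => 'D_w' ('D_v' f) (p.2 *: w' + (p.1 *: v' + x)))}.
    have c1 : {for (0 : R, 0 : R), continuous (fun p : R * R => p.2 *: w' + (p.1 *: v' + x))}.
      apply: cvgD; first by apply: cvgZ; [exact: cvg_snd|exact: cvg_cst].
      apply: cvgD; last exact: cvg_cst.
      by apply: cvgZ; [exact: cvg_fst|exact: cvg_cst].
    have c2 : {for (0 : R) *: w' + ((0 : R) *: v' + x), continuous ('D_w' ('D_v' f))}.
      by rewrite !scale0r !add0r; exact: ((Cf.2 v').2 w').
    exact: (@continuous_comp _ _ _ (fun p : R * R => p.2 *: w' + (p.1 *: v' + x)) _ (0, 0) c1 c2).
  have /cvgrPdist_lt /(_ (d/2)) := c.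
  rewrite divr_gt0// => /(_ isT) [[A B] [/= [a a0 Aa] [b b0 Bb]] AB].
  exists (Num.min a b); first by rewrite lt_min a0.
  move=> s p q /andP[s0]; rewrite lt_min => /andP[sa sb] /andP[p0 ps] /andP[q0 qs].
  have := AB (p, q); rewrite /= !scale0r !add0r; apply; split => /=.
    by apply: Aa; rewrite /ball_ /= sub0r normrN ger0_norm// (le_lt_trans ps).
  by apply: Bb; rewrite /ball_ /= sub0r normrN ger0_norm// (le_lt_trans qs).
have [e1 e10 H1] := der v w; have [e2 e20 H2] := der w v.
have [e3 e30 H3] := near_close v w; have [e4 e40 H4] := near_close w v.
pose s := Num.min (Num.min e1 e2) (Num.min e3 e4) / 2.
have m0 : 0 < Num.min (Num.min e1 e2) (Num.min e3 e4) by rewrite !lt_min e10 e20 e30.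
have s0 : 0 < s by rewrite divr_gt0.
have sm : s < Num.min (Num.min e1 e2) (Num.min e3 e4).
  by rewrite ltr_pdivrMr// ltr_pMr// ltr1n.
move: sm; rewrite !lt_min => /andP[/andP[s1 s2] /andP[s3 s4]].
have [|p /andP[p1 p2] E1] := H1 s; first by rewrite s0.
have [|q /andP[q1 q2] E2] := H2 s; first by rewrite s0.
have E : 'D_w ('D_v f) (p.2 *: w + (p.1 *: v + x)) = 'D_v ('D_w f) (q.2 *: v + (q.1 *: w + x)).
  rewrite [s *: w + (s *: v + x)]addrCA in E2.
  by apply: diffq E1 E2; rewrite gt_eqF.
have := H3 s _ _ _ p1 p2; rewrite s0 s3 => /(_ isT) L1.
have := H4 s _ _ _ q1 q2; rewrite s0 s4 => /(_ isT) L2.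
rewrite E in L1; exact: close L1 L2.
Qed.

Lemma schwarz V m n (U : set V) (f : V -> 'M[R]_(m, n)) v w x : open U -> U x ->
  Ck_on 2 U f -> 'D_v ('D_w f) x = 'D_w ('D_v f) x.
Proof.
move=> oU Ux Cf; apply/matrixP => i j.
have H v' w' : 'D_v' ('D_w' f) x i j = 'D_v' ('D_w' (fun y => f y i j)) x.
  rewrite derive_mxE; last exact: (Cf.2 w').1.
  apply: near_eq_derive; apply: (open_near_eq oU) => // y Uy.
  by rewrite derive_mxE//; exact: Cf.1.
have Cij : Ck_on 2 U (fun y => f y i j) by have /(Ck_on_mx 2 f oU) := Cf; apply.
exact: etrans (H v w) (etrans (schwarzR v w oU Ux Cij) (esym (H w v))).
Qed.

(** Bilinearity in the form in which it gets differentiated: when [B] also depends on a base point,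
    [B (p x) (a x) (b x)] becomes a finite sum of scalars times functions of [p x] alone. Inner
    products, Christoffel forms and second fundamental forms are all handled this way. *)
Definition bilin_expand n W (B : 'rV[R]_n -> 'rV[R]_n -> W) :=
  forall a b, B a b = \sum_i \sum_j (a 0 i * b 0 j) *: B (delta_mx 0 i) (delta_mx 0 j).

Lemma bilin_expandDl n W (B : 'rV[R]_n -> 'rV[R]_n -> W) a a' b : bilin_expand B ->
  B (a + a') b = B a b + B a' b.
Proof.
move=> H; rewrite H [B a b]H [B a' b]H -big_split; apply: eq_bigr => i _.
rewrite -big_split; apply: eq_bigr => j _ /=.
by rewrite -scalerDl mxE mulrDl.
Qed.

Lemma bilin_expandDr n W (B : 'rV[R]_n -> 'rV[R]_n -> W) a b b' : bilin_expand B ->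
  B a (b + b') = B a b + B a b'.
Proof.
move=> H; rewrite H [B a b]H [B a b']H -big_split; apply: eq_bigr => i _.
rewrite -big_split; apply: eq_bigr => j _ /=.
by rewrite -scalerDl mxE mulrDr.
Qed.

Lemma Ck_on_bilin k V n m W (B : 'rV[R]_m -> 'rV[R]_n -> 'rV[R]_n -> W)
    (U : set V) (U' : set 'rV[R]_m) (p : V -> 'rV[R]_m) (a b : V -> 'rV[R]_n) :
  open U -> open U' -> (forall x, U x -> U' (p x)) ->
  (forall y, bilin_expand (B y)) ->
  (forall c d, Ck_on k U' (fun y => B y c d)) ->
  Ck_on k U p -> Ck_on k U a -> Ck_on k U b ->
  Ck_on k U (fun x => B (p x) (a x) (b x)).
Proof.
move=> oU oU' UU' BE CB Cp Ca Cb.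
suff H : Ck_on k U (fun x => \sum_i \sum_j
    (a x 0 i * b x 0 j) *: B (p x) (delta_mx 0 i) (delta_mx 0 j)).
  by apply: (Ck_on_ext oU _ H) => x _; rewrite [RHS]BE.
apply: Ck_on_sum => // i; apply: Ck_on_sum => // j; apply: Ck_on_scale => //.
  apply: Ck_onM => //; first by have /(Ck_on_mx k a oU) := Ca; apply.
  by have /(Ck_on_mx k b oU) := Cb; apply.
exact: (Ck_on_comp oU oU' UU' Cp (CB _ _)).
Qed.

Lemma derive_sumf V W I (s : seq I) (f : I -> V -> W) v x :
  (forall i, differentiable (f i) x) ->
  differentiable (fun y => \sum_(i <- s) f i y) x /\
  'D_v (fun y => \sum_(i <- s) f i y) x = \sum_(i <- s) 'D_v (f i) x.
Proof.
move=> df; elim: s => [|i s [IHd IH]].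
  rewrite (_ : (fun y => _) = cst 0); last by apply/funext => y; rewrite big_nil.
  by rewrite big_nil derive_cst; split => //; exact: differentiable_cst.
rewrite (_ : (fun y => _) = f i + (fun y => \sum_(j <- s) f j y)); last first.
  by apply/funext => y; rewrite big_cons.
split; first exact: differentiableD.
by rewrite deriveD ?big_cons ?IH//; exact: diff_derivable.
Qed.

(** A Leibniz rule with three terms, the first one for the moving base point. Metric compatibility
    and the curvature commutator along a map both come from it. *)
Lemma derive_bilin V n m W (B : 'rV[R]_m -> 'rV[R]_n -> 'rV[R]_n -> W)
    (p : V -> 'rV[R]_m) (a b : V -> 'rV[R]_n) x v :
  (forall y, bilin_expand (B y)) ->
  (forall c d, differentiable (fun y => B y c d) (p x)) ->
  differentiable p x -> differentiable a x -> differentiable b x ->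
  differentiable (fun y => B (p y) (a y) (b y)) x /\
  'D_v (fun y => B (p y) (a y) (b y)) x =
    'D_('D_v p x) (fun y => B y (a x) (b x)) (p x)
    + B (p x) ('D_v a x) (b x) + B (p x) (a x) ('D_v b x).
Proof.
move=> BE dB dp da db.
have dai i : differentiable (fun y => a y 0 i) x.
  exact: (differentiable_comp da (differentiable_coord _ _ _)).
have dbi i : differentiable (fun y => b y 0 i) x.
  exact: (differentiable_comp db (differentiable_coord _ _ _)).
have dBp c d : differentiable (fun y => B (p y) c d) x.
  exact: (differentiable_comp dp (dB c d)).
pose T i j y := (a y 0 i * b y 0 j) *: B (p y) (delta_mx 0 i) (delta_mx 0 j).
have dT i j : differentiable (T i j) x.
  by apply: differentiable_scale => //; exact: differentiableM.
have -> : (fun y => B (p y) (a y) (b y)) = (fun y => \sum_i \sum_j T i j y).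
  by apply/funext => y; rewrite [LHS]BE.
have dTi i : differentiable (fun y => \sum_j T i j y) x by have [] := derive_sumf (index_enum 'I_n) v (dT i).
have [d1 d2] := derive_sumf (index_enum 'I_n) v dTi; split => //; rewrite d2.
rewrite [B (p x) ('D_v a x) _]BE [B (p x) _ ('D_v b x)]BE.
rewrite (_ : (fun y => B y (a x) (b x)) = fun y => \sum_i \sum_j
   (a x 0 i * b x 0 j) *: B y (delta_mx 0 i) (delta_mx 0 j)); last by apply/funext => y; rewrite [LHS]BE.
pose S i j y := (a x 0 i * b x 0 j) *: B y (delta_mx 0 i) (delta_mx 0 j).
have dS i j : differentiable (S i j) (p x) by apply: differentiableZ.
have dSi i : differentiable (fun y => \sum_j S i j y) (p x) by have [] := derive_sumf (index_enum 'I_n) ('D_v p x) (dS i).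
have [_ ->] := derive_sumf (index_enum 'I_n) ('D_v p x) dSi.
rewrite -!big_split; apply: eq_bigr => i _ /=.
have [_ ->] := derive_sumf (index_enum 'I_n) v (dT i).
have [_ ->] := derive_sumf (index_enum 'I_n) ('D_v p x) (dS i).
rewrite -!big_split; apply: eq_bigr => j _ /=.
rewrite derive_scale//; last exact: differentiableM.
rewrite (@deriveM _ _ (fun y => a y 0 i) (fun y => b y 0 j)); try exact: diff_derivable.
rewrite (@deriveZ _ _ _ (fun y => B y (delta_mx 0 i) (delta_mx 0 j))); last exact: diff_derivable.
rewrite (@derive_comp _ _ _ _ p (fun y => B y (delta_mx 0 i) (delta_mx 0 j)))//.
rewrite -(derive_mxE _ _ _ da) -(derive_mxE _ _ _ db).
have AC (x1 x2 x3 : W) : x1 + x2 + x3 = x3 + x2 + x1.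
  by rewrite addrC [x1 + _]addrC addrA.
rewrite scalerDl; apply: etrans; first exact: AC.
by congr (_ + _ *: _ + _); exact: mulrC.
Qed.

End LineDerivatives.

(** * Integrals, compactness and Taylor bounds on intervals *)

Section RealAnalysis.
Context {R : realType}.
Notation mu := (@lebesgue_measure R).

Lemma open_oo (c d : R) : open [set x : R | c < x < d].
Proof. by rewrite -set_itvoo; exact: interval_open. Qed.

Lemma near_oo (c d t : R) : c < t < d -> \forall s \near t, c < s < d.
Proof. by move=> ctd; apply: open_nbhs_nbhs; split => //; exact: open_oo. Qed.

Lemma open_interval_enlarge (I : set R) (a b : R) : open I -> is_interval I ->
  I a -> I b -> exists c d, [/\ c < a, c < b, a < d, b < d & `[c, d] `<=` I].
Proof.
move=> oI iI Ia Ib.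
have ext x : I x -> exists2 e : R, 0 < e & I (x - e) /\ I (x + e).
  move=> Ix; have : nbhs x I by exact: open_nbhs_nbhs.
  move=> /nbhs_ballP[e /= e0 be]; exists (e / 2); first by rewrite divr_gt0.
  have e2 : `|e / 2| < e by rewrite ger0_norm ?divr_ge0 ?ltW// ltr_pdivrMr// ltr_pMr// ltr1n.
  split; apply: be; rewrite /ball/=; first by rewrite opprB addrC subrK.
  by rewrite opprD addrA subrr sub0r normrN.
have [e e0 [Ia1 Ia2]] := ext _ Ia; have [e' e'0 [Ib1 Ib2]] := ext _ Ib.
exists (Num.min (a - e) (b - e')), (Num.max (a + e) (b + e')).
rewrite !gt_min !lt_max; split.
- by rewrite gtrBl e0.
- by rewrite gtrBl e'0 orbT.
- by rewrite ltrDl e0.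
- by rewrite ltrDl e'0 orbT.
- move=> x; rewrite /= in_itv/= => xcd; apply: (iI _ _ _ _ x xcd).
    by rewrite minEle; case: ifP.
  by rewrite maxEle; case: ifP.
Qed.

(** With [F] the integral from a common left end [c] below both [a] and [t], [oint f a] equals
    [F - F a] near [t], whichever of [a] and [t] is larger; the fundamental theorem then applies to
    [F]. *)
Lemma is_derive_oint (I : set R) (f : R -> R) (a t : R) : open I -> is_interval I ->
  I a -> I t -> (forall x, I x -> {for x, continuous f}) ->
  is_derive t 1 (oint f a) (f t).
Proof.
move=> oI iI Ia It cf.
have [c [d [ca ct ad td cdI]]] := open_interval_enlarge oI iI Ia It.
have fi : mu.-integrable `[c, d] (EFin \o f).
  apply: continuous_compact_integrable; first exact: segment_compact.
  apply: continuous_in_subspaceT => x; rewrite inE => /cdI; exact: cf.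
pose F s := \int[mu]_(x in `[c, s]) f x.
have ointE s : c < s < d -> oint f a s = F s - F a.
  move=> /andP[cs sd]; rewrite /oint.
  have fis u : u < d -> mu.-integrable `[c, u] (EFin \o f).
    move=> ud; apply: integrableS fi => //.
    by apply: subset_itvl; rewrite bnd_simp ltW.
  have H u v : c < u -> u <= v -> v < d -> F v - F u = \int[mu]_(x in `[u, v]) f x.
    move=> cu uv vd; rewrite /F (Rintegral_itvB (fis _ vd)) ?bnd_simp//; last exact: ltW.
    rewrite Rintegral_itv_obnd_cbnd//.
    apply: integrableS (fis _ vd) => //.
    move=> x /=; rewrite !in_itv/= => /andP[ux ->].
    by rewrite (le_trans (ltW cu)) ?ltW.
  case: ifPn => [as_|]; first by rewrite H.
  by rewrite -ltNge => sa; rewrite -H ?opprB// ltW.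
have [dF F'] := @continuous_FTC1_closed R f c t d td fi ct (cf _ It).
have dFt : is_derive t 1 F (f t) by split; [exact: dF|rewrite -derive1E; exact: F'].
have H : is_derive t 1 (F - cst (F a)) (f t - 0) by apply: is_deriveB.
rewrite subr0 in H.
apply: near_eq_is_derive H.
have : \forall s \near t, c < s < d by apply: near_oo; rewrite ct.
by apply: filterS => s sd; rewrite ointE.
Qed.

Lemma is_derive_le (f g df dg : R -> R) (a b : R) : a <= b ->
  (forall t, a <= t <= b -> is_derive t 1 f (df t)) ->
  (forall t, a <= t <= b -> is_derive t 1 g (dg t)) ->
  (forall t, a <= t <= b -> df t <= dg t) ->
  f b - f a <= g b - g a.
Proof.
move=> ab fd gd le.
have H t : a <= t <= b -> is_derive t 1 (g - f) (dg t - df t).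
  by move=> tab; apply: is_deriveB; [exact: gd|exact: fd].
have [c cab] := @mvt _ (g - f) (fun t => dg t - df t) a b ab H.
rewrite -subr_ge0 => E.
have -> : g b - g a - (f b - f a) = (g - f) b - (g - f) a by rewrite !fctE; ring.
by rewrite E mulr_ge0 ?subr_ge0// le.
Qed.

Lemma integral_derive (f F : R -> R) (a b e : R) : 0 < e -> a <= b ->
  (forall t, a - e < t < b + e -> {for t, continuous f}) ->
  (forall t, a <= t <= b -> is_derive t 1 F (f t)) ->
  \int[mu]_(t in `[a, b]) f t = F b - F a.
Proof.
move=> e0 ab cf dF.
pose I : set R := [set x : R | a - e < x < b + e].
have I1 t : I t -> a - e < t < b + e by [].
have I2 t : a - e < t < b + e -> I t by [].
have oI : open I by exact: open_oo.
have iI : is_interval I.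
  move=> x y /andP[x1 _] /andP[_ y2] z /andP[xz zy].
  by rewrite /I /= (lt_le_trans x1 xz) (le_lt_trans zy y2).
have Iab t : a <= t <= b -> I t.
  by move=> /andP[at_ tb]; apply: I2; rewrite (lt_le_trans _ at_) ?gtrBl// (le_lt_trans tb)// ltrDl.
have Ia : I a by apply: Iab; rewrite lexx.
have dG t : a <= t <= b -> is_derive t 1 (oint f a) (f t).
  move=> tab; apply: (is_derive_oint oI iI Ia (Iab _ tab)) => x.
  by move=> /I1; exact: cf.
(* Two functions with the same derivative have the same increment: [is_derive_le] is used in both
   directions. *)
have E : oint f a b - oint f a a = F b - F a.
  by apply/eqP; rewrite eq_le; apply/andP; split; apply: is_derive_le ab _ _ _ => //.
rewrite -E /oint ab lexx set_itv1 Rintegral_set1 subr0//.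
Qed.

Lemma integral_le_derive (f F dF : R -> R) (a b e : R) : 0 < e -> a <= b ->
  (forall t, a - e < t < b + e -> {for t, continuous f}) ->
  (forall t, a <= t <= b -> is_derive t 1 F (dF t)) ->
  (forall t, a <= t <= b -> f t <= dF t) ->
  \int[mu]_(t in `[a, b]) f t <= F b - F a.
Proof.
move=> e0 ab cf dFt le.
pose I : set R := [set x : R | a - e < x < b + e].
have I1 t : I t -> a - e < t < b + e by [].
have I2 t : a - e < t < b + e -> I t by [].
have oI : open I by exact: open_oo.
have iI : is_interval I.
  move=> x y /andP[x1 _] /andP[_ y2] z /andP[xz zy].
  by rewrite /I /= (lt_le_trans x1 xz) (le_lt_trans zy y2).
have Iab t : a <= t <= b -> I t.
  by move=> /andP[at_ tb]; apply: I2; rewrite (lt_le_trans _ at_) ?gtrBl// (le_lt_trans tb)// ltrDl.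
have Ia : I a by apply: Iab; rewrite lexx.
have dG t : a <= t <= b -> is_derive t 1 (oint f a) (f t).
  move=> tab; apply: (is_derive_oint oI iI Ia (Iab _ tab)) => x.
  by move=> /I1; exact: cf.
rewrite (integral_derive e0 ab cf dG).
exact: is_derive_le ab dG dFt le.
Qed.

(** The supremum [s] of the [t] with [P a t] is reached, because an interval straddling [s] can be
    appended to one ending just before it; the same interval continues past [s] unless [s = b]. Only
    intervals containing their tag are tested, which is what a derivative, or a frame parallel at
    one point, can control. *)
Lemma cousin (P : R -> R -> Prop) (a b : R) : a <= b ->
  (forall x y z, a <= x <= y -> y <= z <= b -> P x y -> P y z -> P x z) ->
  (forall t, a <= t <= b -> exists2 d, 0 < d & forall x y,
     a <= x <= t -> t <= y <= b -> t - d < x -> y < t + d -> P x y) ->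
  P a b.
Proof.
move=> ab Padd Ploc.
pose S := [set t | a <= t <= b /\ P a t].
have Sa : S a.
  split; first by rewrite lexx.
  have [|d d0 H] := Ploc a; first by rewrite lexx.
  by apply: H; rewrite ?lexx ?gtrBl ?ltrDl.
have hS : has_sup S by split; [exists a|exists b => t [/andP[]]].
pose s := sup S.
have as_ : a <= s by apply: sup_upper_bound.
have sb : s <= b by apply: sup_le_ub; [exists a|move=> t [/andP[]]].
have [|d d0 H] := Ploc s; first by rewrite as_.
have [t [/andP[at_ tb] Pt] st] := sup_adherent d0 hS.
have ts : t <= s by apply: sup_upper_bound => //; split => //; rewrite at_.
have S_ y : s <= y -> y <= b -> y < s + d -> S y.
  move=> sy yb yd; split; first by rewrite yb (le_trans as_).
  apply: (Padd a t y) => //; first by rewrite lexx.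
    by rewrite yb (le_trans ts).
  by apply: H => //; rewrite ?at_ ?sy.
have [sb'|bs] := ltP s b; last first.
  have -> : b = s by apply/eqP; rewrite eq_le bs.
  by have [] := S_ s (lexx _) sb; rewrite ?ltrDl.
pose y := Num.min b (s + d / 2).
have sy : s < y by rewrite lt_min sb' ltrDl divr_gt0.
have yb : y <= b by rewrite ge_min lexx.
have yd : y < s + d by rewrite gt_min ltrD2l ltr_pdivrMr// ltr_pMr// ltr1n orbT.
have : y <= s by apply: sup_upper_bound => //; exact: S_ (ltW sy) yb yd.
by rewrite leNgt sy.
Qed.

(** Compactness of [[a, b]] makes the size of the neighbourhood of [s = 0] uniform in [t]. *)
Lemma tube (P : R * R -> Prop) (a b : R) :
  (forall t, a <= t <= b -> \forall z \near ((0 : R), t), P z) ->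
  exists2 d, 0 < d & forall s t, `|s| < d -> a <= t <= b -> P (s, t).
Proof.
move=> H.
have /compact_near_coveringP/(_ R (nbhs (0 : R)) (fun s t => P (s, t))) := @segment_compact R a b.
have ok t : `[a, b]%classic t -> \forall t' \near t & s \near (0 : R), P (s, t').
  rewrite /= in_itv/= => /H[[A B] /= [nA nB] AB].
  by exists (B, A) => // -[x y] /= [Bx Ay]; apply: AB.
move=> /(_ _ ok) /nbhs_ballP[d /= d0 Hd]; exists d => // s t sd tab.
apply: (Hd s) => /=; last exact: tab.
by rewrite /ball/= sub0r normrN.
Qed.

Lemma taylor2_le (q dq ddq : R -> R) (c s : R) : 0 <= s ->
  (forall x, 0 <= x <= s -> is_derive x 1 q (dq x)) ->
  (forall x, 0 <= x <= s -> is_derive x 1 dq (ddq x)) ->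
  (forall x, 0 <= x <= s -> ddq x <= c) ->
  q s <= q 0 + s * dq 0 + s ^+ 2 / 2 * c.
Proof.
move=> s0 d1 d2 le.
have lin (x y : R) : is_derive x 1 (fun x : R => x * y) y.
  have : is_derive x 1 (id * cst y) (x *: (0:R) + y *: (1:R)) by apply: is_deriveM.
  by rewrite scaler0 add0r [_ *: _]mulr1.
have H1 x : 0 <= x <= s -> dq x <= dq 0 + x * c.
  move=> /andP[x0 xs].
  have : dq x - dq 0 <= x * c - 0 * c.
    apply: (@is_derive_le dq (fun x => x * c) ddq (fun=> c) 0 x) => // t /andP[t0 tx].
    - by apply: d2; rewrite t0 (le_trans tx).
    - by apply: le; rewrite t0 (le_trans tx).
  by rewrite mul0r subr0 lerBlDl.
have H2 : q s - q 0 <= (s * dq 0 + s ^+ 2 / 2 * c) - (0 * dq 0 + 0 ^+ 2 / 2 * c).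
  apply: (@is_derive_le q (fun x => x * dq 0 + x ^+ 2 / 2 * c) dq (fun x => dq 0 + x * c)) => //.
  move=> t _.
  have sq : is_derive t 1 (fun x : R => x ^+ 2 / 2 * c) (t * c).
    have : is_derive t 1 ((id ^+ 2) * cst (2^-1 * c)) ((t ^+ 2) *: (0:R) + (2^-1 * c) *: ((2 * t ^+ 1) *: (1:R))).
      by apply: is_deriveM.
    rewrite scaler0 add0r.
    have -> : (2^-1 * c) *: ((2 * t ^+ 1) *: (1 : R)) = t * c.
      rewrite [_ *: (1 : R)]mulr1 expr1 [_ *: _]mulrCA; by field.
    by rewrite (_ : id ^+ 2 * _ = fun x : R => x ^+ 2 / 2 * c)//; apply/funext => x; rewrite !fctE mulrA.
  exact: is_deriveD.
by move: H2; rewrite expr0n /= !mul0r !addr0 subr0 lerBlDl addrA.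
Qed.

End RealAnalysis.

(** * The Levi-Civita connection *)

Section Inner.
Context {R : realType} {n : nat}.
Implicit Types (G : 'M[R]_n) (a b c : 'rV[R]_n).

Lemma innerDl G a b c : inner G (a + b) c = inner G a c + inner G b c.
Proof. by rewrite /inner !mulmxDl mxE. Qed.

Lemma innerZl G (k : R) a c : inner G (k *: a) c = k * inner G a c.
Proof. by rewrite /inner -!scalemxAl mxE. Qed.

Lemma innerDr G a b c : inner G c (a + b) = inner G c a + inner G c b.
Proof. by rewrite /inner linearD mulmxDr mxE. Qed.

Lemma innerZr G (k : R) a c : inner G c (k *: a) = k * inner G c a.
Proof. by rewrite /inner linearZ -scalemxAr mxE. Qed.

Lemma innerNl G a c : inner G (- a) c = - inner G a c.
Proof. by rewrite -scaleN1r innerZl mulN1r. Qed.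

Lemma innerNr G a c : inner G c (- a) = - inner G c a.
Proof. by rewrite -scaleN1r innerZr mulN1r. Qed.

Lemma innerBl G a b c : inner G (a - b) c = inner G a c - inner G b c.
Proof. by rewrite innerDl innerNl. Qed.

Lemma innerBr G a b c : inner G c (a - b) = inner G c a - inner G c b.
Proof. by rewrite innerDr innerNr. Qed.

Lemma inner0l G c : inner G 0 c = 0.
Proof. by rewrite /inner !mul0mx mxE. Qed.

Lemma inner0r G c : inner G c 0 = 0.
Proof. by rewrite /inner trmx0 mulmx0 mxE. Qed.

Lemma inner_suml G I (s : seq I) (P : pred I) (F : I -> 'rV[R]_n) c :
  inner G (\sum_(i <- s | P i) F i) c = \sum_(i <- s | P i) inner G (F i) c.
Proof.
apply: (big_morph (inner G ^~ c)) => [a b|]; [exact: innerDl|exact: inner0l].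
Qed.

Lemma inner_sumr G I (s : seq I) (P : pred I) (F : I -> 'rV[R]_n) c :
  inner G c (\sum_(i <- s | P i) F i) = \sum_(i <- s | P i) inner G c (F i).
Proof.
apply: (big_morph (inner G c)) => [a b|]; [exact: innerDr|exact: inner0r].
Qed.

Lemma innerC G a b : G^T = G -> inner G a b = inner G b a.
Proof.
move=> GT; rewrite /inner; transitivity ((b *m G *m a^T)^T 0 0); last by rewrite mxE.
by rewrite !trmx_mul trmxK GT mulmxA.
Qed.

Lemma inner_delta G i j : inner G (delta_mx 0 i) (delta_mx 0 j) = G i j.
Proof. by rewrite /inner -rowE trmx_delta -colE !mxE. Qed.

Lemma inner_expand G : bilin_expand (inner G).
Proof.
move=> a b; rewrite {1}(row_sum_delta a) inner_suml; apply: eq_bigr => i _.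
rewrite {1}(row_sum_delta b) inner_sumr; apply: eq_bigr => j _.
by rewrite innerZl innerZr mulrA.
Qed.

Definition posdef G := forall v : 'rV[R]_n, v != 0 -> 0 < inner G v v.

Lemma posdef_ge0 G v : posdef G -> 0 <= inner G v v.
Proof.
move=> H; have [->|/H/ltW//] := eqVneq v 0; by rewrite inner0l.
Qed.

Lemma posdef_eq0 G v : posdef G -> inner G v v = 0 -> v = 0.
Proof.
move=> H E; apply/eqP; apply/negPn/negP => /H; by rewrite E ltxx.
Qed.

Lemma inner_nondegenerate G a b : posdef G ->
  (forall z, inner G a z = inner G b z) -> a = b.
Proof.
move=> H E; apply/eqP; rewrite -subr_eq0; apply/eqP; apply: (posdef_eq0 H).
by rewrite innerBl E subrr.
Qed.

Lemma posdef_unit G : posdef G -> G \in unitmx.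
Proof.
move=> H; rewrite -row_free_unit; apply: inj_row_free => v vG.
by apply: (posdef_eq0 H); rewrite /inner vG mul0mx mxE.
Qed.

Lemma cauchy_schwarz G a b : G^T = G -> posdef G ->
  inner G a b ^+ 2 <= inner G a a * inner G b b.
Proof.
move=> GT H; have [->|b0] := eqVneq b 0; first by rewrite !inner0r expr0n mulr0.
have bb := H _ b0.
(* The squared norm of [|b|^2 a - <a, b> b] is [|b|^2 (|a|^2 |b|^2 - <a, b>^2)]. *)
have := posdef_ge0 (inner G b b *: a - inner G a b *: b) H.
rewrite innerBl !innerBr !innerZl !innerZr (innerC b a GT).
set A := inner G a a; set B := inner G b b; set C := inner G a b => le.
have : 0 <= B * (A * B - C ^+ 2).
  by apply: le_trans le _; rewrite le_eqVlt; apply/orP; left; apply/eqP; ring.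
by rewrite pmulr_rge0// subr_ge0.
Qed.

End Inner.

Section LeviCivita.
Context {R : realType} {n : nat} (U : set 'rV[R]_n) (G : 'rV[R]_n -> 'M[R]_n).

Record metric_on : Prop := MetricOn {
  metric_on_open : open U;
  metric_on_smooth : smooth_on U G;
  metric_on_sym : forall u, U u -> (G u)^T = G u;
  metric_on_pos : forall u, U u -> posdef (G u) }.

Hypothesis HG : metric_on.
Local Notation Gam := (christoffel_form G).

Let oU : open U := metric_on_open HG.
Let symG u : U u -> (G u)^T = G u := metric_on_sym HG (u:=u).
Let posG u : U u -> posdef (G u) := metric_on_pos HG (u:=u).

Lemma smooth_on_inner b c : smooth_on U (fun y => inner (G y) b c).
Proof.
move=> k; have /(Ck_on_mx k G oU) CG := metric_on_smooth HG k.
have H : Ck_on k U (fun y => \sum_i \sum_j (b 0 i * c 0 j) *: G y i j).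
  by apply: Ck_on_sum => // i; apply: Ck_on_sum => // j; apply: Ck_on_scale => //; exact: Ck_on_cst.
apply: (Ck_on_ext oU _ H) => y _; rewrite inner_expand.
by apply: eq_bigr => i _; apply: eq_bigr => j _; rewrite inner_delta.
Qed.

Lemma derive_inner_expand u a b c : U u ->
  'D_a (fun y => inner (G y) b c) u =
    \sum_i \sum_j \sum_k a 0 i * b 0 j * c 0 k * dG G i j k u.
Proof.
move=> Uu; rewrite {1}(row_sum_delta a) derive_sumr; last first.
  exact: smooth_on_diff (smooth_on_inner b c) Uu.
apply: eq_bigr => i _.
have dGjk j k : differentiable (fun y => G y j k) u.
  by have /(Ck_on_mx 1 G oU)/(_ j k)[H _] := metric_on_smooth HG 1; exact: H.
have E : (fun y => inner (G y) b c) = (fun y => \sum_j \sum_k (b 0 j * c 0 k) *: G y j k).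
  apply/funext => y; rewrite inner_expand.
  by apply: eq_bigr => j _; apply: eq_bigr => k _; rewrite inner_delta.
have dz j k : differentiable (fun y => (b 0 j * c 0 k) *: G y j k) u by exact: differentiableZ.
have dj j : differentiable (fun y => \sum_k (b 0 j * c 0 k) *: G y j k) u.
  by have [] := derive_sumf (index_enum 'I_n) a (dz j).
rewrite E; have [_ ->] := derive_sumf (index_enum 'I_n) (delta_mx 0 i) dj.
rewrite scaler_sumr; apply: eq_bigr => j _.
have [_ ->] := derive_sumf (index_enum 'I_n) (delta_mx 0 i) (dz j).
rewrite scaler_sumr; apply: eq_bigr => k _.
rewrite (@deriveZ _ _ _ (fun y => G y j k)); last exact: diff_derivable.
by rewrite /dG scalerA mulrA.
Qed.

(** The bridge from the coordinate definition of the Christoffel symbols to geometry. Symmetry,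
    metric compatibility, the connection of a warped product and that of an immersed manifold are
    all read off from it by testing against an arbitrary [z]. *)
Lemma koszul u v w z : U u ->
  2 * inner (G u) (Gam u v w) z =
    'D_v (fun y => inner (G y) w z) u + 'D_w (fun y => inner (G y) v z) u
    - 'D_z (fun y => inner (G y) v w) u.
Proof.
move=> Uu.
(* [K] lists the right-hand side of the identity against the basis vectors; the definition of the
   symbols says that [Gam u v w] is half of [K] with its index raised. *)
pose K : 'rV[R]_n := \row_l ('D_v (fun y => inner (G y) w (delta_mx 0 l)) u
  + 'D_w (fun y => inner (G y) v (delta_mx 0 l)) u
  - 'D_(delta_mx 0 l) (fun y => inner (G y) v w) u).
have dl (j : 'I_n) (F : 'I_n -> R) : \sum_k (delta_mx 0 j : 'rV[R]_n) 0 k * F k = F j.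
  rewrite (bigD1 j)//= big1 ?addr0; first by rewrite mxE !eqxx mul1r.
  by move=> k kj; rewrite mxE (negbTE kj) andbF mul0r.
have E : Gam u v w = 2^-1 *: (K *m (invmx (G u))^T).
  apply/rowP => k; rewrite !mxE.
  have -> : \sum_i \sum_j christoffel G i j k u * v 0 i * w 0 j =
     \sum_i \sum_j \sum_l 2^-1 * (invmx (G u) k l *
        (v 0 i * w 0 j * (dG G i j l u + dG G j i l u - dG G l i j u))).
    apply: eq_bigr => i _; apply: eq_bigr => j _; rewrite /christoffel -big_distrr/= -!mulrA big_distrl/=.
    by congr (_ * _); apply: eq_bigr => l _; ring.
  rewrite big_distrr/=.
  under eq_bigr do rewrite exchange_big.
  rewrite exchange_big; apply: eq_bigr => l _ /=.
  have KE : K 0 l = \sum_i \sum_j v 0 i * w 0 j * (dG G i j l u + dG G j i l u - dG G l i j u).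
    rewrite mxE !derive_inner_expand//.
    have S1 : \sum_i \sum_j \sum_k v 0 i * w 0 j * (delta_mx 0 l : 'rV[R]_n) 0 k * dG G i j k u
       = \sum_i \sum_j v 0 i * w 0 j * dG G i j l u.
      apply: eq_bigr => i _; apply: eq_bigr => j _.
      rewrite -(dl l (fun k => v 0 i * w 0 j * dG G i j k u)).
      by apply: eq_bigr => k' _; ring.
    have S2 : \sum_i \sum_j \sum_k w 0 i * v 0 j * (delta_mx 0 l : 'rV[R]_n) 0 k * dG G i j k u
       = \sum_i \sum_j v 0 i * w 0 j * dG G j i l u.
      rewrite exchange_big; apply: eq_bigr => i _; apply: eq_bigr => j _.
      rewrite -(dl l (fun k => v 0 i * w 0 j * dG G j i k u)).
      by apply: eq_bigr => k' _; ring.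
    have S3 : \sum_i \sum_j \sum_k (delta_mx 0 l : 'rV[R]_n) 0 i * v 0 j * w 0 k * dG G i j k u
       = \sum_i \sum_j v 0 i * w 0 j * dG G l i j u.
      rewrite -(dl l (fun i => \sum_j \sum_k v 0 j * w 0 k * dG G i j k u)).
      apply: eq_bigr => i _; rewrite big_distrr; apply: eq_bigr => j _.
      by rewrite big_distrr; apply: eq_bigr => k' _; rewrite /=; ring.
    rewrite S1 S2 S3 -big_split -sumrB; apply: eq_bigr => i _ /=.
    by rewrite -big_split -sumrB; apply: eq_bigr => j _ /=; ring.
  rewrite [_^T l k]mxE KE [in RHS]mulrC -mulrA [RHS]mulrC -mulrA big_distrr/= big_distrr/=.
  apply: eq_bigr => i _; rewrite big_distrr/= big_distrr/=; apply: eq_bigr => j _.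
  by rewrite mulrCA.
rewrite E innerZl mulrA divff ?mul1r//.
have -> : (invmx (G u))^T = invmx (G u) by rewrite trmx_inv symG.
rewrite [X in X = _]/inner -(mulmxA K) mulVmx ?mulmx1; last exact: posdef_unit (posG Uu).
rewrite mxE.
have dlin a b : 'D_a (fun y => inner (G y) b z) u =
    \sum_l z 0 l * 'D_a (fun y => inner (G y) b (delta_mx 0 l)) u.
  have E' : (fun y => inner (G y) b z) = (fun y => \sum_l z 0 l *: inner (G y) b (delta_mx 0 l)).
    by apply/funext => y; rewrite {1}(row_sum_delta z) inner_sumr; apply: eq_bigr => l _; rewrite innerZr.
  have d l : differentiable (fun y => inner (G y) b (delta_mx 0 l)) u.
    exact: smooth_on_diff (smooth_on_inner _ _) Uu.
  have dz l : differentiable (fun y => z 0 l *: inner (G y) b (delta_mx 0 l)) u by exact: differentiableZ.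
  rewrite E'; have [_ ->] := derive_sumf (index_enum 'I_n) a dz.
  apply: eq_bigr => l _.
  by rewrite (@deriveZ _ _ _ (fun y => inner (G y) b (delta_mx 0 l)))//; exact: diff_derivable.
have Dz : 'D_z (fun y => inner (G y) v w) u =
    \sum_l z 0 l *: 'D_(delta_mx 0 l) (fun y => inner (G y) v w) u.
  rewrite {1}(row_sum_delta z) derive_sumr//.
  exact: smooth_on_diff (smooth_on_inner v w) Uu.
rewrite (dlin v w) (dlin w v) Dz.
rewrite -big_split -sumrB; apply: eq_bigr => l _ /=.
by rewrite !mxE mulrC mulrBr mulrDr.
Qed.

Lemma Gam_expand u : bilin_expand (Gam u).
Proof.
have key (F : 'I_n -> 'I_n -> R) (i0 j0 : 'I_n) :
    \sum_i \sum_j F i j * (delta_mx 0 i0 : 'rV[R]_n) 0 i * (delta_mx 0 j0 : 'rV[R]_n) 0 j = F i0 j0.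
  rewrite (bigD1 i0)//= [X in _ + X]big1 ?addr0; last first.
    move=> i ii0; apply: big1 => j _.
    by rewrite !mxE (negbTE ii0) andbF mulr0 mul0r.
  rewrite (bigD1 j0)//= big1 ?addr0; first by rewrite !mxE !eqxx !mulr1.
  by move=> j jj0; rewrite !mxE (negbTE jj0) andbF mulr0.
move=> a b; apply/rowP => k; rewrite mxE summxE; apply: eq_bigr => i _.
rewrite summxE; apply: eq_bigr => j _; rewrite !mxE key.
by rewrite [RHS]mulrC mulrA.
Qed.

Lemma GamC u v w : U u -> Gam u v w = Gam u w v.
Proof.
move=> Uu; apply: (inner_nondegenerate (posG Uu)) => z.
have t2 : (2 : R) != 0 by rewrite pnatr_eq0.
apply: (mulfI t2); rewrite !koszul//.
have -> : 'D_z (fun y => inner (G y) w v) u = 'D_z (fun y => inner (G y) v w) u.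
  by apply: near_eq_derive; apply: open_near_eq Uu => // y Uy; rewrite innerC ?symG.
by congr (_ - _); rewrite addrC.
Qed.

(** In the sum of the Koszul identities for [(a, b, c)] and [(a, c, b)] only the derivative in
    direction [a] survives. *)
Lemma Gam_compat u a b c : U u ->
  'D_a (fun y => inner (G y) b c) u =
    inner (G u) (Gam u a b) c + inner (G u) b (Gam u a c).
Proof.
move=> Uu.
have sw p q r : 'D_p (fun y => inner (G y) q r) u = 'D_p (fun y => inner (G y) r q) u.
  by apply: near_eq_derive; apply: open_near_eq Uu => // y Uy; rewrite innerC ?symG.
have := koszul a b c Uu; have := koszul a c b Uu.
rewrite [inner _ b _]innerC ?symG// (sw a c b) (sw c a b) (sw b a c).
have gen (x y p q r : R) : 2 * x = p + q - r -> 2 * y = p + r - q -> p = y + x by lra.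
exact: gen.
Qed.

Lemma smooth_on_Gam v w : smooth_on U (fun y => Gam y v w).
Proof.
move=> k; apply/(Ck_on_mx k _ oU) => i0 l.
suff H : Ck_on k U (fun y => \sum_i \sum_j christoffel G i j l y * v 0 i * w 0 j).
  by apply: (Ck_on_ext oU _ H) => y _; rewrite mxE.
have CdG i j l' : Ck_on k U (dG G i j l').
  by have /(Ck_on_mx k.+1 G oU)/(_ j l')[_ H] := metric_on_smooth HG k.+1; exact: H.
have Cinv : Ck_on k U (fun y => invmx (G y)).
  apply: Ck_on_invmx => //; last exact: metric_on_smooth.
  by move=> y Uy; apply: posdef_unit; exact: posG.
have /(Ck_on_mx k _ oU) Cinv' := Cinv.
apply: Ck_on_sum => // i; apply: Ck_on_sum => // j.
apply: Ck_onM => //; last exact: Ck_on_cst.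
apply: Ck_onM => //; last exact: Ck_on_cst.
apply: Ck_onM => //; first exact: Ck_on_cst.
apply: Ck_on_sum => // q; apply: Ck_onM => //.
by apply: Ck_onD => //; [apply: Ck_onD|apply: Ck_onN].
Qed.

Lemma christoffelE i j k :
  christoffel G i j k = fun y => Gam y (delta_mx 0 i) (delta_mx 0 j) 0 k.
Proof.
apply/funext => y; rewrite mxE (bigD1 i)//= [X in _ = _ + X]big1 ?addr0; last first.
  move=> i' ii'; apply: big1 => j' _.
  by rewrite !mxE (negbTE ii') andbF mulr0 mul0r.
rewrite (bigD1 j)//= big1 ?addr0; first by rewrite !mxE !eqxx !mulr1.
by move=> j' jj'; rewrite !mxE (negbTE jj') andbF mulr0.
Qed.

(** The vectors are read as constant fields, whose brackets vanish; this replaces the index sums of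
    [riem] by a formula free of indices. *)
Lemma riem_opE u v w z : U u ->
  riem_op G u v w z =
    'D_v (fun y => Gam y w z) u - 'D_w (fun y => Gam y v z) u
    + Gam u v (Gam u w z) - Gam u w (Gam u v z).
Proof.
move=> Uu.
have dc i j k : differentiable (christoffel G i j k) u.
  have /(Ck_on_mx 1 _ oU)/(_ 0 k) [H _] := smooth_on_Gam (delta_mx 0 i) (delta_mx 0 j) 1.
  by rewrite christoffelE; exact: H.
have D v' w' l : 'D_v' (fun y => Gam y w' z) u 0 l =
    \sum_i \sum_j \sum_k 'D_(delta_mx 0 i) (christoffel G j k l) u * v' 0 i * w' 0 j * z 0 k.
  have dG := smooth_on_diff (smooth_on_Gam w' z) Uu.
  rewrite {1}(row_sum_delta v') derive_sumr// summxE; apply: eq_bigr => i _.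
  rewrite mxE derive_mxE//.
  rewrite (_ : (fun y => Gam y w' z 0 l) = (fun y => \sum_j \sum_k (w' 0 j * z 0 k) *: christoffel G j k l y)); last first.
    by apply/funext => y; rewrite mxE; apply: eq_bigr => j _; apply: eq_bigr => k _; rewrite [RHS]mulrC mulrA.
  have dk j k : differentiable (fun y => (w' 0 j * z 0 k) *: christoffel G j k l y) u by exact: differentiableZ.
  have dj j : differentiable (fun y => \sum_k (w' 0 j * z 0 k) *: christoffel G j k l y) u.
    by have [] := derive_sumf (index_enum 'I_n) v' (dk j).
  have [_ ->] := derive_sumf (index_enum 'I_n) (delta_mx 0 i) dj.
  rewrite big_distrr; apply: eq_bigr => j _ /=.
  have [_ ->] := derive_sumf (index_enum 'I_n) (delta_mx 0 i) (dk j).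
  rewrite big_distrr; apply: eq_bigr => k _ /=.
  rewrite (@deriveZ _ _ _ (christoffel G j k l)); last exact: diff_derivable.
  have gen (A B C E : R) : A * ((B * C) *: E) = E * A * B * C.
    by rewrite [_ *: _]mulrC; ring.
  exact: gen.
have S a b l : Gam u a (Gam u b z) 0 l = \sum_i \sum_j \sum_k
    (\sum_q christoffel G j k q u * christoffel G i q l u) * a 0 i * b 0 j * z 0 k.
  rewrite mxE; apply: eq_bigr => i _.
  under eq_bigr => q _ do rewrite mxE big_distrr/=.
  rewrite exchange_big; apply: eq_bigr => j _ /=.
  under eq_bigr => q _ do rewrite big_distrr/=.
  rewrite exchange_big; apply: eq_bigr => k _ /=.
  rewrite !big_distrl/=; apply: eq_bigr => q _; ring.
apply/rowP => l; rewrite [LHS]mxE.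
rewrite mxE [X in _ = X + _]mxE [X in _ = X + _ + _]mxE (D v w l).
rewrite [X in _ = _ + X + _ + _]mxE [X in _ = _ + X]mxE (D w v l) (S v w l) (S w v l).
have exch (F : 'I_n -> 'I_n -> 'I_n -> R) : \sum_i \sum_j \sum_k F i j k =
    \sum_j \sum_i \sum_k F i j k by rewrite exchange_big.
rewrite [X in _ = _ - X + _ - _]exch [X in _ = _ - X]exch.
rewrite -sumrB -big_split -sumrB; apply: eq_bigr => i _ /=.
rewrite -sumrB -big_split -sumrB; apply: eq_bigr => j _ /=.
rewrite -sumrB -big_split -sumrB; apply: eq_bigr => k _ /=.
rewrite /riem sumrB !mulrDl !mulNr.
have gen (A B C E x y t : R) : A * x * y * t - B * x * y * t + (C * x * y * t - E * x * y * t) =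
   A * x * y * t - B * y * x * t + C * x * y * t - E * y * x * t by ring.
exact: gen.
Qed.

End LeviCivita.

(* A sealed copy of the directional derivative: unification would otherwise
   unfold the limit defining ['D_v f x] whenever two derivatives differ. *)
HB.lock Definition dir (R : realType) (V W : normedModType R) (v : V) (f : V -> W) (x : V) : W :=
  'D_v f x.

Section Dir.
Context {R : realType}.
Implicit Types V W : normedModType R.

Lemma dirE V W v (f : V -> W) x : dir v f x = 'D_v f x.
Proof. by rewrite dir.unlock. Qed.

Lemma dir_fun V W v (f : V -> W) : dir v f = 'D_v f.
Proof. by apply/funext => x; rewrite dirE. Qed.

Lemma smooth_on_dir V W (U : set V) (f : V -> W) v :
  smooth_on U f -> smooth_on U (dir v f).
Proof. by rewrite dir_fun; exact: smooth_on_derive. Qed.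

Lemma dir_near_eq V W (U : set V) (f f' : V -> W) v x : open U -> U x ->
  (forall y, U y -> f y = f' y) -> dir v f x = dir v f' x.
Proof.
by move=> oU Ux E; rewrite !dirE; apply: near_eq_derive; exact: open_near_eq oU E x Ux.
Qed.

Lemma dir_schwarz V m n (U : set V) (f : V -> 'M[R]_(m, n)) v w x : open U -> U x ->
  smooth_on U f -> dir v (dir w f) x = dir w (dir v f) x.
Proof. by move=> oU Ux sf; rewrite !dir_fun; exact: schwarz oU Ux (sf 2). Qed.

Lemma dir_schwarzR V (U : set V) (f : V -> R) v w x : open U -> U x ->
  smooth_on U f -> dir v (dir w f) x = dir w (dir v f) x.
Proof. by move=> oU Ux sf; rewrite !dir_fun; exact: schwarzR oU Ux (sf 2). Qed.

Lemma dir_comp (U : normedModType R) V W (f : U -> V) (g : V -> W) x v :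
  differentiable f x -> differentiable g (f x) ->
  dir v (g \o f) x = dir (dir v f x) g (f x).
Proof. by move=> df dg; rewrite !dirE derive_comp. Qed.

Lemma dir_scale V W (k : V -> R) (f : V -> W) x v :
  differentiable k x -> differentiable f x ->
  dir v (fun y => k y *: f y) x = dir v k x *: f x + k x *: dir v f x.
Proof. by move=> dk df; rewrite !dirE derive_scale. Qed.

Lemma dirZ V W (c : R) (f : V -> W) x v : differentiable f x ->
  dir v (fun y => c *: f y) x = c *: dir v f x.
Proof. by move=> df; rewrite !dirE (@deriveZ _ _ _ f)//; exact: diff_derivable. Qed.

Lemma dirD V W (f g : V -> W) x v : differentiable f x -> differentiable g x ->
  dir v (fun y => f y + g y) x = dir v f x + dir v g x.
Proof. by move=> df dg; rewrite !dirE (@deriveD _ _ _ f g)//; exact: diff_derivable. Qed.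

Lemma dir_cst V W (c : W) (x v : V) : dir v (fun=> c) x = 0.
Proof. by rewrite dirE derive_cst. Qed.

Lemma dir_id V (x v : V) : dir v id x = v.
Proof. by rewrite dirE derive_id. Qed.

Lemma dir_sumf V W I (s : seq I) (f : I -> V -> W) v x :
  (forall i, differentiable (f i) x) ->
  dir v (fun y => \sum_(i <- s) f i y) x = \sum_(i <- s) dir v (f i) x.
Proof.
move=> df; rewrite dirE; have [_ ->] := derive_sumf s v df.
by apply: eq_bigr => i _; rewrite dirE.
Qed.

Lemma dir_linear V W (f : V -> W) x a v w : differentiable f x ->
  dir (a *: v + w) f x = a *: dir v f x + dir w f x.
Proof. by move=> df; rewrite !dirE derivel. Qed.

Lemma dir_addv V W (f : V -> W) x v w : differentiable f x ->
  dir (v + w) f x = dir v f x + dir w f x.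
Proof. by move=> df; rewrite -[v]scale1r dir_linear// !scale1r. Qed.

Lemma dir_scalev V W (f : V -> W) x a v : differentiable f x ->
  dir (a *: v) f x = a *: dir v f x.
Proof. by move=> df; rewrite !dirE !deriveE// linearZ. Qed.

Lemma dir_expand n W (f : 'rV[R]_n -> W) x v : differentiable f x ->
  dir v f x = \sum_i v 0 i *: dir (delta_mx 0 i) f x.
Proof.
move=> df; rewrite dirE {1}(row_sum_delta v) derive_sumr//.
by apply: eq_bigr => i _; rewrite dirE.
Qed.

Lemma dir_mxE V m n (f : V -> 'M[R]_(m, n)) v x i j : differentiable f x ->
  dir v f x i j = dir v (fun y => f y i j) x.
Proof. by move=> df; rewrite !dirE derive_mxE. Qed.

Lemma dir_jacobian m n (f : 'rV[R]_m -> 'rV[R]_n) u v : differentiable f u ->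
  dir v f u = v *m 'J f u.
Proof. by move=> df; rewrite dirE deriveEjacobian. Qed.

Lemma dir_bilin V n m W (B : 'rV[R]_m -> 'rV[R]_n -> 'rV[R]_n -> W)
    (p : V -> 'rV[R]_m) (a b : V -> 'rV[R]_n) x v :
  (forall y, bilin_expand (B y)) ->
  (forall c d, differentiable (fun y => B y c d) (p x)) ->
  differentiable p x -> differentiable a x -> differentiable b x ->
  dir v (fun y => B (p y) (a y) (b y)) x =
    dir (dir v p x) (fun y => B y (a x) (b x)) (p x)
    + B (p x) (dir v a x) (b x) + B (p x) (a x) (dir v b x).
Proof.
by move=> BE dB dp da db; rewrite !dirE; have [_ ->] := derive_bilin v BE dB dp da db.
Qed.

End Dir.

(** The pullback connection: the covariant derivative in direction [v] of a field [W] along the map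
    [p]. The source [V] is left general so that one operator serves curves ([V = R]), variations
    ([V = R * R]) and immersions ([V] a space of coordinates). It is sealed for the same reason as
    [dir]. *)
HB.lock Definition cov (R : realType) n (G : 'rV[R]_n -> 'M[R]_n) (V : normedModType R)
    (p W : V -> 'rV[R]_n) (v x : V) : 'rV[R]_n :=
  dir v W x + christoffel_form G (p x) (dir v p x) (W x).

Section Covariant.
Context {R : realType} {n : nat} (U : set 'rV[R]_n) (G : 'rV[R]_n -> 'M[R]_n).
Hypothesis HG : metric_on U G.
Local Notation Gam := (christoffel_form G).

Let oU : open U := metric_on_open HG.
Let symG u : U u -> (G u)^T = G u := metric_on_sym HG (u:=u).
Let posG u : U u -> posdef (G u) := metric_on_pos HG (u:=u).

Lemma dir_koszul u v w z : U u ->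
  2 * inner (G u) (Gam u v w) z =
    dir v (fun y => inner (G y) w z) u + dir w (fun y => inner (G y) v z) u
    - dir z (fun y => inner (G y) v w) u.
Proof. by move=> Uu; rewrite !dirE; exact: (koszul HG). Qed.

Lemma dir_compat u a b c : U u ->
  dir a (fun y => inner (G y) b c) u =
    inner (G u) (Gam u a b) c + inner (G u) b (Gam u a c).
Proof. by move=> Uu; rewrite dirE (Gam_compat HG). Qed.

Lemma dir_riem_opE u v w z : U u ->
  riem_op G u v w z =
    dir v (fun y => Gam y w z) u - dir w (fun y => Gam y v z) u
    + Gam u v (Gam u w z) - Gam u w (Gam u v z).
Proof. by move=> Uu; rewrite !dirE (riem_opE HG). Qed.

Lemma covE (V : normedModType R) (p W : V -> 'rV[R]_n) (v : V) :
  cov G p W v = fun x => dir v W x + Gam (p x) (dir v p x) (W x).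
Proof. by apply/funext => x; rewrite cov.unlock. Qed.

Lemma covxE (V : normedModType R) (p W : V -> 'rV[R]_n) (v x : V) :
  cov G p W v x = dir v W x + Gam (p x) (dir v p x) (W x).
Proof. by rewrite cov.unlock. Qed.

Local Notation cov := (cov G).

Section AlongMap.
Context {V : normedModType R} (D : set V) (p : V -> 'rV[R]_n).
Hypothesis oD : open D.
Hypothesis pD : forall x, D x -> U (p x).
Hypothesis sp : smooth_on D p.

Lemma smooth_on_bilin_along (W0 : normedModType R) (B : 'rV[R]_n -> 'rV[R]_n -> 'rV[R]_n -> W0) a b :
  (forall y, bilin_expand (B y)) ->
  (forall c d, smooth_on U (fun y => B y c d)) ->
  smooth_on D a -> smooth_on D b -> smooth_on D (fun x => B (p x) (a x) (b x)).
Proof.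
move=> BE sB sa sb k.
by apply: (Ck_on_bilin oD oU pD) => // c d; exact: sB.
Qed.

Lemma smooth_on_cov W v : smooth_on D W -> smooth_on D (cov p W v).
Proof.
move=> sW k; rewrite covE; apply: Ck_onD => //; first exact: (smooth_on_dir v sW).
apply: (smooth_on_bilin_along (B := Gam)) => //.
- by move=> y; exact: Gam_expand.
- exact: (smooth_on_Gam HG).
- exact: smooth_on_dir.
Qed.

(** Symmetry of second derivatives together with absence of torsion. It exchanges the [s] and [t]
    derivatives of a variation and makes the Hessian of an immersion symmetric. *)
Lemma cov_sym v w x : D x -> cov p (dir w p) v x = cov p (dir v p) w x.
Proof.
move=> Dx; have e1 := dir_schwarz v w oD Dx sp.
have e2 := GamC HG (dir v p x) (dir w p x) (pD Dx).
by rewrite !covxE e1 e2.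
Qed.

Lemma smooth_on_inner_along a b : smooth_on D a -> smooth_on D b ->
  smooth_on D (fun x => inner (G (p x)) (a x) (b x)).
Proof.
apply: (smooth_on_bilin_along (B := fun y => inner (G y))).
- by move=> y; exact: inner_expand.
- exact: (smooth_on_inner HG).
Qed.

Lemma cov_compat (W Z : V -> 'rV[R]_n) v x : D x ->
  differentiable W x -> differentiable Z x ->
  dir v (fun y => inner (G (p y)) (W y) (Z y)) x =
    inner (G (p x)) (cov p W v x) (Z x) + inner (G (p x)) (W x) (cov p Z v x).
Proof.
move=> Dx dW dZ.
have dp := smooth_on_diff sp Dx.
have BE y : bilin_expand (inner (G y)) by exact: inner_expand.
have dB c d : differentiable (fun y => inner (G y) c d) (p x).
  exact: smooth_on_diff (smooth_on_inner HG c d) (pD Dx).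
rewrite (dir_bilin v BE dB dp dW dZ) (dir_compat _ _ _ (pD Dx)) !covxE innerDl innerDr.
have gen (a b c d : R) : a + b + c + d = c + a + (d + b) by ring.
exact: gen.
Qed.

(* Only the derivatives of the Christoffel symbols survive the
   antisymmetrization, as second derivatives commute. *)
Lemma cov_commutator W v w x : D x -> smooth_on D W ->
  cov p (cov p W w) v x - cov p (cov p W v) w x =
    riem_op G (p x) (dir v p x) (dir w p x) (W x).
Proof.
move=> Dx sW.
have E a b : cov p (cov p W b) a x =
    dir a (dir b W) x + dir (dir a p x) (fun y => Gam y (dir b p x) (W x)) (p x)
    + Gam (p x) (dir a (dir b p) x) (W x) + Gam (p x) (dir b p x) (dir a W x)
    + Gam (p x) (dir a p x) (dir b W x) + Gam (p x) (dir a p x) (Gam (p x) (dir b p x) (W x)).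
  have dp := smooth_on_diff sp Dx.
  have dW := smooth_on_diff sW Dx.
  have dbp := smooth_on_diff (smooth_on_dir b sp) Dx.
  have dbW := smooth_on_diff (smooth_on_dir b sW) Dx.
  have dG c d : differentiable (fun y => Gam y c d) (p x).
    exact: smooth_on_diff (smooth_on_Gam HG c d) (pD Dx).
  have BE y : bilin_expand (Gam y) by exact: Gam_expand.
  have [d1 _] := derive_bilin a BE dG dp dbp dW.
  have E1 := dir_bilin a BE dG dp dbp dW.
  rewrite covxE [cov p W b]covE (dirD _ dbW d1) E1 (bilin_expandDr _ _ _ (BE _)).
  by rewrite !addrA.
rewrite (E v w) (E w v) (dir_riem_opE _ _ _ (pD Dx)).
rewrite (dir_schwarz v w oD Dx sW) (dir_schwarz v w oD Dx sp).
have gen (a b b' c d d' e e' : 'rV[R]_n) :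
   a + b + c + d + d' + e - (a + b' + c + d' + d + e') = b - b' + e - e'.
  by apply/rowP => i; rewrite !mxE; ring.
exact: gen.
Qed.

End AlongMap.

(** Metric compatibility trades the derivative of a Christoffel form for that of its pairing with a
    fixed vector. For warped products and for immersions it is this pairing that has an explicit
    expression. *)
Lemma riem_lower u a b c d : U u ->
  inner (G u) (riem_op G u a b c) d =
    dir a (fun y => inner (G y) (Gam y b c) d) u
    - inner (G u) (Gam u b c) (Gam u a d)
    - dir b (fun y => inner (G y) (Gam y a c) d) u
    + inner (G u) (Gam u a c) (Gam u b d).
Proof.
move=> Uu.
have H a' b' : dir a' (fun y => inner (G y) (Gam y b' c) d) u =
   inner (G u) (dir a' (fun y => Gam y b' c) u) d
   + inner (G u) (Gam u a' (Gam u b' c)) d + inner (G u) (Gam u b' c) (Gam u a' d).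
  have sid : smooth_on U (@id 'rV[R]_n) by move=> k; exact: Ck_on_id.
  have dd : differentiable (fun=> d) u by exact: differentiable_cst.
  have dg := smooth_on_diff (smooth_on_Gam HG b' c) Uu.
  rewrite (cov_compat (fun x h => h) sid a' Uu dg dd).
  by rewrite !covxE dir_id dir_cst add0r innerDl.
rewrite (H a b) (H b a) dir_riem_opE// innerBl innerDl innerBl.
have gen (x y z x' y' z' : R) : x - x' + y - y' = x + y + z - z - (x' + y' + z') + z' by ring.
exact: gen.
Qed.

(** Adding the expression with [c] and [d] exchanged leaves, up to terms that cancel, the difference
    of the two mixed second derivatives of [<c, d>] in the directions [a] and [b], which is zero. *)
Lemma riem_antisym u a b c d : U u ->
  inner (G u) (riem_op G u a b c) d = - inner (G u) (riem_op G u a b d) c.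
Proof.
move=> Uu; rewrite !riem_lower//.
have sm e f g : smooth_on U (fun y => inner (G y) (Gam y e f) g).
  apply: (smooth_on_inner_along (p := id)) => //.
  - by move=> k; exact: Ck_on_id.
  - exact: (smooth_on_Gam HG).
  - by move=> k; exact: Ck_on_cst.
have H e f : dir e (fun y => inner (G y) (Gam y f c) d) u + dir e (fun y => inner (G y) (Gam y f d) c) u
    = dir e (dir f (fun y => inner (G y) c d)) u.
  have d1 := smooth_on_diff (sm f c d) Uu; have d2 := smooth_on_diff (sm f d c) Uu.
  rewrite -(dirD _ d1 d2); apply: (dir_near_eq _ oU Uu) => y Uy.
  by rewrite dir_compat// [inner _ c _]innerC ?symG.
have := H a b; have := H b a; rewrite (dir_schwarzR a b oU Uu (smooth_on_inner HG c d)) => <-.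
rewrite [inner (G u) (Gam u b d) _]innerC ?symG// [inner (G u) (Gam u a d) _]innerC ?symG//.
have gen (x y x' y' z z' : R) : x + y = x' + y' -> x - z - x' + z' = - (y - z' - y' + z) by lra.
exact: gen.
Qed.

End Covariant.

Section RealValued.
Context {R : realType} {V : normedModType R}.
Implicit Types (f g : V -> R) (x v : V).

Lemma diffDf f g x : differentiable f x -> differentiable g x ->
  differentiable (fun y => f y + g y) x.
Proof. by move=> df dg; exact: (@differentiableD _ _ _ f g). Qed.

Lemma diffMf f g x : differentiable f x -> differentiable g x ->
  differentiable (fun y => f y * g y) x.
Proof. by move=> df dg; exact: (@differentiable_scale R V R f g). Qed.

Lemma deriveDf f g x v : differentiable f x -> differentiable g x ->
  'D_v (fun y => f y + g y) x = 'D_v f x + 'D_v g x.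
Proof. by move=> df dg; rewrite (@deriveD _ _ _ f g)//; exact: diff_derivable. Qed.

Lemma deriveMf f g x v : differentiable f x -> differentiable g x ->
  'D_v (fun y => f y * g y) x = 'D_v f x * g x + f x * 'D_v g x.
Proof. by move=> df dg; exact: (@derive_scale R V R f g). Qed.

Lemma deriveCf (c : R) f x v : differentiable f x ->
  'D_v (fun y => c * f y) x = c * 'D_v f x.
Proof. by move=> df; rewrite (@deriveZ _ _ _ f)//; exact: diff_derivable. Qed.

Lemma diffCf (c : R) f x : differentiable f x -> differentiable (fun y => c * f y) x.
Proof. by move=> df; exact: (@differentiableZ _ _ _ f). Qed.

End RealValued.

Section SectionalCurvature.
Context {R : realType} {n : nat} (U : set 'rV[R]_n) (G : 'rV[R]_n -> 'M[R]_n).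
Hypothesis HG : metric_on U G.

Lemma riem_op_diag u w z : U u -> riem_op G u w w z = 0.
Proof. by move=> Uu; rewrite (riem_opE HG)// subrr add0r subrr. Qed.

Lemma riem_opZl u (t : R) v w z : riem_op G u (t *: v) w z = t *: riem_op G u v w z.
Proof.
apply/rowP => l; rewrite !mxE big_distrr; apply: eq_bigr => i _ /=.
rewrite big_distrr; apply: eq_bigr => j _ /=.
by rewrite big_distrr; apply: eq_bigr => k _; rewrite mxE /=; ring.
Qed.

Lemma riem_opZm u (t : R) v w z : riem_op G u v (t *: w) z = t *: riem_op G u v w z.
Proof.
apply/rowP => l; rewrite !mxE big_distrr; apply: eq_bigr => i _ /=.
rewrite big_distrr; apply: eq_bigr => j _ /=.
by rewrite big_distrr; apply: eq_bigr => k _; rewrite mxE /=; ring.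
Qed.

(** The quotient [sectional] says something only for independent vectors. For dependent ones both
    sides vanish: a zero Gram determinant is the equality case of Cauchy-Schwarz, so [w] is a
    multiple of [v] or [v = 0]. *)
Lemma constant_sectionalE u (kappa : R) v w : U u ->
  (row_free (col_mx v w) -> sectional G u v w = kappa) ->
  inner (G u) (riem_op G u v w w) v =
    kappa * (inner (G u) v v * inner (G u) w w - inner (G u) v w ^+ 2).
Proof.
move=> Uu H.
have sG := metric_on_sym HG Uu; have pG := metric_on_pos HG Uu.
set den := _ - _ ^+ 2.
have [d0|d0] := eqVneq den 0.
  rewrite d0 mulr0; have [->|v0] := eqVneq v 0.
    by rewrite -(scale0r (0 : 'rV[R]_n)) riem_opZl scale0r inner0l.
  have vv := gt_eqF (pG _ v0).
  have E : inner (G u) v v *: w - inner (G u) v w *: v = 0.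
    apply: (posdef_eq0 pG); rewrite innerBl !innerBr !innerZl !innerZr (innerC w v sG).
    have gen (a b c : R) : a * b - c ^+ 2 = 0 -> a * (a * b) - c * (a * c) - (a * (c * c) - c * (c * a)) = 0.
      by move=> /eqP; rewrite subr_eq0 => /eqP e; rewrite e; ring.
    have gen' (a b c : R) : a * b - c ^+ 2 = 0 -> a * (a * b) - a * (c * c) - (c * (a * c) - c * (c * a)) = 0.
      by move=> /eqP; rewrite subr_eq0 => /eqP e; rewrite e; ring.
    by first [exact: gen|exact: gen'].
  have -> : w = (inner (G u) v w / inner (G u) v v) *: v.
    move/eqP: E; rewrite subr_eq0 => /eqP E.
    by rewrite mulrC -scalerA -E scalerA mulVf ?scale1r// vv.
  by rewrite riem_opZm riem_op_diag// scaler0 inner0l.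
have rf : row_free (col_mx v w).
  apply: inj_row_free => r; rewrite -[r]hsubmxK mul_row_col.
  rewrite [lsubmx r]mx11_scalar [rsubmx r]mx11_scalar !mul_scalar_mx.
  set a := lsubmx r 0 0; set b := rsubmx r 0 0 => E.
  have e1 : a * inner (G u) v v + b * inner (G u) v w = 0.
    by rewrite -(innerC w v sG) -!innerZl -innerDl E inner0l.
  have e2 : a * inner (G u) v w + b * inner (G u) w w = 0.
    by rewrite -!innerZl -innerDl E inner0l.
  have gen (x y z A B : R) : x * y - z ^+ 2 != 0 -> A * x + B * z = 0 -> A * z + B * y = 0 ->
      A = 0 /\ B = 0.
    move=> ne h1 h2; split; apply/eqP; apply: contraT => n0.
      have : A * (x * y - z ^+ 2) = (A * x + B * z) * y - (A * z + B * y) * z by ring.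
      by rewrite h1 h2 !mul0r subrr => /eqP; rewrite mulf_eq0 (negbTE n0) (negbTE ne).
    have : B * (x * y - z ^+ 2) = (A * z + B * y) * x - (A * x + B * z) * z by ring.
    by rewrite h1 h2 !mul0r subrr => /eqP; rewrite mulf_eq0 (negbTE n0) (negbTE ne).
  by have [-> ->] := gen _ _ _ _ _ d0 e1 e2; rewrite raddf0 row_mx0.
by rewrite -(H rf) /sectional -/den divfK.
Qed.

End SectionalCurvature.

(** * Curvature of warped products *)

Section WarpedMetric.
Context {R : realType} {n : nat} (I : set R) (h : R -> R)
  (U : set 'rV[R]_n) (G : 'rV[R]_n -> 'M[R]_n).
Hypothesis oI : open I.
Hypothesis sh : smooth_on I h.
Hypothesis hpos : forall t, I t -> 0 < h t.
Hypothesis HG : metric_on U G.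

Definition hd (v : 'rV[R]_(1 + n)) : R := lsubmx v 0 0.
Definition tl (v : 'rV[R]_(1 + n)) : 'rV[R]_n := rsubmx v.

Lemma hd_is_linear : linear hd.
Proof. by move=> a u v; rewrite /hd !mxE. Qed.

HB.instance Definition _ := GRing.isLinear.Build _ _ _ _ hd hd_is_linear.

Lemma tl_is_linear : linear tl.
Proof. by move=> a u v; apply/rowP => i; rewrite /tl !mxE. Qed.

HB.instance Definition _ := GRing.isLinear.Build _ _ _ _ tl tl_is_linear.

Lemma hd_continuous : continuous hd.
Proof.
move=> v; rewrite (_ : hd = fun u => u 0 (lshift n 0)); first exact: coord_continuous.
by apply/funext => u; rewrite /hd mxE.
Qed.

Lemma tl_continuous : continuous tl.
Proof. by move=> v; apply: differentiable_continuous; exact: differentiable_rsubmx. Qed.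

Lemma hd_row_mx (t : R) (v : 'rV[R]_n) : hd (row_mx t%:M v) = t.
Proof. by rewrite /hd row_mxKl mxE eqxx. Qed.

Lemma tl_row_mx (A : 'rV[R]_1) (v : 'rV[R]_n) : tl (row_mx A v) = v.
Proof. by rewrite /tl row_mxKr. Qed.

(** The metric of [warped] in one product chart, stated for an arbitrary local metric [G] so that
    its curvature can be computed without reference to an atlas. *)
Definition warped_gram (u : 'rV[R]_(1 + n)) : 'M[R]_(1 + n) :=
  block_mx 1%:M 0 0 (h (hd u) ^+ 2 *: G (tl u)).

Definition warped_dom : set 'rV[R]_(1 + n) := [set u | I (hd u) /\ U (tl u)].

Lemma inner_warped u v w : inner (warped_gram u) v w =
  hd v * hd w + h (hd u) ^+ 2 * inner (G (tl u)) (tl v) (tl w).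
Proof.
rewrite /inner /warped_gram -{1}[v]hsubmxK -{1}[w]hsubmxK mul_row_block.
rewrite !mulmx0 addr0 add0r mulmx1 tr_row_mx mul_row_col mxE; congr (_ + _).
  by rewrite mxE big_ord1 [_^T _ _]mxE.
by rewrite -scalemxAr -scalemxAl mxE.
Qed.

Lemma open_warped_dom : open warped_dom.
Proof.
have -> : warped_dom = hd @^-1` I `&` tl @^-1` U by [].
apply: openI; apply: open_comp => //.
- by move=> x _; exact: hd_continuous.
- by move=> x _; exact: tl_continuous.
- exact: metric_on_open HG.
Qed.

Lemma derive_scal1 (W : normedModType R) (f : R -> W) (a t : R) : differentiable f t ->
  'D_a f t = a *: derive1 f t.
Proof. by move=> df; rewrite derive1E !deriveE// -{1}[a]mulr1 linearZ. Qed.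

Lemma smooth_on_derive1 (W : normedModType R) (D : set R) (f : R -> W) :
  smooth_on D f -> smooth_on D (derive1 f).
Proof.
move=> sf; rewrite (_ : derive1 f = 'D_1 f); first exact: smooth_on_derive.
by apply/funext => t; rewrite derive1E.
Qed.

Lemma smooth_on_hd (W : normedModType R) (f : R -> W) : smooth_on I f ->
  smooth_on warped_dom (fun u => f (hd u)).
Proof.
move=> sf k; apply: (Ck_on_comp1 (U' := I)) => //.
- exact: open_warped_dom.
- by move=> x [].
- by apply: Ck_on_linear; [exact: open_warped_dom|exact: hd_continuous].
Qed.

Lemma smooth_on_tl (W : normedModType R) (f : 'rV[R]_n -> W) : smooth_on U f ->
  smooth_on warped_dom (fun u => f (tl u)).
Proof.
move=> sf k; apply: (Ck_on_comp (U' := U)) => //.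
- exact: open_warped_dom.
- exact: metric_on_open HG.
- by move=> x [].
- by apply: Ck_on_linear; [exact: open_warped_dom|exact: tl_continuous].
Qed.

Lemma derive_hd (W : normedModType R) (f : R -> W) u v : smooth_on I f ->
  warped_dom u -> 'D_v (fun y => f (hd y)) u = hd v *: derive1 f (hd u).
Proof.
move=> sf [Iu Uu]; have df := smooth_on_diff sf Iu.
rewrite (@derive_comp _ _ _ _ hd f)//; last exact: differentiable_lin hd_continuous.
by rewrite derive_lin ?derive_scal1//; exact: hd_continuous.
Qed.

Lemma derive_tl (W : normedModType R) (f : 'rV[R]_n -> W) u v : smooth_on U f ->
  warped_dom u -> 'D_v (fun y => f (tl y)) u = 'D_(tl v) f (tl u).
Proof.
move=> sf [Iu Uu]; have df := smooth_on_diff sf Uu.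
rewrite (@derive_comp _ _ _ _ tl f)//; last exact: differentiable_lin tl_continuous.
by rewrite derive_lin//; exact: tl_continuous.
Qed.

Lemma metric_on_warped : metric_on warped_dom warped_gram.
Proof.
split.
- exact: open_warped_dom.
- move=> k; apply/(Ck_on_mx k _ open_warped_dom) => i j.
  have H : Ck_on k warped_dom (fun u => inner (warped_gram u) (delta_mx 0 i) (delta_mx 0 j)).
    pose a : 'rV[R]_(1 + n) := delta_mx 0 i; pose b : 'rV[R]_(1 + n) := delta_mx 0 j.
    suff H : Ck_on k warped_dom (fun u => hd a * hd b + h (hd u) ^+ 2 * inner (G (tl u)) (tl a) (tl b)).
      by apply: (Ck_on_ext open_warped_dom _ H) => u _; rewrite inner_warped.
    apply: Ck_onD; [exact: open_warped_dom|exact: Ck_on_cst|].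
    apply: Ck_onM; first exact: open_warped_dom.
      by apply: Ck_onM; [exact: open_warped_dom|exact: smooth_on_hd|exact: smooth_on_hd].
    by apply: (smooth_on_tl (f := fun y => inner (G y) (tl a) (tl b))); exact: smooth_on_inner.
  by apply: (Ck_on_ext open_warped_dom _ H) => u _; rewrite inner_delta.
- move=> u [Iu Uu]; rewrite /warped_gram tr_block_mx !trmx0 trmx1 linearZ/=.
  by rewrite (metric_on_sym HG Uu).
- move=> u [Iu Uu] v v0; rewrite inner_warped.
  have pG := metric_on_pos HG Uu.
  have h2 : 0 < h (hd u) ^+ 2 by rewrite exprn_gt0// hpos.
  have t0 : 0 <= h (hd u) ^+ 2 * inner (G (tl u)) (tl v) (tl v).
    by rewrite mulr_ge0 ?(ltW h2)//; exact: posdef_ge0.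
  have [hv0|hv0] := eqVneq (hd v) 0; last first.
    by rewrite ltr_wpDr// -expr2 exprn_even_gt0.
  rewrite hv0 mul0r add0r mulr_gt0// pG//.
  apply: contra v0 => /eqP tv0; rewrite -[v]hsubmxK -[rsubmx v]/(tl v) tv0.
  by rewrite [lsubmx v]mx11_scalar -[lsubmx v 0 0]/(hd v) hv0 raddf0 row_mx0.
Qed.

Notation h' := h^`().
Notation h'' := h'^`().

Let sh' : smooth_on I h' := smooth_on_derive1 sh.

Lemma derive_warped_inner u v w z : warped_dom u ->
  'D_v (fun y => inner (warped_gram y) w z) u =
    2 * h (hd u) * h' (hd u) * hd v * inner (G (tl u)) (tl w) (tl z)
    + h (hd u) ^+ 2 * 'D_(tl v) (fun y => inner (G y) (tl w) (tl z)) (tl u).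
Proof.
move=> wu; pose g y := inner (G y) (tl w) (tl z).
have sg : smooth_on U g by exact: smooth_on_inner.
have sh1 := smooth_on_hd sh; have sg1 := smooth_on_tl sg.
have dh : differentiable (fun y => h (hd y)) u := smooth_on_diff sh1 wu.
have dg : differentiable (fun y => g (tl y)) u := smooth_on_diff sg1 wu.
have dc : differentiable (fun=> hd w * hd z) u by exact: differentiable_cst.
rewrite (_ : (fun y => _) = fun y => hd w * hd z + h (hd y) * (h (hd y) * g (tl y))); last first.
  by apply/funext => y; rewrite inner_warped expr2 mulrA.
have d1 := diffMf dh dg; have d2 := diffMf dh d1.
rewrite (deriveDf _ dc d2) (deriveMf _ dh d1) (deriveMf _ dh dg) derive_cst add0r.
rewrite derive_hd// derive_tl//.
have gen (a b c d e : R) : e *: b * (a * c) + a * (e *: b * c + a * d) =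
    2 * a * b * e * c + a ^+ 2 * d.
  by rewrite /GRing.scale/=; ring.
exact: gen.
Qed.

(** The right-hand side is verified by pairing it with an arbitrary [z] and comparing with the
    Koszul identity, so the inverse of the block Gram matrix never has to be computed. *)
Lemma christoffel_warped u v w : warped_dom u ->
  christoffel_form warped_gram u v w =
    row_mx (- h (hd u) * h' (hd u) * inner (G (tl u)) (tl v) (tl w))%:M
      (christoffel_form G (tl u) (tl v) (tl w)
       + (h' (hd u) / h (hd u)) *: (hd v *: tl w + hd w *: tl v)).
Proof.
move=> wu; have [Iu Uu] := wu; have hu : h (hd u) != 0 by rewrite gt_eqF// hpos.
apply: (inner_nondegenerate (metric_on_pos metric_on_warped wu)) => z.
have t2 : (2 : R) != 0 by rewrite pnatr_eq0.
apply: (mulfI t2); rewrite (koszul metric_on_warped)// !derive_warped_inner//.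
have := koszul HG (tl v) (tl w) (tl z) Uu.
rewrite inner_warped hd_row_mx tl_row_mx innerDl innerZl innerDl !innerZl.
have gen (H H1 vw wz vz v0 w0 z0 A B C D : R) : H != 0 -> 2 * D = A + B - C ->
  2 * H * H1 * v0 * wz + H ^+ 2 * A + (2 * H * H1 * w0 * vz + H ^+ 2 * B) - (2 * H * H1 * z0 * vw + H ^+ 2 * C)
  = 2 * (- H * H1 * vw * z0 + H ^+ 2 * (D + H1 / H * (v0 * wz + w0 * vz))).
  move=> H0 E; have -> : A = 2 * D - B + C by rewrite E; ring.
  by field.
exact: gen.
Qed.

Lemma smooth_on_mulR (D : set R) (f g : R -> R) : open D ->
  smooth_on D f -> smooth_on D g -> smooth_on D (fun t => f t * g t).
Proof. by move=> oD sf sg k; exact: Ck_onM. Qed.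

(** The derivatives that [riem_lower] asks for. The pairing splits as [h h'] times a function on
    [P], plus [h^2] times the corresponding pairing on [P]; [D] is the derivative of [G], rewritten
    by metric compatibility. *)
Lemma derive_lower_warped u v a b d : warped_dom u ->
  'D_v (fun y => inner (warped_gram y) (christoffel_form warped_gram y a b) d) u =
  let g x y := inner (G (tl u)) x y in
  let Gm := christoffel_form G (tl u) in
  let D x y := g (Gm (tl v) x) y + g x (Gm (tl v) y) in
  (h' (hd u) ^+ 2 + h (hd u) * h'' (hd u)) * hd v *
     (- hd d * g (tl a) (tl b) + hd a * g (tl b) (tl d) + hd b * g (tl a) (tl d))
  + h (hd u) * h' (hd u) *
     (- hd d * D (tl a) (tl b) + hd a * D (tl b) (tl d) + hd b * D (tl a) (tl d))
  + 2 * h (hd u) * h' (hd u) * hd v * g (Gm (tl a) (tl b)) (tl d)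
  + h (hd u) ^+ 2 *
     'D_(tl v) (fun y => inner (G y) (christoffel_form G y (tl a) (tl b)) (tl d)) (tl u).
Proof.
move=> wu /=; have [Iu Uu] := wu.
pose Q y := inner (G y) (christoffel_form G y (tl a) (tl b)) (tl d).
pose L y := - hd d * inner (G y) (tl a) (tl b) + hd a * inner (G y) (tl b) (tl d)
   + hd b * inner (G y) (tl a) (tl d).
pose k t := h t * h' t.
have oU := metric_on_open HG.
have sk : smooth_on I k by exact: smooth_on_mulR.
have sQ : smooth_on U Q.
  apply: (smooth_on_inner_along HG oU (p := id)) => //.
  - by move=> j; exact: Ck_on_id.
  - exact: smooth_on_Gam.
  - by move=> j; exact: Ck_on_cst.
have sL : smooth_on U L.
  move=> j; apply: Ck_onD => //; first apply: Ck_onD => //;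
    (apply: Ck_onM => //; [exact: Ck_on_cst|exact: smooth_on_inner]).
have E : forall y, warped_dom y -> inner (warped_gram y) (christoffel_form warped_gram y a b) d =
    k (hd y) * L (tl y) + h (hd y) * (h (hd y) * Q (tl y)).
  move=> y wy; have [Iy Uy] := wy; have hy : h (hd y) != 0 by rewrite gt_eqF// hpos.
  rewrite christoffel_warped// inner_warped hd_row_mx tl_row_mx innerDl innerZl innerDl !innerZl.
  rewrite /k /L /Q.
  have gen (H H1 ab bd ad a0 b0 d0 q : R) : H != 0 -> - H * H1 * ab * d0 + H ^+ 2 * (q + H1 / H * (a0 * bd + b0 * ad)) =
     H * H1 * (- d0 * ab + a0 * bd + b0 * ad) + H * (H * q) by move=> H0; field.
  exact: gen.
rewrite (near_eq_derive _ (open_near_eq open_warped_dom E wu)).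
have dk : differentiable (fun y => k (hd y)) u := smooth_on_diff (smooth_on_hd sk) wu.
have dh : differentiable (fun y => h (hd y)) u := smooth_on_diff (smooth_on_hd sh) wu.
have dL : differentiable (fun y => L (tl y)) u := smooth_on_diff (smooth_on_tl sL) wu.
have dQ : differentiable (fun y => Q (tl y)) u := smooth_on_diff (smooth_on_tl sQ) wu.
have d1 := diffMf dk dL; have d2 := diffMf dh dQ; have d3 := diffMf dh d2.
rewrite (deriveDf _ d1 d3) (deriveMf _ dk dL) (deriveMf _ dh d2) (deriveMf _ dh dQ).
rewrite !derive_hd// !derive_tl//.
have k'E : derive1 k (hd u) = h' (hd u) ^+ 2 + h (hd u) * h'' (hd u).
  have dh0 : differentiable h (hd u) := smooth_on_diff sh Iu.
  have dh1 : differentiable h' (hd u) := smooth_on_diff sh' Iu.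
  by rewrite derive1E (deriveMf _ dh0 dh1) -!derive1E expr2.
have dgi x y : differentiable (fun t => inner (G t) x y) (tl u).
  exact: smooth_on_diff (smooth_on_inner HG x y) Uu.
have dL' : 'D_(tl v) L (tl u) =
   - hd d * 'D_(tl v) (fun t => inner (G t) (tl a) (tl b)) (tl u)
   + hd a * 'D_(tl v) (fun t => inner (G t) (tl b) (tl d)) (tl u)
   + hd b * 'D_(tl v) (fun t => inner (G t) (tl a) (tl d)) (tl u).
  have e1 := diffCf (- hd d) (dgi (tl a) (tl b)).
  have e2 := diffCf (hd a) (dgi (tl b) (tl d)).
  have e3 := diffCf (hd b) (dgi (tl a) (tl d)).
  by rewrite (deriveDf _ (diffDf e1 e2) e3) (deriveDf _ e1 e2) !deriveCf.
rewrite k'E dL' !(Gam_compat HG)//.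
rewrite -/(Q) /L /k.
have gen (v0 K1 l H H1 l' q q' : R) :
  v0 *: K1 * l + H * H1 * l' + (v0 *: H1 * (H * q) + H * (v0 *: H1 * q + H * q')) =
  K1 * v0 * l + H * H1 * l' + 2 * H * H1 * v0 * q + H ^+ 2 * q' by rewrite /GRing.scale/=; ring.
exact: gen.
Qed.

Lemma riem_warped u v w : warped_dom u ->
  inner (warped_gram u) (riem_op warped_gram u v w w) v =
  let g x y := inner (G (tl u)) x y in
  let ww := g (tl w) (tl w) in let vv := g (tl v) (tl v) in let vw := g (tl v) (tl w) in
  - (h (hd u) * h'' (hd u)) * (hd v ^+ 2 * ww - 2 * hd v * hd w * vw + hd w ^+ 2 * vv)
  + h (hd u) ^+ 2 * g (riem_op G (tl u) (tl v) (tl w) (tl w)) (tl v)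
  - h (hd u) ^+ 2 * h' (hd u) ^+ 2 * (vv * ww - vw ^+ 2).
Proof.
move=> wu /=; have [Iu Uu] := wu; have hu : h (hd u) != 0 by rewrite gt_eqF// hpos.
have sG := metric_on_sym HG Uu.
rewrite (riem_lower metric_on_warped)// !dirE !derive_lower_warped//=.
rewrite (riem_lower HG)// !dirE.
rewrite !christoffel_warped// !inner_warped !hd_row_mx !tl_row_mx.
rewrite (GamC HG (tl w) (tl v) Uu).
set g := inner (G (tl u)); set Gm := christoffel_form G (tl u).
have gC x y : g x y = g y x by exact: innerC.
set a := tl v; set b := tl w; set A := Gm b b; set B := Gm a b; set C := Gm a a.
have gD x y z : g (x + y) z = g x z + g y z by exact: innerDl.
have gD' x y z : g z (x + y) = g z x + g z y by exact: innerDr.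
have gZ t x y : g (t *: x) y = t * g x y by exact: innerZl.
have gZ' t x y : g x (t *: y) = t * g x y by exact: innerZr.
rewrite !(gD, gD', gZ, gZ').
rewrite (gC b a) (gC a A) (gC a B) (gC b B) (gC b C).
set D1 := 'D_a _ _; set D2 := 'D_b _ _.
(* Everything is now expressed by scalar products of vectors of the factor [P]; with these as
   independent unknowns the claim is an identity of rational functions. *)
move: (hd v) (hd w) (g a a) (g a b) (g b b) (g A a) (g A b) (g B a) (g B b) (g C b) (g A C) (g B B)
  D1 D2 (h'' (hd u)) (h' (hd u)) (h (hd u)) hu => *.
by field.
Qed.

(* The sectional curvatures of [I x_h P] are convex combinations of
   [- h'' / h] and [kappa / h ^ 2 - (h' / h) ^ 2]. *)
Lemma riem_warped_ge (kappa : R) u v w : warped_dom u ->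
  (forall a b, row_free (col_mx a b) -> sectional G (tl u) a b = kappa) ->
  varkappa h kappa (hd u) *
    (inner (warped_gram u) v v * inner (warped_gram u) w w - inner (warped_gram u) v w ^+ 2)
  <= inner (warped_gram u) (riem_op warped_gram u v w w) v.
Proof.
move=> wu Hk; have [Iu Uu] := wu; have hu := hpos Iu.
have sG := metric_on_sym HG Uu; have pG := metric_on_pos HG Uu.
rewrite riem_warped//= (constant_sectionalE HG Uu (Hk _ _)) !inner_warped.
have := posdef_ge0 (hd v *: tl w - hd w *: tl v) pG.
rewrite innerBl !innerBr !innerZl !innerZr (innerC (tl w) (tl v) sG).
have := cauchy_schwarz (tl v) (tl w) sG pG.
rewrite /varkappa.
have : Num.min (- (h'' (hd u) / h (hd u))) (kappa / h (hd u) ^+ 2 - h' (hd u) ^+ 2 / h (hd u) ^+ 2)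
  <= - (h'' (hd u) / h (hd u)) by rewrite ge_min lexx.
have : Num.min (- (h'' (hd u) / h (hd u))) (kappa / h (hd u) ^+ 2 - h' (hd u) ^+ 2 / h (hd u) ^+ 2)
  <= kappa / h (hd u) ^+ 2 - h' (hd u) ^+ 2 / h (hd u) ^+ 2 by rewrite ge_min lexx orbT.
move: (Num.min _ _) => k.
move: (inner _ (tl v) (tl v)) (inner _ (tl w) (tl w)) (inner _ (tl v) (tl w)) (hd v) (hd w)
  (h'' (hd u)) (h' (hd u)) (h (hd u)) hu => a b c v0 w0 H2 H1 H H0 k2 k1 cs nn.
have Hn : H != 0 by rewrite gt_eqF.
(* [X] is the squared norm in [P] of [hd v *: tl w - hd w *: tl v]. The Gram determinant of [v, w]
   is [H^2 X + H^4 (a b - c^2)]: the part of the plane mixed with [d_t] and the part tangent to [P],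
   each nonnegative and each with its own curvature. *)
set X := v0 * (v0 * b) - v0 * (w0 * c) - (w0 * (v0 * c) - w0 * (w0 * a)) in nn.
have nn' : 0 <= H ^+ 2 * X by rewrite mulr_ge0// sqr_ge0.
have cs' : 0 <= H ^+ 2 * H ^+ 2 * (a * b - c ^+ 2) by rewrite mulr_ge0 ?subr_ge0// mulr_ge0 ?sqr_ge0.
have e1 := ler_wpM2r nn' k1; have e2 := ler_wpM2r cs' k2.
have -> : k * ((v0 * v0 + H ^+ 2 * a) * (w0 * w0 + H ^+ 2 * b) - (v0 * w0 + H ^+ 2 * c) ^+ 2) =
    k * (H ^+ 2 * X) + k * (H ^+ 2 * H ^+ 2 * (a * b - c ^+ 2)) by rewrite /X; ring.
apply: le_trans (lerD e1 e2) _.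
by rewrite le_eqVlt; apply/orP; left; apply/eqP; rewrite /X; field.
Qed.

End WarpedMetric.

HB.lock Definition hess (R : realType) m k (G : 'rV[R]_k -> 'M[R]_k)
    (f : 'rV[R]_m -> 'rV[R]_k) (v w u : 'rV[R]_m) : 'rV[R]_k :=
  cov G f (dir w f) v u.

(** The second fundamental form as the Hessian [nabla (df)] of the immersion: the intrinsic
    Christoffel term is subtracted instead of projecting to the normal space. That the result is
    normal is then a lemma, and [loc_II_sff] identifies it with [loc_II]. *)
HB.lock Definition sff (R : realType) m k (g : 'rV[R]_m -> 'M[R]_m)
    (G : 'rV[R]_k -> 'M[R]_k) (f : 'rV[R]_m -> 'rV[R]_k) (u v w : 'rV[R]_m) : 'rV[R]_k :=
  hess G f v w u - dir (christoffel_form g u v w) f u.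

Section BilinearExpansion.
Context {R : realType} {n : nat} {W : normedModType R}.
Variable B : 'rV[R]_n -> 'rV[R]_n -> W.
Hypothesis HB : bilin_expand B.

Lemma bilin_expandZl t a b : B (t *: a) b = t *: B a b.
Proof.
rewrite HB [B a b]HB scaler_sumr; apply: eq_bigr => i _.
by rewrite scaler_sumr; apply: eq_bigr => j _; rewrite mxE scalerA mulrA.
Qed.

Lemma bilin_expandZr t a b : B a (t *: b) = t *: B a b.
Proof.
rewrite HB [B a b]HB scaler_sumr; apply: eq_bigr => i _.
by rewrite scaler_sumr; apply: eq_bigr => j _; rewrite mxE scalerA mulrCA.
Qed.

Lemma bilin_expand0l b : B 0 b = 0.
Proof. by rewrite -(scale0r (0 : 'rV[R]_n)) bilin_expandZl scale0r. Qed.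

Lemma bilin_expand0r a : B a 0 = 0.
Proof. by rewrite -(scale0r (0 : 'rV[R]_n)) bilin_expandZr scale0r. Qed.

Lemma bilin_expand_sum m (a b : 'I_m -> R) (x y : 'I_m -> 'rV[R]_n) :
  B (\sum_i a i *: x i) (\sum_j b j *: y j) =
    \sum_i \sum_j (a i * b j) *: B (x i) (y j).
Proof.
rewrite (big_morph (B ^~ _) (fun u v => bilin_expandDl u v _ HB) (bilin_expand0l _)).
apply: eq_bigr => i _.
rewrite (big_morph (B _) (fun u v => bilin_expandDr _ u v HB) (bilin_expand0r _)).
by apply: eq_bigr => j _; rewrite bilin_expandZl bilin_expandZr scalerA.
Qed.

End BilinearExpansion.

(** * The second fundamental form *)

Section Immersion.
Context {R : realType} {m k : nat}.
Variables (D : set 'rV[R]_m) (g : 'rV[R]_m -> 'M[R]_m).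
Variables (U : set 'rV[R]_k) (G : 'rV[R]_k -> 'M[R]_k) (f : 'rV[R]_m -> 'rV[R]_k).
Hypothesis Hg : metric_on D g.
Hypothesis HG : metric_on U G.
Hypothesis fU : forall u, D u -> U (f u).
Hypothesis sf : smooth_on D f.
Hypothesis iso : forall u, D u -> pullback f G u = g u.

Let oD : open D := metric_on_open Hg.
Local Notation B := (hess G f).
Local Notation sff := (sff g G f).

Lemma hessE v w u : cov G f (dir w f) v u = B v w u.
Proof. by rewrite hess.unlock. Qed.

Lemma hess_fun v w : cov G f (dir w f) v = B v w.
Proof. by rewrite hess.unlock. Qed.

Lemma sffE u v w : sff u v w = B v w u - dir (christoffel_form g u v w) f u.
Proof. by rewrite sff.unlock. Qed.

Let df u : D u -> differentiable f u.
Proof. by move=> Du; exact: smooth_on_diff sf Du. Qed.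

Let sDf w : smooth_on D (dir w f) := smooth_on_dir w sf.

Let dDf w u : D u -> differentiable (dir w f) u.
Proof. by move=> Du; exact: smooth_on_diff (sDf w) Du. Qed.

Lemma pullback_inner u v w : D u ->
  inner (g u) v w = inner (G (f u)) (dir v f u) (dir w f u).
Proof.
move=> Du; rewrite -iso// !dir_jacobian; [|exact: df|exact: df].
by rewrite /inner /pullback trmx_mul !mulmxA.
Qed.

Lemma dir_pullback_inner u v w z : D u ->
  dir v (fun y => inner (g y) w z) u =
    inner (G (f u)) (B v w u) (dir z f u) + inner (G (f u)) (dir w f u) (B v z u).
Proof.
move=> Du; rewrite -!hessE -(cov_compat HG fU sf v Du (dDf w Du) (dDf z Du)).
by apply: (dir_near_eq _ oD Du) => y Dy; exact: pullback_inner.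
Qed.

Lemma hess_sym v w u : D u -> B v w u = B w v u.
Proof. by move=> Du; rewrite -!hessE (cov_sym HG oD fU sf v w Du). Qed.

(** The Levi-Civita connection of the induced metric is the tangential part of the ambient one: in
    the Koszul identity for [g], each derivative of [g] splits into two Hessian terms, and symmetry
    of the Hessian leaves twice the left-hand side. *)
Lemma tangential_christoffel u v w z : D u ->
  inner (G (f u)) (B v w u) (dir z f u) = inner (g u) (christoffel_form g u v w) z.
Proof.
move=> Du; have := dir_koszul Hg v w z Du.
rewrite !dir_pullback_inner//.
rewrite (hess_sym z v Du) (hess_sym z w Du) (hess_sym w v Du).
have sG := metric_on_sym HG (fU Du).
rewrite (innerC (dir w f u) _ sG) (innerC (dir v f u) _ sG).
have gen (X A b c : R) : 2 * X = A + b + (A + c) - (b + c) -> A = X by lra.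
exact: gen.
Qed.

Lemma sff_normal u v w z : D u -> inner (G (f u)) (sff u v w) (dir z f u) = 0.
Proof.
by move=> Du; rewrite sffE innerBl tangential_christoffel// pullback_inner// subrr.
Qed.

Lemma sff_sym u v w : D u -> sff u v w = sff u w v.
Proof.
by move=> Du; rewrite !sffE (hess_sym v w Du) (GamC Hg v w Du).
Qed.

Lemma cov_sff u v w : B v w u = sff u v w + dir (christoffel_form g u v w) f u.
Proof. by rewrite sffE subrK. Qed.

Lemma inner_cov_cov u a b c d : D u ->
  inner (G (f u)) (B a b u) (B c d u) = inner (G (f u)) (sff u a b) (sff u c d)
    + inner (g u) (christoffel_form g u a b) (christoffel_form g u c d).
Proof.
move=> Du; rewrite (cov_sff u a b) (cov_sff u c d) innerDl !innerDr.
have sG := metric_on_sym HG (fU Du).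
rewrite (sff_normal a b _ Du) (innerC (dir (christoffel_form g u a b) f u) (sff u c d) sG) (sff_normal c d _ Du).
by rewrite -(pullback_inner _ _ Du) addr0 add0r.
Qed.

(** By [tangential_christoffel], the pairings in [riem_lower] for [g] are pairings of ambient
    Hessians with tangent vectors. Differentiating these along [f] gives commutators of [cov], hence
    the ambient curvature, and products of Hessians; what such a product exceeds the matching
    Christoffel product by is a product of second fundamental forms. *)
Lemma gauss u v w : D u ->
  inner (g u) (riem_op g u v w w) v =
    inner (G (f u)) (riem_op G (f u) (dir v f u) (dir w f u) (dir w f u)) (dir v f u)
    + inner (G (f u)) (sff u w w) (sff u v v)
    - inner (G (f u)) (sff u v w) (sff u v w).
Proof.
move=> Du; rewrite (riem_lower Hg)//.
have H a b : dir a (fun y => inner (g y) (christoffel_form g y b w) v) u =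
    inner (G (f u)) (cov G f (B b w) a u) (dir v f u) + inner (G (f u)) (B b w u) (B a v u).
  have dB : differentiable (B b w) u by rewrite -hess_fun; exact: smooth_on_diff (smooth_on_cov HG oD fU sf b (sDf w)) Du.
  rewrite -[B a v u]hessE -(cov_compat HG fU sf a Du dB (dDf v Du)).
  by apply: (dir_near_eq _ oD Du) => y Dy; rewrite tangential_christoffel.
rewrite (H v w) (H w v) -(cov_commutator HG oD fU sf v w Du (sDf w)) !hess_fun innerBl.
rewrite (inner_cov_cov w w v v Du) (inner_cov_cov v w w v Du) (sff_sym w v Du).
have gen (a b c d e f' : R) : a + (b + c) - c - (d + (e + f')) + f' = a - d + b - e by ring.
exact: gen.
Qed.

Lemma hessian_expand u : D u -> bilin_expand (fun v w => dir v (dir w f) u).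
Proof.
move=> Du v w.
have E : dir v (dir w f) u = dir v (fun y => \sum_j w 0 j *: dir (delta_mx 0 j) f y) u.
  by apply: (dir_near_eq _ oD Du) => y Dy; rewrite dir_expand//; exact: df.
have dj j : differentiable (fun y => w 0 j *: dir (delta_mx 0 j) f y) u.
  by apply: differentiableZ; exact: dDf.
have E2 := dir_sumf (index_enum 'I_m) v dj.
rewrite E E2 exchange_big; apply: eq_bigr => j _ /=.
rewrite dirZ ?dir_expand; [|exact: dDf|exact: dDf].
by rewrite scaler_sumr; apply: eq_bigr => i _; rewrite scalerA mulrC.
Qed.

Lemma sff_expand u : D u -> bilin_expand (sff u).
Proof.
move=> Du v w; rewrite sffE -hessE covxE.
have H1 := hessian_expand Du v w.
have H2 : christoffel_form G (f u) (dir v f u) (dir w f u) = \sum_i \sum_j (v 0 i * w 0 j) *: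
    christoffel_form G (f u) (dir (delta_mx 0 i) f u) (dir (delta_mx 0 j) f u).
  by rewrite (dir_expand v (df Du)) (dir_expand w (df Du)) (bilin_expand_sum (Gam_expand G (f u))).
have H3 : dir (christoffel_form g u v w) f u = \sum_i \sum_j (v 0 i * w 0 j) *:
    dir (christoffel_form g u (delta_mx 0 i) (delta_mx 0 j)) f u.
  rewrite dirE (deriveE _ (df Du)) (Gam_expand g u v w) linear_sum; apply: eq_bigr => i _.
  rewrite linear_sum; apply: eq_bigr => j _; rewrite linearZ/=.
  by rewrite dirE (deriveE _ (df Du)).
rewrite H1 H2 H3 -big_split -sumrB; apply: eq_bigr => i _ /=.
rewrite -big_split -sumrB; apply: eq_bigr => j _ /=.
by rewrite sffE -hessE covxE scalerBr scalerDr.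
Qed.

(** The second order chain rule. For a geodesic [x] only the [sff] term remains, which gives the
    acceleration of its image in the ambient space; for a change of charts only the other term
    remains, which expresses that covariant acceleration does not depend on the chart. *)
Lemma cov_comp (V : normedModType R) (E : set V) (x : V -> 'rV[R]_m) t v w :
  open E -> (forall s, E s -> D (x s)) -> smooth_on E x -> E t ->
  cov G (f \o x) (dir w (f \o x)) v t =
    sff (x t) (dir v x t) (dir w x t) + dir (cov g x (dir w x) v t) f (x t).
Proof.
move=> oE xD sx Et; have Dx := xD _ Et.
have dx s : E s -> differentiable x s by move=> Es; exact: smooth_on_diff sx Es.
have Dfx a s : E s -> dir a (f \o x) s = dir (dir a x s) f (x s).
  by move=> Es; rewrite dir_comp//; [exact: dx|exact/df/xD].
have dwx : differentiable (dir w x) t := smooth_on_diff (smooth_on_dir w sx) Et.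
have E1 : dir v (dir w (f \o x)) t =
    dir (dir v (dir w x) t) f (x t) + dir (dir v x t) (dir (dir w x t) f) (x t).
  have -> : dir v (dir w (f \o x)) t =
     dir v (fun s => \sum_j dir w x s 0 j *: dir (delta_mx 0 j) f (x s)) t.
    by apply: (dir_near_eq _ oE Et) => s Es; rewrite Dfx// dir_expand//; exact/df/xD.
  have dwj j : differentiable (fun s => dir w x s 0 j) t.
    exact: (differentiable_comp dwx (differentiable_coord _ _ _)).
  have dfj j : differentiable (fun s => dir (delta_mx 0 j) f (x s)) t.
    by apply: (@differentiable_comp _ _ _ _ x (dir (delta_mx 0 j) f)); [exact: dx|exact: dDf].
  have dj j : differentiable (fun s => dir w x s 0 j *: dir (delta_mx 0 j) f (x s)) t.
    exact: differentiable_scale.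
  rewrite (dir_sumf (index_enum 'I_m) v dj).
  rewrite (dir_expand _ (df Dx)) (hessian_expand Dx (dir v x t) (dir w x t)) exchange_big -big_split.
  apply: eq_bigr => j _ /=.
  rewrite dir_scale// -(dir_mxE _ _ _ dwx); congr (_ + _).
  rewrite (@dir_comp _ _ _ _ x (dir (delta_mx 0 j) f)); [|exact: dx|exact: dDf].
  rewrite (dir_expand (dir v x t) (dDf (delta_mx 0 j) Dx)) scaler_sumr.
  by apply: eq_bigr => i _; rewrite scalerA mulrC.
have E3 : dir (cov g x (dir w x) v t) f (x t) = dir (dir v (dir w x) t) f (x t) +
    dir (christoffel_form g (x t) (dir v x t) (dir w x t)) f (x t).
  by rewrite covxE dir_addv//; exact: df.
rewrite covxE E1 (Dfx v t Et) (Dfx w t Et) sffE -hessE covxE E3.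
have gen (a b c d : 'rV[R]_k) : a + b + c = b + c - d + (a + d).
  by apply/rowP => i; rewrite !mxE; ring.
exact: gen.
Qed.

End Immersion.

(** * Orthonormal frames and traces *)

Section Frames.
Context {R : realType}.

(** The vectors of the frame are the rows of [E], in accordance with tangent vectors being row
    vectors. *)
Definition orthonormal_frame m (g E : 'M[R]_m) := E *m g *m E^T = 1%:M.

Lemma inner_mulmx m (g P : 'M[R]_m) (v w : 'rV[R]_m) :
  inner (P *m g *m P^T) v w = inner g (v *m P) (w *m P).
Proof. by rewrite /inner trmx_mul !mulmxA. Qed.

Lemma smooth_on_sqrt : smooth_on [set x : R | 0 < x] Num.sqrt.
Proof.
have oU : open [set x : R | 0 < x] by exact: open_gt.
elim=> [|k IH].
  by move=> x _; exact: sqrt_continuous.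
split=> [x /= x0|v]; first by apply/derivable1_diffP; have := is_derive1_sqrt x0 => -[].
have H : Ck_on k [set x : R | 0 < x] (fun x => v *: (2 * Num.sqrt x)^-1).
  apply: Ck_on_scale => //; first exact: Ck_on_cst.
  apply: Ck_onV => //; last by apply: Ck_onM => //; exact: Ck_on_cst.
  by move=> x /= x0; rewrite mulf_neq0// gt_eqF// sqrtr_gt0.
apply: (Ck_on_ext oU _ H) => x /= x0.
rewrite derive_scal1 ?derive1E ?derive_sqrt//.
by apply/derivable1_diffP; have := is_derive1_sqrt x0 => -[].
Qed.

Lemma Ck_on_block k (V : normedModType R) (U : set V) m1 m2 n1 n2
    (a : V -> 'M[R]_(m1, n1)) (b : V -> 'M[R]_(m1, n2)) (c : V -> 'M[R]_(m2, n1)) (d : V -> 'M[R]_(m2, n2)) :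
  open U -> Ck_on k U a -> Ck_on k U b -> Ck_on k U c -> Ck_on k U d ->
  Ck_on k U (fun x => block_mx (a x) (b x) (c x) (d x)).
Proof.
move=> oU /(Ck_on_mx k _ oU) Ca /(Ck_on_mx k _ oU) Cb /(Ck_on_mx k _ oU) Cc /(Ck_on_mx k _ oU) Cd.
apply/(Ck_on_mx k _ oU) => i j.
case: (split_ordP i) => i' ->; case: (split_ordP j) => j' ->.
- by under eq_fun do rewrite block_mxEul; exact: Ca.
- by under eq_fun do rewrite block_mxEur; exact: Cb.
- by under eq_fun do rewrite block_mxEdl; exact: Cc.
- by under eq_fun do rewrite block_mxEdr; exact: Cd.
Qed.

(** Gram-Schmidt by blocks, with induction on the Schur complement. Apart from the square root of a
    positive entry every operation is rational, so the frame depends smoothly on the point. *)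
Lemma orthonormal_frame_smooth (V : normedModType R) (D : set V) m (g : V -> 'M[R]_m) :
  open D -> smooth_on D g -> (forall x, D x -> (g x)^T = g x) ->
  (forall x, D x -> posdef (g x)) ->
  exists2 E, smooth_on D E & forall x, D x -> orthonormal_frame (g x) (E x).
Proof.
move=> oD; elim: m g => [|m IH] g sg gT gp.
  by exists (fun=> 1%:M) => [k|x _]; [exact: Ck_on_cst|apply/matrixP; case].
rewrite -[m.+1]/(1 + m)%N in g sg gT gp *.
have sgE k i j : Ck_on k D (fun x => g x i j) by have /(Ck_on_mx k _ oD) := sg k; exact.
pose a x := ulsubmx (g x) 0 0; pose b x := ursubmx (g x); pose d x := drsubmx (g x).
have Ca k : Ck_on k D a.
  by apply: (Ck_on_ext oD _ (sgE k (lshift m 0) (lshift m 0))) => x _; rewrite /a !mxE.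
have Cb k : Ck_on k D b.
  apply/(Ck_on_mx k _ oD) => i j.
  by apply: (Ck_on_ext oD _ (sgE k (lshift m i) (rshift 1 j))) => x _; rewrite !mxE.
have Cd k : Ck_on k D d.
  apply/(Ck_on_mx k _ oD) => i j.
  by apply: (Ck_on_ext oD _ (sgE k (rshift 1 i) (rshift 1 j))) => x _; rewrite !mxE.
have gE x : D x -> g x = block_mx (a x)%:M (b x) (b x)^T (d x).
  move=> Dx; rewrite -[LHS]submxK [ulsubmx (g x)]mx11_scalar; congr block_mx.
  by rewrite /b trmx_ursub gT.
have dT x : D x -> (d x)^T = d x by move=> Dx; rewrite /d trmx_drsub gT.
have a0 x : D x -> 0 < a x.
  move=> Dx; pose e : 'rV[R]_(1 + m) := row_mx 1%:M 0.
  have e0 : e != 0.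
    apply/eqP => /(congr1 (fun v : 'rV[R]_(1 + m) => lsubmx v 0 0)).
    by rewrite row_mxKl !mxE eqxx => /eqP; rewrite oner_eq0.
  have := gp x Dx e e0; rewrite /inner gE// /e mul_row_block !mul1mx !mul0mx !addr0.
  by rewrite tr_row_mx mul_row_col trmx1 mulmx1 trmx0 mulmx0 addr0 mxE eqxx.
(* [P] eliminates the off-diagonal blocks: [P g P^T] is block diagonal with blocks [a] and the Schur
   complement [s], which inherits positivity. *)
pose P x : 'M[R]_(1 + m) := block_mx 1%:M 0 (- (a x)^-1 *: (b x)^T) 1%:M.
pose s x := d x - (a x)^-1 *: ((b x)^T *m b x).
have CV k : Ck_on k D (fun x => (a x)^-1).
  by apply: Ck_onV => // x Dx; rewrite gt_eqF ?a0.
have CbT k : Ck_on k D (fun x => (b x)^T) by exact: Ck_on_trmx.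
have Cs : smooth_on D s.
  move=> k; apply: Ck_onD => //; apply: Ck_onN => //; apply: Ck_on_scale => //.
  exact: Ck_on_mulmx.
have CP k : Ck_on k D P.
  apply: Ck_on_block => //; try exact: Ck_on_cst.
  by apply: Ck_on_scale => //; exact: Ck_onN.
have PgP x : D x -> P x *m g x *m (P x)^T = block_mx (a x)%:M 0 0 (s x).
  move=> Dx; have an0 : a x != 0 by rewrite gt_eqF ?a0.
  rewrite gE// /P tr_block_mx mulmx_block !mul1mx !mul0mx !addr0 !trmx1 trmx0.
  rewrite mulmx_block !mulmx1 !mulmx0 !addr0.
  rewrite linearZ/= trmxK -!scalemxAl -!scalemxAr mul_scalar_mx mul_mx_scalar !scalerA.
  by rewrite mulNr mulVf// !scaleN1r !addNr mul0mx scaler0 add0r /s scaleNr addrC.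
have sT x : D x -> (s x)^T = s x.
  by move=> Dx; rewrite /s linearB linearZ/= trmx_mul trmxK dT.
have sp x : D x -> posdef (s x).
  move=> Dx v v0; pose w : 'rV[R]_(1 + m) := row_mx 0 v.
  have -> : inner (s x) v v = inner (P x *m g x *m (P x)^T) w w.
    rewrite PgP// /inner /w mul_row_block !mul0mx !mulmx0 !add0r tr_row_mx mul_row_col.
    by rewrite mul0mx add0r.
  rewrite inner_mulmx; apply: gp => //; apply: contra v0 => /eqP.
  rewrite /w /P mul_row_block mul0mx add0r mul0mx add0r mulmx1.
  by move=> /(congr1 rsubmx); rewrite row_mxKr => ->; rewrite linear0.
have [E' sE' hE'] := IH s Cs sT sp.
exists (fun x => block_mx ((Num.sqrt (a x))^-1)%:M 0 0 (E' x) *m P x).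
  move=> k; apply: Ck_on_mulmx => //; apply: Ck_on_block => //; try exact: Ck_on_cst.
  have CA : Ck_on k D (fun x => (Num.sqrt (a x))^-1).
    apply: Ck_onV => // [x Dx|]; first by rewrite gt_eqF// sqrtr_gt0 a0.
    by apply: (Ck_on_comp1 (U' := [set y : R | 0 < y]) oD _ a0) => //; exact: smooth_on_sqrt.
  apply/(Ck_on_mx k _ oD) => i j.
  by apply: (Ck_on_ext oD _ CA) => x _; rewrite !ord1 mxE eqxx.
move=> x Dx; rewrite /orthonormal_frame trmx_mul !mulmxA -(mulmxA _ (P x) (g x)) -(mulmxA _ (P x *m g x)) PgP//.
rewrite tr_block_mx !trmx0 !mulmx_block !mul0mx !mulmx0 !addr0 !add0r hE'//.
rewrite tr_scalar_mx -!scalar_mxM; set y := _ * _ * _.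
have -> : y = 1.
  rewrite /y -{2}[a x]sqr_sqrtr ?ltW ?a0//.
  by rewrite expr2 mulrA mulVf ?mul1r ?divff// sqrtr_eq0 -ltNge a0.
by rewrite !mul0mx -scalar_mx_block.
Qed.

Lemma orthonormal_frame_exists m (g : 'M[R]_m) : g^T = g -> posdef g ->
  exists E, orthonormal_frame g E.
Proof.
move=> gT gp; have [|||E _ hE] := @orthonormal_frame_smooth R setT m (fun=> g) openT => //.
  by move=> k; exact: Ck_on_cst.
by exists (E 0); exact: hE.
Qed.

Section FrameSums.
Context {m : nat} (g E : 'M[R]_m).
Hypothesis hE : orthonormal_frame g E.

Lemma frame_unit : E \in unitmx.
Proof. by have /mulmx1_unit[] : E *m (g *m E^T) = 1%:M by rewrite mulmxA. Qed.

Lemma frame_inv : invmx g = E^T *m E.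
Proof.
have h1 : (g *m E^T) *m E = 1%:M.
  by apply: mulmx1C; rewrite mulmxA.
have gu : g \in unitmx by have /mulmx1_unit[] : g *m (E^T *m E) = 1%:M by rewrite mulmxA.
by apply: (can_inj (mulKmx gu)); rewrite mulmxV// mulmxA.
Qed.

Lemma frame_unit_gram : g \in unitmx.
Proof.
have h1 : (g *m E^T) *m E = 1%:M by apply: mulmx1C; rewrite mulmxA.
by have /mulmx1_unit[] : g *m (E^T *m E) = 1%:M by rewrite mulmxA.
Qed.

Lemma frame_inner k l : inner g (row k E) (row l E) = (k == l)%:R.
Proof.
transitivity ((E *m g *m E^T) k l); last by rewrite hE mxE.
by rewrite /inner -row_mul !mxE; apply: eq_bigr => j _; rewrite !mxE.
Qed.

(** Traces are defined through the inverse Gram matrix; for an orthonormal frame this inverse is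
    [E^T E], which turns them into sums over the frame. *)
Lemma frame_sum (W : normedModType R) (B : 'rV[R]_m -> 'rV[R]_m -> W) : bilin_expand B ->
  \sum_i \sum_j invmx g i j *: B (delta_mx 0 i) (delta_mx 0 j) =
  \sum_k B (row k E) (row k E).
Proof.
move=> HB; under [RHS]eq_bigr do rewrite HB.
rewrite [RHS]exchange_big; apply: eq_bigr => i _ /=.
rewrite [RHS]exchange_big; apply: eq_bigr => j _ /=.
rewrite -scaler_suml frame_inv mxE; congr (_ *: _).
by apply: eq_bigr => k _; rewrite !mxE.
Qed.

Lemma frame_expand (Y : 'rV[R]_m) : Y = \sum_k inner g Y (row k E) *: row k E.
Proof.
have h1 : (g *m E^T) *m E = 1%:M by apply: mulmx1C; rewrite mulmxA.
rewrite -{1}[Y]mulmx1 -h1 !mulmxA mulmx_sum_row; apply: eq_bigr => k _; congr (_ *: _).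
by rewrite /inner !mxE; apply: eq_bigr => j _; rewrite !mxE.
Qed.

Lemma parseval (Y : 'rV[R]_m) : inner g Y Y = \sum_k inner g Y (row k E) ^+ 2.
Proof.
transitivity (inner g Y (\sum_k inner g Y (row k E) *: row k E)); first by rewrite -frame_expand.
rewrite inner_sumr; apply: eq_bigr => k _.
by rewrite innerZr expr2.
Qed.

End FrameSums.

(** With [S] the combination, the nonnegative sum of the [|a_i - y_i S|^2] equals the sum of the
    [|a_i|^2] minus [|S|^2]. It bounds [|II(e_p, Y)|^2] by the sum over [q] of [|II(e_p, e_q)|^2]
    without making [Y] a member of the frame. *)
Lemma sum_scale_norm_le k (G : 'M[R]_k) I (s : seq I) (y : I -> R) (a : I -> 'rV[R]_k) :
  G^T = G -> posdef G -> \sum_(i <- s) y i ^+ 2 = 1 ->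
  inner G (\sum_(i <- s) y i *: a i) (\sum_(i <- s) y i *: a i) <= \sum_(i <- s) inner G (a i) (a i).
Proof.
move=> GT Gp y1; set S := \sum_(i <- s) _ *: _.
have : 0 <= \sum_(i <- s) inner G (a i - y i *: S) (a i - y i *: S).
  by apply: sumr_ge0 => i _; exact: posdef_ge0.
have -> : \sum_(i <- s) inner G (a i - y i *: S) (a i - y i *: S) =
    \sum_(i <- s) (inner G (a i) (a i) - 2 * (y i * inner G (a i) S) + y i ^+ 2 * inner G S S).
  apply: eq_bigr => i _; rewrite innerBl !innerBr !innerZl !innerZr (innerC S (a i) GT).
  ring.
rewrite big_split sumrB -big_distrl -big_distrr /= y1 mul1r.
have -> : \sum_(i <- s) y i * inner G (a i) S = inner G S S.
  by rewrite {2}/S inner_suml; apply: eq_bigr => i _; rewrite innerZl.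
by rewrite -subr_ge0 => h; rewrite -subr_ge0; apply: le_trans h _; rewrite subr0; lra.
Qed.

End Frames.

Section RicciTrace.
Context {R : realType} {n : nat} (g : 'rV[R]_n -> 'M[R]_n) (E : 'M[R]_n) (u : 'rV[R]_n).
Hypothesis hE : orthonormal_frame (g u) E.

Lemma riem_op_mulmx v w z :
  riem_op g u z v w = z *m (\matrix_(i, l) riem_op g u (delta_mx 0 i) v w 0 l).
Proof.
apply/rowP => l; rewrite !mxE; apply: eq_bigr => i _.
rewrite [X in _ = _ * X]mxE [X in _ = _ * X]mxE [X in _ = _ * X](bigD1 i)//= [X in _ = _ * (_ + X)]big1 ?addr0; last first.
  move=> i' ii'; apply: big1 => j _; apply: big1 => k _.
  by rewrite mxE (negbTE ii') andbF mulr0 !mul0r.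
rewrite big_distrr; apply: eq_bigr => j _ /=.
rewrite big_distrr; apply: eq_bigr => k _ /=.
by rewrite mxE !eqxx mulr1; ring.
Qed.

(** The trace of [L] is unchanged when [L] is replaced by [E L g E^T], as [g E^T E = 1]; the
    diagonal entries of the latter are the pairings in the sum. *)
Lemma ricci_frame v w :
  ricci g u v w = \sum_k inner (g u) (riem_op g u (row k E) v w) (row k E).
Proof.
set L := \matrix_(i, l) riem_op g u (delta_mx 0 i) v w 0 l.
transitivity (\tr L); first by apply: eq_bigr => i _; rewrite [RHS]mxE.
transitivity (\tr (E *m L *m g u *m E^T)).
  rewrite -!mulmxA mxtrace_mulC -!mulmxA -(frame_inv hE) mulmxV ?mulmx1//.
  exact: frame_unit_gram hE.
apply: eq_bigr => k _; rewrite riem_op_mulmx -/L.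
by rewrite /inner -!row_mul !mxE; apply: eq_bigr => j _; rewrite !mxE.
Qed.

End RicciTrace.

Section ImmersionFrame.
Context {R : realType} {m k : nat}.
Variables (D : set 'rV[R]_m) (g : 'rV[R]_m -> 'M[R]_m).
Variables (U : set 'rV[R]_k) (G : 'rV[R]_k -> 'M[R]_k) (f : 'rV[R]_m -> 'rV[R]_k).
Hypothesis Hg : metric_on D g.
Hypothesis HG : metric_on U G.
Hypothesis fU : forall u, D u -> U (f u).
Hypothesis sf : smooth_on D f.
Hypothesis iso : forall u, D u -> pullback f G u = g u.
Local Notation sff := (sff g G f).

Let df u : D u -> differentiable f u.
Proof. by move=> Du; exact: smooth_on_diff sf Du. Qed.

Lemma nor_proj_decomp u y a : D u -> (forall z, inner (G (f u)) y (dir z f u) = 0) ->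
  nor_proj f G u (y + dir a f u) = y.
Proof.
move=> Du yn; have J a' : dir a' f u = a' *m 'J f u by rewrite dir_jacobian//; exact: df.
have y0 : y *m G (f u) *m ('J f u)^T = 0.
  apply/rowP => j; rewrite [RHS]mxE -(yn (delta_mx 0 j)) J /inner trmx_mul mulmxA trmx_delta -colE.
  by rewrite !mxE.
have up : pullback f G u \in unitmx.
  by rewrite iso//; apply: posdef_unit; exact: metric_on_pos Hg _ Du.
rewrite /nor_proj /tan_proj J !mulmxDl y0 !mul0mx add0r.
rewrite -(mulmxA a) -(mulmxA a) -/(pullback f G u).
by rewrite -(mulmxA a) mulmxV// mulmx1 addrK.
Qed.

Lemma loc_II_sff u i j : D u ->
  loc_II f G u i j = sff u (delta_mx 0 i) (delta_mx 0 j).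
Proof.
move=> Du; rewrite /loc_II.
have -> : ambient_nabla f G u i j = hess G f (delta_mx 0 i) (delta_mx 0 j) u.
  by rewrite hess.unlock cov.unlock !dir_fun.
rewrite (cov_sff g) nor_proj_decomp// => z.
exact: (sff_normal Hg HG fU sf iso).
Qed.

Variables (u : 'rV[R]_m) (E : 'M[R]_m).
Hypothesis Du : D u.
Hypothesis hE : orthonormal_frame (g u) E.

Lemma loc_H_frame : loc_H f G u = \sum_k sff u (row k E) (row k E).
Proof.
rewrite -(frame_sum hE (sff_expand G Hg sf Du)) /loc_H.
by apply: eq_bigr => i _; apply: eq_bigr => j _; rewrite iso// loc_II_sff.
Qed.

Lemma bilin_inner (A B : 'rV[R]_m -> 'rV[R]_k) (M : 'M[R]_k) :
  (forall a, A a = \sum_i a 0 i *: A (delta_mx 0 i)) ->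
  (forall a, B a = \sum_i a 0 i *: B (delta_mx 0 i)) ->
  bilin_expand (fun a b => inner M (A a) (B b)).
Proof.
move=> hA hB a b; rewrite hA inner_suml; apply: eq_bigr => i _.
rewrite hB inner_sumr; apply: eq_bigr => j _.
by rewrite innerZl innerZr mulrA.
Qed.

Lemma bilin_expand_l (B : 'rV[R]_m -> 'rV[R]_m -> 'rV[R]_k) b : bilin_expand B ->
  forall a, B a b = \sum_i a 0 i *: B (delta_mx 0 i) b.
Proof.
move=> HB a; rewrite {1}(row_sum_delta a).
rewrite (big_morph (B ^~ b) (fun u v => bilin_expandDl u v _ HB) (bilin_expand0l HB _)).
by apply: eq_bigr => i _; rewrite (bilin_expandZl HB).
Qed.

Lemma bilin_expand_r (B : 'rV[R]_m -> 'rV[R]_m -> 'rV[R]_k) a : bilin_expand B ->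
  forall b, B a b = \sum_i b 0 i *: B a (delta_mx 0 i).
Proof.
move=> HB b; rewrite {1}(row_sum_delta b).
rewrite (big_morph (B a) (fun u v => bilin_expandDr a u v HB) (bilin_expand0r HB _)).
by apply: eq_bigr => i _; rewrite (bilin_expandZr HB).
Qed.

Lemma loc_normsq_frame : loc_normsq_II f G u =
  \sum_p \sum_q inner (G (f u)) (sff u (row p E) (row q E)) (sff u (row p E) (row q E)).
Proof.
have HB := sff_expand G Hg sf Du.
set ip := inner (G (f u)).
transitivity (\sum_j \sum_b invmx (g u) j b *: \sum_i \sum_a invmx (g u) i a *:
   ip (sff u (delta_mx 0 i) (delta_mx 0 j)) (sff u (delta_mx 0 a) (delta_mx 0 b))).
  rewrite /loc_normsq_II exchange_big; apply: eq_bigr => j _ /=.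
  under eq_bigr do rewrite exchange_big.
  rewrite exchange_big; apply: eq_bigr => b _ /=.
  rewrite scaler_sumr; apply: eq_bigr => i _; rewrite scaler_sumr; apply: eq_bigr => a _.
  rewrite iso// !loc_II_sff// scalerA -/ip.
  by rewrite [X in _ = X *: _]mulrC.
transitivity (\sum_j \sum_b invmx (g u) j b *: \sum_p
   ip (sff u (row p E) (delta_mx 0 j)) (sff u (row p E) (delta_mx 0 b))).
  apply: eq_bigr => j _; apply: eq_bigr => b _; congr (_ *: _).
  apply: (frame_sum hE (B := fun x y => ip (sff u x (delta_mx 0 j)) (sff u y (delta_mx 0 b)))).
  by apply: bilin_inner => a; exact: bilin_expand_l.
under eq_bigr => j _ do under eq_bigr => b _ do rewrite scaler_sumr.
under eq_bigr => j _ do rewrite exchange_big.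
rewrite exchange_big; apply: eq_bigr => p _ /=.
apply: (frame_sum hE (B := fun x y => ip (sff u (row p E) x) (sff u (row p E) y))).
by apply: bilin_inner => a; exact: bilin_expand_r.
Qed.

(** The Gauss equation summed over a frame. The ambient terms are at least [vk (1 - <Y, e_p>^2)] and
    add up to [(m - 1) vk] since [|Y| = 1]; the terms [|II(e_p, Y)|^2] add up to at most [|II|^2];
    the remaining ones form [<II(Y, Y), H>]. *)
Lemma sff_H_le_ricci (vk : R) (Y : 'rV[R]_m) : inner (g u) Y Y = 1 ->
  (forall v w, vk * (inner (G (f u)) v v * inner (G (f u)) w w - inner (G (f u)) v w ^+ 2)
     <= inner (G (f u)) (riem_op G (f u) v w w) v) ->
  inner (G (f u)) (sff u Y Y) (loc_H f G u) <=
    ricci g u Y Y - (m%:R - 1) * vk + loc_normsq_II f G u.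
Proof.
move=> Y1 hvk; have HB := sff_expand G Hg sf Du.
have sG := metric_on_sym HG (fU Du); have pG := metric_on_pos HG (fU Du).
have sg := metric_on_sym Hg Du.
set ip := inner (G (f u)) in hvk *.
have gs p : inner (g u) (riem_op g u (row p E) Y Y) (row p E) =
    ip (riem_op G (f u) (dir (row p E) f u) (dir Y f u) (dir Y f u)) (dir (row p E) f u)
    + ip (sff u Y Y) (sff u (row p E) (row p E)) - ip (sff u (row p E) Y) (sff u (row p E) Y).
  exact: (gauss Hg HG fU sf iso).
have amb p : vk * (1 - inner (g u) Y (row p E) ^+ 2) <=
    ip (riem_op G (f u) (dir (row p E) f u) (dir Y f u) (dir Y f u)) (dir (row p E) f u).
  apply: le_trans (hvk _ _); rewrite /ip -!(pullback_inner sf iso _ _ Du) Y1.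
  by rewrite (frame_inner hE) eqxx (innerC _ (row p E) sg) mulr1.
have last_ : \sum_p ip (sff u (row p E) Y) (sff u (row p E) Y) <= loc_normsq_II f G u.
  rewrite loc_normsq_frame; apply: ler_sum => p _.
  rewrite (frame_expand hE Y) (_ : sff u (row p E) _ =
     \sum_q inner (g u) Y (row q E) *: sff u (row p E) (row q E)).
    by apply: sum_scale_norm_le => //; rewrite -(parseval hE).
  rewrite (big_morph (sff u (row p E)) (fun u v => bilin_expandDr _ u v HB) (bilin_expand0r HB _)).
  by apply: eq_bigr => q _; rewrite (bilin_expandZr HB).
rewrite (ricci_frame hE) loc_H_frame -/ip /ip inner_sumr -/ip.
under [X in _ <= X - _ + _]eq_bigr do rewrite gs.
rewrite sumrB big_split/=.
have h1 := ler_sum (index_enum 'I_m) (fun p _ => amb p) (P := xpredT).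
have e1 : \sum_p vk * (1 - inner (g u) Y (row p E) ^+ 2) = (m%:R - 1) * vk.
  rewrite -big_distrr/= sumrB -(parseval hE) Y1 sumr_const card_ord.
  by rewrite mulrC.
rewrite e1 in h1.
by move: h1 last_; lra.
Qed.

End ImmersionFrame.

Lemma metric_on_sub (R : realType) n (U U' : set 'rV[R]_n) (G : 'rV[R]_n -> 'M[R]_n) :
  open U' -> U' `<=` U -> metric_on U G -> metric_on U' G.
Proof.
move=> oU' UU' HG; split => //.
- by move=> k; exact: Ck_on_sub UU' (metric_on_smooth HG k).
- by move=> u /UU'; exact: metric_on_sym HG _.
- by move=> u /UU'; exact: metric_on_pos HG _.
Qed.

(** * Isometries between open sets of the same dimension *)

Section CodimensionZero.
Context {R : realType} {m : nat}.
Variables (D : set 'rV[R]_m) (g : 'rV[R]_m -> 'M[R]_m).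
Variables (U : set 'rV[R]_m) (G : 'rV[R]_m -> 'M[R]_m) (f : 'rV[R]_m -> 'rV[R]_m).
Hypothesis Hg : metric_on D g.
Hypothesis HG : metric_on U G.
Hypothesis fU : forall u, D u -> U (f u).
Hypothesis sf : smooth_on D f.
Hypothesis iso : forall u, D u -> pullback f G u = g u.

Lemma jacobian_unit u : D u -> 'J f u \in unitmx.
Proof.
move=> Du; have gu : g u \in unitmx by apply: posdef_unit; exact: metric_on_pos Hg _ Du.
by move: gu; rewrite -iso// /pullback -mulmxA unitmx_mul => /andP[].
Qed.

Lemma dir_surj u y : D u -> dir (y *m invmx ('J f u)) f u = y.
Proof.
move=> Du; rewrite dir_jacobian; last exact: smooth_on_diff sf Du.
by rewrite mulmxKV//; exact: jacobian_unit.
Qed.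

(** The second fundamental form is normal, while here every vector is tangent, so it is orthogonal
    to itself. *)
Lemma sff_square0 u v w : D u -> sff g G f u v w = 0.
Proof.
move=> Du; apply: (posdef_eq0 (metric_on_pos HG (fU Du))).
by rewrite -{2}(dir_surj (sff g G f u v w) Du) (sff_normal Hg HG fU sf iso).
Qed.

Lemma cov_comp_square (V : normedModType R) (E : set V) (x : V -> 'rV[R]_m) t (v w : V) :
  open E -> (forall s, E s -> D (x s)) -> smooth_on E x -> E t ->
  cov G (f \o x) (dir w (f \o x)) v t = dir (cov g x (dir w x) v t) f (x t).
Proof.
by move=> oE xD sx Et; rewrite (cov_comp G Hg sf v w oE xD sx Et) sff_square0 ?add0r//; exact: xD.
Qed.

(** The chain rule [cov_comp] shows that the two forms differ by a tangent vector. Both being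
    normal, the difference is also normal, hence zero. *)
Lemma sff_reparam k (U' : set 'rV[R]_k) (H : 'rV[R]_k -> 'M[R]_k) (F F' : 'rV[R]_m -> 'rV[R]_k) u v w :
  metric_on U' H ->
  (forall y, U y -> U' (F y)) -> smooth_on U F ->
  (forall y, U y -> pullback F H y = G y) ->
  (forall y, D y -> F' y = F (f y)) -> (forall y, D y -> pullback F' H y = g y) ->
  D u -> sff g H F' u v w = sff G H F (f u) (dir v f u) (dir w f u).
Proof.
move=> HH FU sF isoF F'E isoF' Du.
have oD := metric_on_open Hg.
have sFf : smooth_on D (F \o f).
  by move=> j; apply: (Ck_on_comp oD (metric_on_open HG) fU (sf j) (sF j)).
have sF' : smooth_on D F'.
  by move=> j; apply: (Ck_on_ext oD _ (sFf j)) => y Dy; rewrite F'E.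
have F'U y : D y -> U' (F' y) by move=> Dy; rewrite F'E//; exact/FU/fU.
have dF' a y : D y -> dir a F' y = dir (dir a f y) F (f y).
  move=> Dy; rewrite (dir_near_eq a oD Dy F'E) (@dir_comp _ _ _ _ f F)//.
  - exact: smooth_on_diff sf Dy.
  - exact: smooth_on_diff sF (fU Dy).
have hE : hess H F' v w u = cov H (F \o f) (dir w (F \o f)) v u.
  rewrite hess.unlock !covxE F'E//; congr (_ + christoffel_form H _ _ _).
  - by apply: (dir_near_eq _ oD Du) => y Dy; exact: dir_near_eq oD Dy F'E.
  - exact: (dir_near_eq v oD Du F'E).
  - exact: (dir_near_eq w oD Du F'E).
have := cov_sff g H F' u v w.
rewrite hE (cov_comp H HG sF v w oD fU sf Du) dF'//.
set S := sff G H F _ _ _; set a := cov _ _ _ _ _; set S' := sff g H F' u v w; set b := dir _ f u.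
have dF := smooth_on_diff sF (fU Du).
move=> E; have E2 : S' - S = dir (a - b) F (f u).
  rewrite dir_addv// -[- b]scaleN1r dir_scalev// scaleN1r.
  by apply/eqP; rewrite subr_eq addrAC eq_sym subr_eq addrC E.
have H0 z : inner (H (F (f u))) (S' - S) (dir z F (f u)) = 0.
  rewrite innerBl (sff_normal HG HH FU sF isoF _ _ _ (fU Du)) subr0.
  rewrite -(dir_surj z Du) -dF'// -F'E//.
  exact: (sff_normal Hg HH F'U sF' isoF').
have : S' - S = 0.
  apply: (posdef_eq0 (metric_on_pos HH (FU _ (fU Du)))).
  by rewrite {2}E2.
by move/eqP; rewrite subr_eq0 => /eqP.
Qed.

Lemma frame_push u E : D u -> orthonormal_frame (g u) E ->
  orthonormal_frame (G (f u)) (E *m 'J f u).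
Proof.
move=> Du; rewrite /orthonormal_frame -iso// /pullback trmx_mul => <-.
by rewrite !mulmxA.
Qed.

Lemma normsq_reparam k (U' : set 'rV[R]_k) (H : 'rV[R]_k -> 'M[R]_k) (F F' : 'rV[R]_m -> 'rV[R]_k) u :
  metric_on U' H -> (forall y, U y -> U' (F y)) -> smooth_on U F ->
  (forall y, U y -> pullback F H y = G y) ->
  (forall y, D y -> F' y = F (f y)) -> (forall y, D y -> pullback F' H y = g y) ->
  D u -> loc_normsq_II F' H u = loc_normsq_II F H (f u).
Proof.
move=> HH FU sF isoF F'E isoF' Du.
have oD := metric_on_open Hg.
have sF' : smooth_on D F'.
  move=> j; apply: (Ck_on_ext oD _ (Ck_on_comp oD (metric_on_open HG) fU (sf j) (sF j))) => y Dy.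
  by rewrite F'E.
have F'U y : D y -> U' (F' y) by move=> Dy; rewrite F'E//; exact/FU/fU.
have [E hE] := orthonormal_frame_exists (metric_on_sym Hg Du) (metric_on_pos Hg Du).
rewrite (loc_normsq_frame Hg HH F'U sF' isoF' Du hE).
rewrite (loc_normsq_frame HG HH FU sF isoF (fU Du) (frame_push Du hE)).
have df := smooth_on_diff sf Du.
apply: eq_bigr => p _; apply: eq_bigr => q _.
rewrite (sff_reparam _ _ HH FU sF isoF F'E isoF' Du) F'E//.
by rewrite !dir_jacobian// -!row_mul.
Qed.

End CodimensionZero.

(** * Changes of charts *)

Section Charts.
Context {R : realType} {n : nat} (M : atlas_metric R n).
Hypothesis HM : riemannian_manifold M.
Implicit Types (i j : idx M) (x : M).

Definition cod i : set 'rV[R]_n := to M i @` dom M i.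

Lemma cod_to i x : dom M i x -> cod i (to M i x).
Proof. by move=> dx; exists x. Qed.

Lemma inv_dom i u : cod i u -> dom M i (inv M i u).
Proof. by move=> [x dx <-]; rewrite (rm_toK HM). Qed.

Lemma to_inv i u : cod i u -> to M i (inv M i u) = u.
Proof. by move=> [x dx <-]; rewrite (rm_toK HM). Qed.

Lemma metric_on_chart i : metric_on (cod i) (metric M i).
Proof.
split.
- exact: rm_cod_open HM i.
- exact: rm_metric_smooth HM i.
- exact: rm_metric_sym HM i.
- by move=> u cu v v0; exact: rm_metric_pos HM i u v cu v0.
Qed.

Lemma open_to_image i (A : set M) : open A -> open (to M i @` (dom M i `&` A)).
Proof.
move=> oA; have -> : to M i @` (dom M i `&` A) = cod i `&` (inv M i) @^-1` A.
  apply/seteqP; split=> [u [x [dx Ax] <-]|u [[x dx <-]]] /=.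
    by split; [exact: cod_to|rewrite /= (rm_toK HM)].
  by rewrite (rm_toK HM)// => Ax; exists x.
rewrite openE => u [cu Au].
apply: filterI.
  by apply: open_nbhs_nbhs; split => //; exact: rm_cod_open HM i.
apply: (rm_inv_cont HM cu); exact: open_nbhs_nbhs.
Qed.

Definition overlap i j : set 'rV[R]_n := to M i @` (dom M i `&` dom M j).
Definition trans i j : 'rV[R]_n -> 'rV[R]_n := to M j \o inv M i.

Lemma open_overlap i j : open (overlap i j).
Proof. by apply: open_to_image; exact: rm_dom_open HM j. Qed.

Lemma overlap_cod i j u : overlap i j u -> cod i u.
Proof. by move=> [x [dx _] <-]; exact: cod_to. Qed.

Lemma trans_cod i j u : overlap i j u -> cod j (trans i j u).
Proof. by move=> [x [dx dx'] <-]; rewrite /trans /= (rm_toK HM)//; exact: cod_to. Qed.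

Lemma trans_to i j x : dom M i x -> trans i j (to M i x) = to M j x.
Proof. by move=> dx; rewrite /trans /= (rm_toK HM). Qed.

Lemma overlap_to i j x : dom M i x -> dom M j x -> overlap i j (to M i x).
Proof. by move=> dx dx'; exists x. Qed.

Lemma smooth_trans i j : smooth_on (overlap i j) (trans i j).
Proof. exact: rm_transition HM i j. Qed.

Lemma metric_on_overlap i j : metric_on (overlap i j) (metric M i).
Proof.
apply: metric_on_sub (metric_on_chart i); [exact: open_overlap|].
by move=> u; exact: overlap_cod.
Qed.

Lemma pullback_trans i j u : overlap i j u ->
  pullback (trans i j) (metric M j) u = metric M i u.
Proof. by move=> [x [dx dx'] <-]; rewrite (rm_metric_change HM dx dx'). Qed.

End Charts.

Section DirHelpers.
Context {R : realType}.

Lemma derive1_dir (W : normedModType R) (f : R -> W) : derive1 f = dir (1 : R) f.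
Proof. by apply/funext => t; rewrite derive1E dirE. Qed.

Lemma dir_lin (V W1 W2 : normedModType R) (L : {linear W1 -> W2}) (f : V -> W1) x v :
  continuous L -> differentiable f x -> dir v (fun y => L (f y)) x = L (dir v f x).
Proof. by move=> Lc df; rewrite !dirE (@derivable_derive_lin _ _ _ _ L f). Qed.

Lemma dirM (V : normedModType R) (f g : V -> R) x v : differentiable f x -> differentiable g x ->
  dir v (fun y => f y * g y) x = dir v f x * g x + f x * dir v g x.
Proof. by move=> df dg; rewrite !dirE deriveMf. Qed.

Lemma dir_comp1 (V W : normedModType R) (f : V -> R) (g : R -> W) x v :
  differentiable f x -> differentiable g (f x) ->
  dir v (fun y => g (f y)) x = dir v f x *: derive1 g (f x).
Proof. by move=> df dg; rewrite (@dir_comp _ _ _ _ f g)// dirE derive_scal1. Qed.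

End DirHelpers.

(** * The height function of a soliton along a geodesic *)

Section Soliton.
Context {R : realType} {m n : nat} (I : set R) (h : R -> R)
  (P : atlas_metric R n) (M : atlas_metric R m) (psi : M -> warped I h P) (kappa c : R).
Hypothesis m1 : (1 <= m)%N.
Hypothesis oI : open I.
Hypothesis sh : smooth_on I h.
Hypothesis hpos : forall t, I t -> 0 < h t.
Hypothesis HP : riemannian_manifold P.
Hypothesis HM : riemannian_manifold M.
Hypothesis psiI : forall x, I (psi x).1.
Hypothesis Hiso : isometric_immersion psi.
Hypothesis Hsol : mcf_soliton psi (warped_field I h P) c.
Hypothesis Hsec : constant_sectional_curvature P kappa.

Local Notation N := (warped I h P).

Definition loc_dom (i : idx M) (j : idx N) : set 'rV[R]_m :=
  to M i @` (dom M i `&` psi @^-1` dom N j).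
Local Notation f := (loc_map psi).
Local Notation G j := (warped_gram h (metric P j)).
Local Notation U j := (warped_dom I (@cod R n P j)).

Lemma metric_on_N j : metric_on (U j) (G j).
Proof. by apply: metric_on_warped => //; exact: metric_on_chart HP j. Qed.

Lemma open_dom_N j : open (dom N j).
Proof.
have -> : dom N j = [set x | I x.1] `&` [set x | dom P j x.2] by [].
apply: openI.
  by apply: (@open_comp _ _ (@fst R P)) => // x _; exact: cvg_fst.
apply: (@open_comp _ _ (@snd R P)); last exact: rm_dom_open HP j.
by move=> x _; exact: cvg_snd.
Qed.

Lemma open_psi_dom j : open (psi @^-1` dom N j).
Proof. by apply: open_comp; [move=> x _; exact: Hiso.1.1|exact: open_dom_N]. Qed.

Lemma open_loc_dom i j : open (loc_dom i j).
Proof. by apply: (open_to_image HM); exact: open_psi_dom. Qed.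

Lemma loc_dom_cod i j u : loc_dom i j u -> cod i u.
Proof. by move=> [x [dx _] <-]; exact: cod_to. Qed.

Lemma loc_mapE i j x : dom M i x ->
  f i j (to M i x) = row_mx (psi x).1%:M (to P j (psi x).2).
Proof. by move=> dx; rewrite /loc_map /= (rm_toK HM). Qed.

Lemma loc_map_dom i j u : loc_dom i j u -> U j (f i j u).
Proof.
move=> [x [dx [Ix dp]] <-]; rewrite loc_mapE//; split; rewrite ?hd_row_mx ?tl_row_mx//.
exact: cod_to.
Qed.

Lemma smooth_loc_map i j : smooth_on (loc_dom i j) (f i j).
Proof. exact: Hiso.1.2. Qed.

Lemma pullback_loc_map i j u : loc_dom i j u -> pullback (f i j) (G j) u = metric M i u.
Proof. by move=> [x [dx dp] <-]; exact: Hiso.2. Qed.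

Lemma metric_on_loc_dom i j : metric_on (loc_dom i j) (metric M i).
Proof.
apply: metric_on_sub (metric_on_chart HM i); [exact: open_loc_dom|].
by move=> u; exact: loc_dom_cod.
Qed.

(** [normsq_II] is evaluated in the chart chosen at the point, whereas the curvature estimate is
    carried out in an arbitrary chart around it. *)
Lemma loc_normsq_chart i i' j x : dom M i x -> dom M i' x -> dom N j (psi x) ->
  loc_normsq_II (f i j) (G j) (to M i x) = loc_normsq_II (f i' j) (G j) (to M i' x).
Proof.
move=> dx dx' dp; rewrite -{1}(trans_to HM i' dx).
pose D := to M i @` (dom M i `&` (dom M i' `&` psi @^-1` dom N j)).
have oD : open D.
  apply: (open_to_image HM); apply: openI; [exact: rm_dom_open HM i'|exact: open_psi_dom].
have Dov : D `<=` overlap i i' by move=> u [y [d1 [d2 _]] <-]; exact: overlap_to.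
have Dloc : D `<=` loc_dom i j by move=> u [y [d1 [_ d2]] <-]; exists y.
have mD : metric_on D (metric M i) := metric_on_sub oD Dloc (metric_on_loc_dom i j).
apply: (normsq_reparam mD (metric_on_loc_dom i' j) _ _ _ (metric_on_N j)).
- by move=> u [y [d1 [d2 d3]] <-]; rewrite trans_to//; exists y.
- by move=> k; exact: Ck_on_sub Dov (smooth_trans HM i i' k).
- by move=> u /Dov; exact: (pullback_trans HM).
- exact: loc_map_dom.
- exact: smooth_loc_map.
- exact: pullback_loc_map.
- by move=> u [y [d1 [d2 d3]] <-]; rewrite trans_to// !loc_mapE.
- by move=> u /Dloc; exact: pullback_loc_map.
- by exists x.
Qed.

Definition Xvec t : 'rV[R]_(1 + n) := row_mx (h t)%:M 0.

(** The soliton equation determines only the normal part of [X]; paired with the normal vector [S],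
    the tangential part disappears. *)
Lemma soliton_pairing i j x Y : dom M i x -> dom N j (psi x) ->
  let u := to M i x in let S := sff (metric M i) (G j) (f i j) u Y Y in
  c * inner (G j (f i j u)) S (Xvec (psi x).1) =
  inner (G j (f i j u)) S (loc_H (f i j) (G j) u).
Proof.
move=> dx dp /=; set u := to M i x; set S := sff _ _ _ _ _ _.
have Du : loc_dom i j u by exists x.
have := Hsol dx dp; rewrite /warped_field => <-; rewrite innerZr; congr (_ * _).
have -> : lsubmx (to N j (psi x)) 0 0 = (psi x).1 by rewrite -[LHS]/(hd _) hd_row_mx.
rewrite /nor_proj innerBr /tan_proj.
set a := (_ *m invmx _)%R; rewrite -[a *m _](dir_jacobian (f := f i j)); last first.
  exact: smooth_on_diff (smooth_loc_map i j) Du.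
have := sff_normal (metric_on_loc_dom i j) (metric_on_N j) (@loc_map_dom i j)
  (smooth_loc_map i j) (@pullback_loc_map i j) Y Y a Du.
by rewrite -/S => ->; rewrite subr0.
Qed.

Lemma soliton_le_ricci i x Y : dom M i x ->
  let u := to M i x in let j := chart_at N (psi x) in
  inner (metric M i u) Y Y = 1 ->
  c * inner (G j (f i j u)) (sff (metric M i) (G j) (f i j) u Y Y) (Xvec (psi x).1) <=
  ricci (metric M i) u Y Y
    + (normsq_II psi x - (m - 1)%:R * varkappa h kappa (psi x).1).
Proof.
move=> dx u j Y1; have dp : dom N j (psi x) by split=> //=; exact: rm_cover HP _.
have Du : loc_dom i j u by exists x.
(* The subtraction in [(m - 1)%:R] is that of natural numbers; [1 <= m] makes it [m%:R - 1]. *)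
rewrite soliton_pairing// /normsq_II (loc_normsq_chart (rm_cover HM x) dx dp) natrB//.
have [E hE] := orthonormal_frame_exists (metric_on_sym (metric_on_loc_dom i j) Du)
  (metric_on_pos (metric_on_loc_dom i j) Du).
have := sff_H_le_ricci (metric_on_loc_dom i j) (metric_on_N j) (@loc_map_dom i j)
  (smooth_loc_map i j) (@pullback_loc_map i j) Du hE (vk := varkappa h kappa (psi x).1) Y1.
have fu : f i j u = row_mx (psi x).1%:M (to P j (psi x).2) by exact: loc_mapE.
move=> H; have {}H := H _; rewrite addrA addrAC; apply: H => v w.
rewrite -{1}(hd_row_mx (psi x).1 (to P j (psi x).2)) -fu.
apply: (riem_warped_ge oI sh hpos (metric_on_chart HP j)).
  exact: loc_map_dom.
by move=> a b; rewrite fu tl_row_mx; apply: Hsec; exact: dp.2.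
Qed.

End Soliton.

Lemma open_preimage_on (T S : topologicalType) (J : set T) (g : T -> S) (A : set S) :
  open J -> (forall t, J t -> {for t, continuous g}) -> open A -> open (J `&` g @^-1` A).
Proof.
move=> oJ gc oA; rewrite openE => t [Jt At]; apply: filterI; first exact: open_nbhs_nbhs.
by apply: gc Jt _ _; exact: open_nbhs_nbhs.
Qed.

Section HeightAlongCurve.
Context {R : realType} {m n : nat} (I : set R) (h : R -> R)
  (P : atlas_metric R n) (M : atlas_metric R m) (psi : M -> warped I h P) (J : set R) (gamma : R -> M).
Hypothesis oI : open I.
Hypothesis sh : smooth_on I h.
Hypothesis hpos : forall t, I t -> 0 < h t.
Hypothesis HP : riemannian_manifold P.
Hypothesis HM : riemannian_manifold M.
Hypothesis psiI : forall x, I (psi x).1.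
Hypothesis Hiso : isometric_immersion psi.
Hypothesis oJ : open J.
Hypothesis Hgeo : geodesic J gamma.

Local Notation N := (warped I h P).
Local Notation f := (loc_map psi).
Local Notation G j := (warped_gram h (metric P j)).
Local Notation U j := (warped_dom I (@cod R n P j)).

Definition height t := (psi (gamma t)).1.
(** The derivative of [eta] along the curve, that is [<grad eta, gamma'>], written through the
    height so that it makes sense without charts. *)
Definition height_flux t := h (height t) * derive1 height t.

Definition curve_dom i j : set R :=
  J `&` gamma @^-1` (dom M i `&` psi @^-1` dom N j).

Lemma open_curve_dom i j : open (curve_dom i j).
Proof.
apply: open_preimage_on => //; first exact: (Hgeo.1 0%N).1.
by apply: openI; [exact: rm_dom_open HM i|exact: open_psi_dom].
Qed.

Lemma smooth_curve_dom i j : smooth_on (curve_dom i j) (to M i \o gamma).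
Proof.
move=> k; apply: Ck_on_sub ((Hgeo.1 k).2 i).
by move=> t [Jt [? _]].
Qed.

Lemma curve_dom_loc i j t : curve_dom i j t -> loc_dom psi i j (to M i (gamma t)).
Proof. by move=> [_ ?]; exists (gamma t). Qed.

Lemma loc_map_curve i j t : curve_dom i j t ->
  f i j (to M i (gamma t)) = row_mx (height t)%:M (to P j (psi (gamma t)).2).
Proof. by move=> [_ [d _]]; rewrite loc_mapE. Qed.

Lemma heightE i j t : curve_dom i j t -> height t = hd (f i j (to M i (gamma t))).
Proof. by move=> /loc_map_curve ->; rewrite hd_row_mx. Qed.

Lemma smooth_image_curve i j : smooth_on (curve_dom i j) (fun t => f i j (to M i (gamma t))).
Proof.
move=> k; apply: (Ck_on_comp (U' := loc_dom psi i j) (@open_curve_dom i j)).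
- exact: open_loc_dom.
- exact: curve_dom_loc.
- exact: smooth_curve_dom.
- exact: smooth_loc_map.
Qed.

Lemma curve_dom_chart t : J t -> curve_dom (chart_at M (gamma t)) (chart_at N (psi (gamma t))) t.
Proof. by split=> //; split; [exact: rm_cover HM _|split=> //=; exact: rm_cover HP _]. Qed.

Lemma smooth_height : smooth_on J height.
Proof.
move=> k; apply: Ck_on_local => t /curve_dom_chart.
set i := chart_at _ _; set j := chart_at _ _ => Dt; exists (curve_dom i j) => //.
apply: (Ck_on_ext (@open_curve_dom i j)) => [s Ds|]; first by rewrite (heightE Ds).
apply: Ck_on_lin; [exact: open_curve_dom|exact: hd_continuous|exact: smooth_image_curve].
Qed.

Lemma smooth_height_flux : smooth_on J height_flux.
Proof.
move=> k; apply: Ck_onM => //; last exact: smooth_on_derive1 smooth_height k.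
by apply: (Ck_on_comp1 oJ oI) => [t _||]; [exact: psiI|exact: smooth_height|exact: sh].
Qed.

Lemma derive1_height i j t : curve_dom i j t ->
  derive1 height t = hd (dir (1 : R) (fun t => f i j (to M i (gamma t))) t).
Proof.
move=> Dt; rewrite derive1_dir.
rewrite (dir_near_eq _ (@open_curve_dom i j) Dt (@heightE i j)).
rewrite (dir_lin _ (L := hd)) //; first exact: hd_continuous.
exact: smooth_on_diff (@smooth_image_curve i j) Dt.
Qed.

(** Here [X] being conformal becomes a computation. The derivative is [h' sigma'^2 + h sigma'']; the
    Christoffel form of the warped product gives [sigma''] as the first component of the ambient
    acceleration plus [h h'] times the square of the [P] component of the velocity; unit speed then
    collects the terms with [h'] into [h'] alone. The acceleration is purely [sff], the curve being
    a geodesic of [M]. *)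
Lemma derive1_height_flux i j t (u := fun t => to M i (gamma t)) : curve_dom i j t ->
  inner (metric M i (u t)) (dir (1 : R) u t) (dir (1 : R) u t) = 1 ->
  derive1 height_flux t = derive1 h (height t) +
    inner (G j (f i j (u t))) (sff (metric M i) (G j) (f i j) (u t) (dir (1 : R) u t) (dir (1 : R) u t))
      (Xvec h (height t)).
Proof.
move=> Dt u1.
pose F t := f i j (u t).
have oE := @open_curve_dom i j.
have sF : smooth_on (curve_dom i j) F := @smooth_image_curve i j.
have su : smooth_on (curve_dom i j) u := @smooth_curve_dom i j.
have FU s : curve_dom i j s -> U j (F s).
  by move=> Ds; apply: loc_map_dom => //; exact: curve_dom_loc.
have dF : differentiable F t := smooth_on_diff sF Dt.
have Fh : hd (F t) = height t by rewrite -(heightE Dt).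
have dirF : dir (1 : R) F t = dir (dir (1 : R) u t) (f i j) (u t).
  apply: dir_comp; first exact: smooth_on_diff su Dt.
  by apply: smooth_on_diff (smooth_loc_map Hiso i j) _; exact: curve_dom_loc.
have cov0 : cov (metric M i) u (dir (1 : R) u) (1 : R) t = 0.
  have [Jt [di _]] := Dt; have := Hgeo.2 i t Jt di.
  by rewrite /= !derive1_dir covxE.
have covF : cov (G j) F (dir (1 : R) F) (1 : R) t =
    sff (metric M i) (G j) (f i j) (u t) (dir (1 : R) u t) (dir (1 : R) u t).
  have := cov_comp (G j) (metric_on_loc_dom oI HP HM Hiso i j) (smooth_loc_map Hiso i j) (1 : R) (1 : R)
    oE (@curve_dom_loc i j) su Dt.
  rewrite cov0 [dir 0 _ _]dirE derive0 addr0; exact.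
rewrite -covF covxE; set S := christoffel_form _ _ _ _.
have H0 : derive1 height t = hd (dir (1 : R) F t) := derive1_height Dt.
have H1 : derive1 (derive1 height) t = hd (dir (1 : R) (dir (1 : R) F) t).
  rewrite derive1_dir.
  rewrite (dir_near_eq _ oE Dt (@derive1_height i j)).
  rewrite (dir_lin _ (L := hd)) //; first exact: hd_continuous.
  exact: smooth_on_diff (smooth_on_dir _ sF) Dt.
have It : I (height t) by exact: psiI.
have Jt : J t by case: Dt.
have dh : differentiable h (height t) := smooth_on_diff sh It.
have dg : differentiable height t := smooth_on_diff smooth_height Jt.
have dg' : differentiable (derive1 height) t.
  exact: smooth_on_diff (smooth_on_derive1 smooth_height) Jt.
have -> : derive1 height_flux t = derive1 h (height t) * derive1 height t ^+ 2
    + h (height t) * derive1 (derive1 height) t.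
  rewrite derive1_dir dirM//; last exact: differentiable_comp.
  rewrite dir_comp1// -!derive1_dir.
  have gen (a b c d : R) : b * a * b + c * d = a * b ^+ 2 + c * d by ring.
  exact: gen.
have := pullback_inner (smooth_loc_map Hiso i j) (pullback_loc_map Hiso (i := i) (j := j)) 
  (dir (1 : R) u t) (dir (1 : R) u t) (curve_dom_loc Dt).
rewrite u1 -dirF inner_warped => e1.
rewrite inner_warped -/(F t) Fh [hd (Xvec _ _)]hd_row_mx [tl (Xvec _ _)]tl_row_mx inner0r mulr0 addr0.
have -> : hd (dir (1 : R) (dir (1 : R) F) t + S) =
    hd (dir (1 : R) (dir (1 : R) F) t) + hd S by rewrite raddfD.
rewrite -H1 /S (christoffel_warped oI sh hpos (metric_on_chart HP j))//; last exact: FU.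
rewrite hd_row_mx Fh.
move: e1; rewrite -/(F t) Fh -H0.
set q := inner _ _ _.
have gen (a b c d p : R) : 1 = b * b + c ^+ 2 * p ->
  a * b ^+ 2 + c * d = a + (d + - c * a * p) * c.
  by move=> e; rewrite -[X in _ = X + _]mulr1 e; ring.
by move=> e1; exact: gen.
Qed.

End HeightAlongCurve.

Section GradientAlongCurve.
Context {R : realType} {m : nat} (M : atlas_metric R m).
Hypothesis HM : riemannian_manifold M.

Lemma grad_inner i (a : M -> R) x v : dom M i x ->
  differentiable (a \o inv M i : 'rV[R]_m -> R) (to M i x) ->
  inner (metric M i (to M i x)) (grad i a x) v = dir v (a \o inv M i) (to M i x).
Proof.
move=> dx da; rewrite dir_expand// /inner /grad mulmxKV; last first.
  exact: posdef_unit (metric_on_pos (metric_on_chart HM i) (cod_to dx)).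
rewrite mxE; apply: eq_bigr => k _; rewrite !mxE dirE.
by rewrite mulrC.
Qed.

Lemma derive_le_norm_grad (a : M -> R) x v (i := chart_at M x) :
  differentiable (a \o inv M i : 'rV[R]_m -> R) (to M i x) ->
  inner (metric M i (to M i x)) v v = 1 ->
  `|dir v (a \o inv M i) (to M i x)| <= norm_grad a x.
Proof.
move=> da v1; have dx : dom M i x := rm_cover HM x.
have Hg := metric_on_chart HM i; have cx := cod_to dx.
rewrite -grad_inner// /norm_grad -sqrtr_sqr ler_wsqrtr//.
have := cauchy_schwarz (grad i a x) v (metric_on_sym Hg cx) (metric_on_pos Hg cx).
by rewrite v1 mulr1.
Qed.

End GradientAlongCurve.

Section FluxGradient.
Context {R : realType} {m n : nat} (I : set R) (h : R -> R)
  (P : atlas_metric R n) (M : atlas_metric R m) (psi : M -> warped I h P) (J : set R) (gamma : R -> M).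
Hypothesis oI : open I.
Hypothesis iI : is_interval I.
Hypothesis sh : smooth_on I h.
Hypothesis HP : riemannian_manifold P.
Hypothesis HM : riemannian_manifold M.
Hypothesis psiI : forall x, I (psi x).1.
Hypothesis Hiso : isometric_immersion psi.
Hypothesis oJ : open J.
Hypothesis Hgeo : geodesic J gamma.

(** By the fundamental theorem of calculus the flux is the derivative of [eta] in the direction of a
    unit vector, so Cauchy-Schwarz applies. It is used at the two ends of the geodesic only. *)
Lemma height_flux_le_norm_grad t0 t (u := fun s => to M (chart_at M (gamma t)) (gamma s)) :
  I t0 -> J t ->
  inner (metric M (chart_at M (gamma t)) (u t)) (dir (1 : R) u t) (dir (1 : R) u t) = 1 ->
  `|height_flux psi gamma t| <= norm_grad (fun x : M => oint h t0 (psi x).1) (gamma t).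
Proof.
move=> It0 Jt u1; set i := chart_at M (gamma t); set j := chart_at (warped I h P) (psi (gamma t)).
have Dt : curve_dom psi J gamma i j t by exact: curve_dom_chart.
have oE := @open_curve_dom _ _ _ _ _ _ _ _ _ _ oI HP HM Hiso oJ Hgeo i j.
have cL := curve_dom_loc Dt.
have hc x : I x -> {for x, continuous h} by move=> Ix; exact: smooth_on_continuous sh Ix.
have Is : I (psi (gamma t)).1 by exact: psiI.
have doi : is_derive (psi (gamma t)).1 1 (oint h t0) (h (psi (gamma t)).1).
  exact: (is_derive_oint oI iI).
have Do : differentiable (oint h t0) (psi (gamma t)).1.
  by apply/derivable1_diffP; exact: ex_derive.
set a := fun x : M => oint h t0 (psi x).1.
have aE v : loc_dom psi i j v -> oint h t0 (hd (loc_map psi i j v)) = (a \o inv M i) v.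
  move=> [x [dx dp] <-]; rewrite loc_mapE// hd_row_mx /a /=.
  by rewrite (rm_toK HM).
have fE : hd (loc_map psi i j (u t)) = (psi (gamma t)).1 by rewrite -(heightE HM Dt).
have df : differentiable (loc_map psi i j) (u t) := smooth_on_diff (smooth_loc_map Hiso i j) cL.
have da : differentiable (a \o inv M i : 'rV[R]_m -> R) (u t).
  apply: (near_eq_diff (f := fun v => oint h t0 (hd (loc_map psi i j v)))).
    by apply: (open_near_eq _ aE) => //; exact: open_loc_dom.
  apply: (@differentiable_comp _ _ _ _ (fun v => hd (loc_map psi i j v)) (oint h t0)).
    apply: (@differentiable_comp _ _ _ _ (loc_map psi i j) (@hd R n)) => //.
    by apply: differentiable_lin; exact: hd_continuous.
  by rewrite fE.
have du : differentiable u t := smooth_on_diff (smooth_curve_dom psi Hgeo i j) Dt.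
have sE s : curve_dom psi J gamma i j s -> oint h t0 (height psi gamma s) = (a \o inv M i) (u s).
  move=> Ds; have := aE _ (curve_dom_loc Ds).
  by rewrite -(heightE HM Ds).
have -> : height_flux psi gamma t = dir (dir (1 : R) u t) (a \o inv M i) (u t).
  rewrite -dir_comp// -(dir_near_eq _ oE Dt sE).
  rewrite (@dir_comp1 _ _ _ (height psi gamma) (oint h t0))//; last first.
    exact: smooth_on_diff (smooth_height oI HP HM psiI Hiso oJ Hgeo) Jt.
  rewrite -derive1_dir [derive1 (oint h t0) _]derive1E.
  rewrite (_ : 'D_1 (oint h t0) _ = h (psi (gamma t)).1); last exact: derive_val.
  exact: mulrC.
exact: derive_le_norm_grad.
Qed.

End FluxGradient.

(** * Frames along curves *)

Section Cayley.
Context {R : realType} {m : nat} (B : 'M[R]_m).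
Hypothesis skewB : B^T = - B.

Lemma inner_skew v : inner B v v = 0.
Proof.
have e : inner B v v = - inner B v v.
  rewrite {1}/inner -[in LHS](trmxK (v *m B *m v^T)) mxE !trmx_mul trmxK skewB.
  by rewrite mulNmx mulmxN mxE mulmxA.
have := subrr (inner B v v); rewrite {2}e opprK => /eqP.
by rewrite -mulr2n mulrn_eq0 => /eqP.
Qed.

Lemma inner1_gt0 (v : 'rV[R]_m) : v != 0 -> 0 < inner 1%:M v v.
Proof.
rewrite /inner mulmx1 => v0; rewrite mxE lt_neqAle sumr_ge0 ?andbT; last first.
  by move=> i _; rewrite mxE -expr2 sqr_ge0.
apply: contra v0 => /eqP/esym e0; apply/eqP/rowP => i; rewrite mxE.
have F (j : 'I_m) : true -> 0 <= v 0 j * v^T j 0 by rewrite mxE -expr2 sqr_ge0.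
by have /eqP := psumr_eq0P F e0 (erefl : true) (i := i); rewrite mxE mulf_eq0 orbb => /eqP.
Qed.

Lemma skew_add1_unit : 1%:M + B \in unitmx.
Proof.
apply: posdef_unit => v v0.
have -> : inner (1%:M + B) v v = inner 1%:M v v + inner B v v.
  by rewrite /inner mulmxDr mulmxDl mxE.
by rewrite inner_skew addr0 inner1_gt0.
Qed.

(** A substitute for the exponential of [- 2 B]: it is orthogonal for skew [B] and agrees with it to
    first order, but it is rational in [B], so its smoothness is that of a matrix inverse. *)
Definition cayley : 'M[R]_m := invmx (1%:M + B) *m (1%:M - B).

(** The equation [(1 + B) C = 1 - B] solved as a fixed point; when [B] carries a factor vanishing at
    a point, the first derivative of [C] there can be read off. *)
Lemma cayleyE : cayley = 1%:M - B *m (1%:M + cayley).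
Proof.
have e : (1%:M + B) *m cayley = 1%:M - B by rewrite mulKVmx ?skew_add1_unit.
rewrite mulmxDr mulmx1 opprD addrA -e mulmxDl mul1mx.
by rewrite addrK.
Qed.

End Cayley.

Lemma cayley_orthogonal (R : realType) m (B : 'M[R]_m) : B^T = - B ->
  cayley B *m (cayley B)^T = 1%:M.
Proof.
move=> skewB.
have skewN : (- B)^T = - - B by rewrite linearN/= skewB.
have uP : 1%:M + B \in unitmx := skew_add1_unit skewB.
have uN : 1%:M - B \in unitmx := skew_add1_unit skewN.
have tN : (1%:M - B)^T = 1%:M + B by rewrite linearB/= trmx1 skewB opprK.
have tP : (1%:M + B)^T = 1%:M - B by rewrite linearD/= trmx1 skewB.
rewrite /cayley trmx_mul trmx_inv tN tP.
have comm : (1%:M - B) *m (1%:M + B) = (1%:M + B) *m (1%:M - B).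
  by rewrite mulmxBl mulmxDl !mulmxBr !mulmxDr !mulmx1 !mul1mx opprD !addrA addrK subrK.
rewrite mulmxA -(mulmxA (invmx _)) comm mulmxA mulVmx// mul1mx mulmxV//.
Qed.

Section ParallelFrame.
Context {R : realType} {m : nat} (U : set 'rV[R]_m) (g : 'rV[R]_m -> 'M[R]_m).
Hypothesis Hg : metric_on U g.
Variables (D : set R) (u : R -> 'rV[R]_m) (t0 : R).
Hypothesis oD : open D.
Hypothesis uU : forall t, D t -> U (u t).
Hypothesis su : smooth_on D u.
Hypothesis Dt0 : D t0.

Lemma smooth_on_row (E : R -> 'M[R]_m) k : smooth_on D E -> smooth_on D (fun t => row k (E t)).
Proof.
move=> sE j; apply/(Ck_on_mx j _ oD) => a b.
have /(Ck_on_mx j _ oD) H := sE j.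
by apply: (Ck_on_ext oD _ (H k b)) => t _; rewrite mxE.
Qed.

(* A smooth orthonormal frame becomes parallel at [t0] when rotated by the Cayley
   transform of [(t - t0) / 2 *: B], [B] its covariant derivative at [t0]. *)
Lemma parallel_frame_at : exists e : R -> 'M[R]_m,
  [/\ smooth_on D e, forall t, D t -> orthonormal_frame (g (u t)) (e t) &
   forall k, cov g u (fun t => row k (e t)) (1 : R) t0 = 0].
Proof.
have sG : smooth_on D (fun t => g (u t)).
  by move=> k; apply: (Ck_on_comp oD (metric_on_open Hg) uU) => //; exact: metric_on_smooth.
have [E sE hE] := orthonormal_frame_smooth oD sG
  (fun t Dt => metric_on_sym Hg (uU Dt)) (fun t Dt => metric_on_pos Hg (uU Dt)).
pose C k := cov g u (fun t => row k (E t)) (1 : R) t0.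
pose B : 'M[R]_m := \matrix_(k, l) inner (g (u t0)) (C k) (row l (E t0)).
have dE k : differentiable (fun t => row k (E t)) t0.
  exact: smooth_on_diff (smooth_on_row k sE) Dt0.
(* The products [<e_l, e_k>] are constant in time, so their derivatives, which by compatibility are
   sums of an entry of [B] and its transpose, vanish. *)
have skewB : B^T = - B.
  apply/matrixP => k l; rewrite !mxE; apply/eqP; rewrite -subr_eq0 opprK; apply/eqP.
  have := cov_compat Hg uU su (1 : R) Dt0 (dE l) (dE k).
  rewrite (dir_near_eq (f' := fun=> (l == k)%:R : R) _ oD Dt0); last first.
    by move=> t Dt; rewrite (frame_inner (hE t Dt)).
  rewrite dir_cst => e; rewrite e.
  by congr (_ + _); rewrite innerC ?(metric_on_sym Hg (uU Dt0)).
pose X t := ((t - t0) / 2) *: B.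
have skewX t : (X t)^T = - X t by rewrite /X linearZ/= skewB scalerN.
pose O t := cayley (X t).
have CX k : Ck_on k D X.
  apply: Ck_on_scale => //; last exact: Ck_on_cst.
  apply: Ck_onM => //; last exact: Ck_on_cst.
  by apply: Ck_onD => //; [exact: Ck_on_id|exact: Ck_on_cst].
have sO : smooth_on D O.
  move=> k; apply: Ck_on_mulmx => //.
    apply: Ck_on_invmx => // [t _|]; first exact: skew_add1_unit.
    by apply: Ck_onD => //; exact: Ck_on_cst.
  by apply: Ck_onD => //; [exact: Ck_on_cst|exact: Ck_onN].
have dO : differentiable O t0 := smooth_on_diff sO Dt0.
have X0 : X t0 = 0 by rewrite /X subrr mul0r scale0r.
have O0 : O t0 = 1%:M by rewrite /O cayleyE// X0 mul0mx subr0.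
have DO : dir (1 : R) O t0 = - B.
  (* The factor [(t - t0) / 2] vanishes at [t0], so only the value [Y t0 = - 2 B] enters the
     derivative of [O]. *)
  pose Y t := - (B *m (1%:M + O t)).
  have sY : smooth_on D Y.
    move=> k; apply: Ck_onN => //; apply: Ck_on_mulmx => //; first exact: Ck_on_cst.
    by apply: Ck_onD => //; exact: Ck_on_cst.
  have OE t : O t = 1%:M + ((t - t0) / 2) *: Y t.
    by rewrite {1}/O cayleyE// {1}/X -scalemxAl /Y scalerN.
  have ds : differentiable (fun t : R => t - t0) t0.
    exact: (diffDf (f := id) (g := fun=> - t0)).
  have dk : differentiable (fun t : R => (t - t0) / 2) t0.
    by apply: (diffMf (f := fun t => t - t0) (g := fun=> 2^-1)) => //; exact: ds.
  have dY : differentiable Y t0 := smooth_on_diff sY Dt0.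
  rewrite (_ : O = fun t => 1%:M + ((t - t0) / 2) *: Y t); last exact/funext.
  rewrite dirD//; last exact: differentiable_scale.
  rewrite dir_cst add0r dir_scale// subrr mul0r scale0r addr0.
  rewrite dirM//.
  rewrite dirD// !dir_cst dir_id addr0 mulr0 addr0 mul1r /Y O0.
  by rewrite mulmxDr !mulmx1 -mulr2n -[B *+ 2]scaler_nat scalerN scalerA mulVf ?scale1r.
exists (fun t => O t *m E t); split.
- by move=> k; exact: Ck_on_mulmx.
- move=> t Dt; rewrite /orthonormal_frame trmx_mul !mulmxA -(mulmxA _ (E t) (g _)).
  by rewrite -(mulmxA (O t)) hE// mulmx1 cayley_orthogonal.
move=> k.
have eE : (fun t => row k (O t *m E t)) = fun t => \sum_l O t k l *: row l (E t).
  apply/funext => t; apply/rowP => a; rewrite !mxE summxE.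
  by apply: eq_bigr => l _; rewrite !mxE.
have dOkl l : differentiable (fun t => O t k l) t0.
  have /(Ck_on_mx 1 _ oD) := sO 1%N => /(_ k l) [H _]; exact: H.
rewrite covxE eE dir_sumf; last by move=> l; exact: differentiable_scale.
rewrite O0 mul1mx.
have -> : \sum_l dir (1 : R) (fun t => O t k l *: row l (E t)) t0 =
    \sum_l (- B) k l *: row l (E t0) + dir (1 : R) (fun t => row k (E t)) t0.
  rewrite (eq_bigr (fun l => (- B) k l *: row l (E t0) +
      (1%:M : 'M[R]_m) k l *: dir (1 : R) (fun t => row l (E t)) t0)); last first.
    by move=> l _; rewrite dir_scale// -dir_mxE// DO O0.
  rewrite big_split/=; congr (_ + _).
  rewrite (bigD1 k)//= mxE eqxx scale1r big1 ?addr0// => l lk.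
  by rewrite mxE eq_sym (negbTE lk) scale0r.
rewrite -addrA.
rewrite -(covxE g u (fun t => row k (E t)) (1 : R) t0) -/(C k) (frame_expand (hE _ Dt0) (C k)) -big_split big1//= => l _.
by rewrite !mxE scaleNr addNr.
Qed.

End ParallelFrame.

(** * Lengths of paths *)

Section PathLength.
Context {R : realType} {m : nat} (M : atlas_metric R m).

Lemma speed_ge0 (gamma : R -> M) t : 0 <= speed gamma t.
Proof. exact: sqrtr_ge0. Qed.

Lemma path_length_ge0 (x y : M) l : path_length x y l -> 0 <= l.
Proof.
elim=> // gamma a b e z k _ _ _ _ k0; rewrite addr_ge0//.
by apply: Rintegral_ge0 => t _; exact: speed_ge0.
Qed.

Lemma path_length_trans (x y z : M) l k :
  path_length x y l -> path_length y z k -> path_length x z (l + k).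
Proof.
elim=> [w|gamma a b e w l' ab e0 C _ IH] H; first by rewrite add0r.
by rewrite -addrA; apply: (path_cons ab e0 C); exact: IH.
Qed.

Lemma rdist_le (x y : M) l : path_length x y l -> rdist x y <= l.
Proof.
by move=> H; apply: ge_inf => //; exists 0 => k /=; exact: path_length_ge0.
Qed.

End PathLength.

Section ChartPaths.
Context {R : realType} {m : nat} (M : atlas_metric R m).
Hypothesis HM : riemannian_manifold M.
Variable j : idx M.

Section ChartCurve.
Variables (E : set R) (c : R -> 'rV[R]_m).
Hypothesis oE : open E.
Hypothesis sc : smooth_on E c.
Hypothesis cj : forall t, E t -> cod j (c t).

Lemma overlap_cod_inv i u : cod j u -> dom M i (inv M j u) -> overlap j i u.
Proof. by move=> cu di; exists (inv M j u); rewrite ?to_inv//; split=> //; exact: inv_dom. Qed.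

(** [speed] switches from chart to chart along the curve; compatibility of the metrics allows it to
    be computed in the single chart [j]. *)
Lemma speed_chart t : E t ->
  speed (inv M j \o c) t =
  Num.sqrt (inner (metric M j (c t)) (dir (1 : R) c t) (dir (1 : R) c t)).
Proof.
move=> Et; rewrite /speed /=; set i := chart_at M _.
have di : dom M i (inv M j (c t)) := rm_cover HM _.
have Ov : overlap j i (c t) := overlap_cod_inv (cj Et) di.
rewrite derive1_dir.
rewrite (_ : to M i \o (inv M j \o c) = trans j i \o c)//.
rewrite dir_comp; [|exact: smooth_on_diff sc Et|exact: smooth_on_diff (smooth_trans HM j i) Ov].
by rewrite (pullback_inner (smooth_trans HM j i) (fun u => @pullback_trans _ _ _ HM j i u)).
Qed.

Lemma Ck_curve_chart k : Ck_curve k E (inv M j \o c).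
Proof.
split=> [t Et|i].
  apply: continuous_comp; first exact: smooth_on_continuous sc Et.
  exact: rm_inv_cont HM j _ (cj Et).
have oF : open (E `&` (inv M j \o c) @^-1` dom M i).
  apply: open_preimage_on => // [t Et|]; last exact: rm_dom_open HM i.
  apply: continuous_comp; first exact: smooth_on_continuous sc Et.
  exact: rm_inv_cont HM j _ (cj Et).
apply: (Ck_on_comp (U' := overlap j i) (g := trans j i) oF).
- exact: open_overlap.
- by move=> t [Et di]; exact: overlap_cod_inv (cj Et) di.
- by apply: Ck_on_sub (sc k) => t [].
- exact: smooth_trans.
Qed.

End ChartCurve.

(** A pointwise bound on the speed by a derivative becomes a bound on the length by an increment.
    Room [e] beyond both ends is required because an arc must extend as a [C^1] curve. *)
Lemma chart_path (E : set R) (c : R -> 'rV[R]_m) (F dF : R -> R) a b e : open E -> smooth_on E c ->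
  (forall t, E t -> cod j (c t)) -> a <= b -> 0 < e ->
  (forall t, a - e < t < b + e -> E t) ->
  (forall t, a <= t <= b -> is_derive t 1 F (dF t)) ->
  (forall t, a <= t <= b ->
    Num.sqrt (inner (metric M j (c t)) (dir (1 : R) c t) (dir (1 : R) c t)) <= dF t) ->
  exists2 l, path_length (inv M j (c a)) (inv M j (c b)) l & l <= F b - F a.
Proof.
move=> oE sc cj ab e0 iE hF le.
have Iab t : a <= t <= b -> E t.
  by move=> /andP[at_ tb]; apply: iE; rewrite (lt_le_trans _ at_) ?gtrBl// (le_lt_trans tb)// ltrDl.
exists (curve_length (inv M j \o c) a b + 0).
  apply: (path_cons (gamma := inv M j \o c) ab e0); last exact: path_nil.
  have [H1 H2] := Ck_curve_chart oE sc cj 1.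
  have sub : `]a - e, b + e[%classic `<=` E by move=> t /=; rewrite in_itv/=; exact: iE.
  split=> [t /sub|i]; first exact: H1.
  by apply: Ck_on_sub (H2 i) => t [/sub].
rewrite addr0; apply: (integral_le_derive e0 ab _ hF) => [t /iE Et|t /[dup] /Iab Et /le]; last first.
  by rewrite (speed_chart sc cj).
have C0 : Ck_on 0 E (fun t => Num.sqrt (inner (metric M j (c t)) (dir (1 : R) c t) (dir (1 : R) c t))).
  move=> s Es; apply: (@continuous_comp _ _ _ _ Num.sqrt); last exact: sqrt_continuous.
  have := smooth_on_inner_along (metric_on_chart HM j) oE cj sc (smooth_on_dir (1 : R) sc) (smooth_on_dir (1 : R) sc).
  by move=> H; exact: smooth_on_continuous H Es.
have : Ck_on 0 E (speed (inv M j \o c)).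
  by apply: Ck_on_ext C0 => // s Es; rewrite (speed_chart sc cj).
by move=> H; exact: H Et.
Qed.

Lemma coord_le_norm p q (A : 'M[R]_(p, q)) a b : `|A a b| <= `|A|.
Proof. have -> : `|A| = mx_norm A by [].
by rewrite mx_normrE; exact: (le_bigmax _ (fun i => `|A i.1 i.2|) (a, b)). Qed.

Lemma inner_le_entries n (G : 'M[R]_n) (v : 'rV[R]_n) B e : 0 <= e -> (forall a b, `|G a b| <= B) ->
  (forall a, `|v 0 a| <= e) -> inner G v v <= n%:R ^+ 2 * B * e ^+ 2.
Proof.
move=> e0 GB ve; rewrite inner_expand.
have -> : n%:R ^+ 2 * B * e ^+ 2 = \sum_(a < n) \sum_(b < n) e * e * B.
  rewrite !sumr_const !card_ord -mulrnA -[_ *+ (n * n)]mulr_natl natrM.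
  have gen (x : R) : x ^+ 2 * B * e ^+ 2 = x * x * (e * e * B) by ring.
  exact: gen.
apply: ler_sum => a _; apply: ler_sum => b _.
apply: le_trans (ler_norm _) _; rewrite inner_delta !normrM.
by apply: ler_pM; rewrite ?mulr_ge0//; apply: ler_pM.
Qed.

(** Near a point the distance is at most a constant times the coordinate distance, by straight
    segments in the chart. The constant must not depend on the end points, since it is applied to
    pairs of points moving with [s]. *)
Lemma segment_path u0 : cod j u0 -> exists2 C, 0 < C & exists2 d, 0 < d &
  forall x y e, 0 <= e -> `|x - u0| < d -> `|y - u0| < d -> (forall a, `|(y - x) 0 a| <= e) ->
    exists2 l, path_length (inv M j x) (inv M j y) l & l <= C * e.
Proof.
move=> cu0; have mo := metric_on_chart HM j.
pose B : R := 1 + `|metric M j u0|.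
have near1 : \forall u \near u0, `|metric M j u| < B.
  have cm : {for u0, continuous (metric M j)}.
    exact: smooth_on_continuous (metric_on_smooth mo) cu0.
  have := @cvgr_norm_lt _ _ _ _ _ _ _ cm B; apply.
  by rewrite /B ltrDr.
have near2 : \forall u \near u0, cod j u.
  by apply: open_nbhs_nbhs; split=> //; exact: metric_on_open mo.
have /nbhs_ballP[r /= r0 Hr] : \forall u \near u0, cod j u /\ `|metric M j u| < B.
  by apply: filterS2 near2 near1.
have B0 : 0 < B by rewrite ltr_pwDl.
(* A vector with entries at most [e] has length at most [m e] times the square root of [B]; the
   added [1] keeps [C] positive even when [m = 0]. *)
pose C : R := m%:R * Num.sqrt B + 1.
have C0 : 0 < C by rewrite ltr_wpDl// mulr_ge0// sqrtr_ge0.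
(* On the enlarged parameter interval from [-1] to [2] both coefficients [1 - t] and [t] are at most
   [2] in absolute value, so end points within [r / 4] keep the segment within [r]. *)
exists C => //; exists (r / 4); first by rewrite divr_gt0.
move=> x y e e0 xd yd ye.
pose c (t : R) := x + t *: (y - x).
pose E : set R := [set t : R | -1 < t < 2].
have cE t : E t -> cod j (c t) /\ `|metric M j (c t)| < B.
  move=> /andP[t1 t2]; apply: Hr; rewrite -ball_normE /= distrC.
  have -> : c t - u0 = (1 - t) *: (x - u0) + t *: (y - u0).
    rewrite /c !scalerBr !scalerBl !scale1r.
    by rewrite [RHS]addrAC; apply/eqP; rewrite -subr_eq0; apply/eqP/rowP => k; rewrite !mxE; ring.
  apply: le_lt_trans (ler_normD _ _) _; rewrite !normrZ.
  have a1 : `|1 - t| <= 2 by rewrite ler_norml; lra.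
  have a2 : `|t| <= 2 by rewrite ler_norml; lra.
  have gen (p q : R) : 0 <= p -> p < r / 4 -> 0 <= q -> q <= 2 -> q * p <= 2 * p.
    by move=> *; rewrite ler_wpM2r.
  have b1 := gen _ _ (normr_ge0 (x - u0)) xd (normr_ge0 _) a1.
  have b2 := gen _ _ (normr_ge0 (y - u0)) yd (normr_ge0 _) a2.
  have fin (a b p q : R) : a <= 2 * p -> b <= 2 * q -> p < r / 4 -> q < r / 4 -> a + b < r by lra.
  exact: fin b1 b2 xd yd.
have oE : open E := @open_oo R _ _.
have sc : smooth_on E c.
  move=> k; apply: Ck_onD => //; first exact: Ck_on_cst.
  by apply: Ck_on_scale => //; [exact: Ck_on_id|exact: Ck_on_cst].
have dc t : dir (1 : R) c t = y - x.
  have d1 : differentiable (fun t : R => t *: (y - x)) t.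
    exact: (@differentiable_scale R R _ id (fun=> y - x) t).
  rewrite (dirD _ _ d1)//.
  by rewrite dir_cst add0r (dir_scale (k := id))// dir_id dir_cst scaler0 addr0 scale1r.
have := @chart_path E c (fun t => t * (C * e)) (fun=> C * e) 0 1 1 oE sc
  (fun t Et => (cE t Et).1) ler01 ltr01.
have -> : c 0 = x by rewrite /c scale0r addr0.
have -> : c 1 = y by rewrite /c scale1r addrC subrK.
rewrite mul0r mul1r subr0; apply.
- by move=> t /andP[t1 t2]; rewrite /E /=; lra.
- move=> t _; have : is_derive t 1 (id * cst (C * e)) (t *: (0 : R) + (C * e) *: (1 : R)).
    by apply: is_deriveM.
  by rewrite scaler0 add0r [_ *: _]mulr1.
move=> t /andP[t1 t2]; rewrite dc.
have Et : E t by rewrite /E /=; lra.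
have le1 := inner_le_entries e0 (fun a b => le_trans (coord_le_norm (metric M j (c t)) a b) (ltW (cE t Et).2)) ye.
apply: le_trans (ler_wsqrtr le1) _.
have -> : m%:R ^+ 2 * B * e ^+ 2 = (m%:R * e) ^+ 2 * B.
  have gen (p q : R) : p ^+ 2 * q * e ^+ 2 = (p * e) ^+ 2 * q by ring.
  exact: gen.
rewrite sqrtrM ?sqr_ge0// sqrtr_sqr ger0_norm ?mulr_ge0//.
by rewrite mulrAC ler_wpM2r// /C lerDl.
Qed.

End ChartPaths.

(** * Second order jets of curves *)

Section Jets.
Context {R : realType}.

Lemma is_derive_dir (f : R -> R) t : differentiable f t -> is_derive t 1 f (dir (1 : R) f t).
Proof. by move=> df; apply: DeriveDef; [exact/derivable1_diffP|rewrite dirE]. Qed.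

Lemma is_derive_coord p q (f : R -> 'M[R]_(p, q)) t a b : differentiable f t ->
  is_derive t 1 (fun s => f s a b) (dir (1 : R) f t a b).
Proof.
move=> df; rewrite dir_mxE//; apply: is_derive_dir.
apply: (@differentiable_comp _ _ _ _ f (fun A : 'M[R]_(p, q) => A a b)) => //.
exact: differentiable_coord.
Qed.

Lemma jet2_small m (E : set R) (d : R -> 'rV[R]_m) e : open E -> E 0 -> smooth_on E d ->
  d 0 = 0 -> dir (1 : R) d 0 = 0 -> dir (1 : R) (dir (1 : R) d) 0 = 0 -> 0 < e ->
  exists2 r, 0 < r & forall s, 0 < s < r -> forall k, `|d s 0 k| <= s ^+ 2 * e.
Proof.
move=> oE E0 sd d0 d1 d2 e0.
have sd1 := smooth_on_dir (1 : R) sd; have sd2 := smooth_on_dir (1 : R) sd1.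
set dd := dir (1 : R) (dir (1 : R) d) in d2 sd2.
have cdd : {for 0, continuous dd} := smooth_on_continuous sd2 E0.
(* Taylor's formula multiplies the bound on the second derivative by [s^2 / 2], hence the factor
   [2]. *)
have near1 : \forall s \near (0 : R), `|dd s| < 2 * e.
  have := @cvgr_norm_lt _ _ _ _ _ _ _ cdd (2 * e); apply.
  by rewrite d2 normr0 mulr_gt0.
have near2 : \forall s \near (0 : R), E s by exact: open_nbhs_nbhs.
have /nbhs_ballP[r /= r0 Hr] : \forall s \near (0 : R), E s /\ `|dd s| < 2 * e.
  by apply: filterS2 near2 near1.
exists r => // s /andP[s0 sr] k.
have Hx x : 0 <= x <= s -> E x /\ `|dd x| < 2 * e.
  by move=> /andP[x0 xs]; apply: Hr; rewrite /ball/= sub0r normrN ger0_norm// (le_lt_trans xs).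
have D1 x : 0 <= x <= s -> is_derive x 1 (fun t => d t 0 k) (dir (1 : R) d x 0 k).
  by move=> /Hx[Ex _]; apply: is_derive_coord; exact: smooth_on_diff sd Ex.
have D2 x : 0 <= x <= s -> is_derive x 1 (fun t => dir (1 : R) d t 0 k) (dd x 0 k).
  by move=> /Hx[Ex _]; apply: is_derive_coord; exact: smooth_on_diff sd1 Ex.
have bd x : 0 <= x <= s -> `|dd x 0 k| <= 2 * e.
  by move=> /Hx[_ /ltW]; apply: le_trans; exact: coord_le_norm.
have gen (a : R) : 0 + s * 0 + s ^+ 2 / 2 * (2 * a) = s ^+ 2 * a by field.
rewrite ler_norml -(gen e); apply/andP; split.
  have := @taylor2_le R (fun t => - d t 0 k) (fun t => - dir (1 : R) d t 0 k) (fun t => - dd t 0 k) (2 * e) s (ltW s0).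
  rewrite d0 d1 !mxE oppr0 lerNl; apply.
  - by move=> x xs; have := D1 x xs => H; apply: is_deriveN.
  - by move=> x xs; have := D2 x xs => H; apply: is_deriveN.
  - by move=> x xs; rewrite lerNl; have := bd x xs; rewrite ler_norml => /andP[].
have := taylor2_le (ltW s0) D1 D2 (c := 2 * e); rewrite d0 d1 !mxE; apply.
by move=> x xs; have := bd x xs; rewrite ler_norml => /andP[].
Qed.

(** The minus sign is that of the geodesic equation [u'' = - Gam (u', u')]: for [a = Gam (v, v)] at
    [u], the covariant acceleration at [s = 0] is zero. *)
Definition jet m (u v a : 'rV[R]_m) (s : R) : 'rV[R]_m := u + s *: v - (s ^+ 2 / 2) *: a.

Context {m : nat}.
Implicit Types u v a : 'rV[R]_m.

Lemma Ck_on_sqr2 k (V : normedModType R) (E : set V) (f : V -> R) : open E -> Ck_on k E f ->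
  Ck_on k E (fun x => f x ^+ 2 / 2).
Proof.
by move=> oE Cf; apply: Ck_onM => //; [exact: Ck_onM|exact: Ck_on_cst].
Qed.

Lemma smooth_on_jet (E : set R) u v a : open E -> smooth_on E (jet u v a).
Proof.
move=> oE k; apply: Ck_onD => //.
  apply: Ck_onD => //; first exact: Ck_on_cst.
  by apply: Ck_on_scale => //; [exact: Ck_on_id|exact: Ck_on_cst].
apply: Ck_onN => //; apply: Ck_on_scale => //; last exact: Ck_on_cst.
by apply: Ck_on_sqr2 => //; exact: Ck_on_id.
Qed.

Lemma dir_scalec (f : R -> R) (v : 'rV[R]_m) t : differentiable f t ->
  differentiable (fun s => f s *: v) t /\
  dir (1 : R) (fun s => f s *: v) t = dir (1 : R) f t *: v.
Proof.
move=> df; split; first exact: (@differentiable_scale R R _ f (fun=> v) t).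
by rewrite dir_scale// dir_cst scaler0 addr0.
Qed.

Lemma dir_jet u v a : dir (1 : R) (jet u v a) = fun s => v - s *: a.
Proof.
apply/funext => s.
have did : differentiable (id : R -> R) s by [].
have [d1 e1] := dir_scalec v did.
have dsq : differentiable (fun t : R => t ^+ 2 / 2) s.
  have := smooth_on_diff (fun k => @Ck_on_sqr2 k R setT id openT (Ck_on_id k setT)) (I : setT s).
  exact.
have [d2 e2] := dir_scalec (- a) dsq.
have -> : jet u v a = fun s => (u + s *: v) + (s ^+ 2 / 2) *: (- a).
  by apply/funext => t; rewrite /jet scalerN.
have d3 : differentiable (fun t : R => u + t *: v) s.
  exact: (@differentiableD _ _ _ (fun=> u) (fun t : R => t *: v)).
rewrite dirD// dirD// dir_cst add0r e1 e2 dir_id scale1r scalerN; congr (_ - _ *: _).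
rewrite (dirM (f := fun t : R => t * t) (g := fun=> 2^-1))//.
rewrite (dirM (f := id) (g := id))// dir_id dir_cst.
have gen (x : R) : (1 * x + x * 1) * 2^-1 + x * x * 0 = x by field.
exact: gen.
Qed.

Lemma dir2_jet u v a : dir (1 : R) (dir (1 : R) (jet u v a)) = fun=> - a.
Proof.
apply/funext => s; rewrite dir_jet.
have did : differentiable (id : R -> R) s by [].
have [d1 e1] := dir_scalec (- a) did.
have -> : (fun s : R => v - s *: a) = fun s => v + s *: (- a).
  by apply/funext => t; rewrite scalerN.
by rewrite dirD// dir_cst add0r e1 dir_id scale1r.
Qed.

Lemma jet0 u v a : jet u v a 0 = u.
Proof. by rewrite /jet expr0n mul0r !scale0r addr0 subr0. Qed.

Lemma dir_jet0 u v a : dir (1 : R) (jet u v a) 0 = v.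
Proof. by rewrite dir_jet scale0r subr0. Qed.

End Jets.

Section Junction.
Context {R : realType} {m : nat} (M : atlas_metric R m).
Hypothesis HM : riemannian_manifold M.

(* Agrees to second order at [s = 0] with the exponential map at [x] of [s v]. *)
Definition jet_point i (x : M) (v : 'rV[R]_m) (s : R) : M :=
  inv M i (jet (to M i x) v (christoffel_form (metric M i) (to M i x) v v) s).

(* The two curves have the same 2-jet at [s = 0], the second covariant
   derivative being natural under changes of charts. *)
Lemma jet_point_junction i j x v e : dom M i x -> dom M j x -> 0 < e ->
  exists2 r, 0 < r & forall s, 0 < s < r ->
    exists2 l, path_length (jet_point i x v s)
      (jet_point j x (dir v (trans i j) (to M i x)) s) l & l <= s ^+ 2 * e.
Proof.
move=> di dj e0; set w := dir v _ _.
set ui := to M i x; set uj := to M j x.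
have Ov : overlap i j ui := overlap_to di dj.
have cuj : cod j uj := cod_to dj.
set p := jet ui v (christoffel_form (metric M i) ui v v).
set c := jet uj w (christoffel_form (metric M j) uj w w).
have [C C0 [d d0 Hseg]] := segment_path HM cuj.
have cp : {for 0, continuous p} := smooth_on_continuous (smooth_on_jet _ _ _ openT) (I : setT 0).
have cc : {for 0, continuous c} := smooth_on_continuous (smooth_on_jet _ _ _ openT) (I : setT 0).
pose E : set R := p @^-1` overlap i j.
have oE : open E.
  apply: open_comp; last exact: open_overlap.
  by move=> s _; exact: smooth_on_continuous (smooth_on_jet _ _ _ openT) (I : setT s).
have E0 : E 0 by rewrite /E /= /p jet0.
have sp : smooth_on E p := smooth_on_jet _ _ _ oE.
have sc : smooth_on E c := smooth_on_jet _ _ _ oE.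
pose q := trans i j \o p.
have sq : smooth_on E q.
  by move=> k; apply: (Ck_on_comp (U' := overlap i j) oE) => //; [exact: open_overlap|exact: smooth_trans].
have q0 : q 0 = uj by rewrite /q /= /p jet0 trans_to.
have dp0 : dir (1 : R) p 0 = v by rewrite /p dir_jet0.
have q1 : dir (1 : R) q 0 = w.
  rewrite /q dir_comp; last 2 first.
  - exact: smooth_on_diff sp E0.
  - by rewrite /p jet0; exact: smooth_on_diff (smooth_trans HM i j) Ov.
  by rewrite dp0 /p jet0.
(* [p] has zero covariant acceleration at [0]; an isometry preserves this, so the second derivative
   of [q] is forced to be that of [c]. *)
have q2 : dir (1 : R) (dir (1 : R) q) 0 = - christoffel_form (metric M j) uj w w.
  have := cov_comp_square (metric_on_overlap HM i j) (metric_on_chart HM j) (@trans_cod _ _ _ HM i j)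
    (smooth_trans HM i j) (@pullback_trans _ _ _ HM i j) (1 : R) (1 : R) oE (fun s (Es : E s) => Es) sp E0.
  rewrite !covxE -/q q1 -/(q 0) q0 dp0 {1}/p dir2_jet {1}/p jet0 addNr => H.
  apply/eqP; rewrite -addr_eq0; apply/eqP; rewrite H.
  by rewrite dirE derive0.
pose dl s := c s - q s.
have sdl : smooth_on E dl by move=> k; apply: Ck_onD => //; exact: Ck_onN.
have dirB (f g : R -> 'rV[R]_m) s : smooth_on E f -> smooth_on E g -> E s ->
    dir (1 : R) (fun t => f t - g t) s = dir (1 : R) f s - dir (1 : R) g s.
  move=> sf sg Es; rewrite !dirE (@deriveB _ _ _ f g)//.
    exact: diff_derivable (smooth_on_diff sf Es).
  exact: diff_derivable (smooth_on_diff sg Es).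
have dl0 : dl 0 = 0 by rewrite /dl /c jet0 q0 subrr.
have dl1 : dir (1 : R) dl 0 = 0 by rewrite /dl dirB// q1 /c dir_jet0 subrr.
have dl2 : dir (1 : R) (dir (1 : R) dl) 0 = 0.
  rewrite (dir_near_eq (f' := fun s => dir (1 : R) c s - dir (1 : R) q s) _ oE E0); last first.
    by move=> s Es; exact: dirB.
  rewrite dirB//; [|exact: smooth_on_dir|exact: smooth_on_dir].
  by rewrite q2 /c dir2_jet subrr.
have eC : 0 < e / C by rewrite divr_gt0.
have [r r0 Hr] := jet2_small oE E0 sdl dl0 dl1 dl2 eC.
have near1 : \forall s \near (0 : R), [/\ E s, `|q s - uj| < d & `|c s - uj| < d].
  have cq : {for 0, continuous q} := smooth_on_continuous sq E0.
  have n1 : \forall s \near (0 : R), E s by exact: open_nbhs_nbhs.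
  have n2 : \forall s \near (0 : R), `|q s - uj| < d.
    by rewrite -q0; near=> s; rewrite distrC; near: s; exact: cvgr_dist_lt.
  have n3 : \forall s \near (0 : R), `|c s - uj| < d.
    rewrite -(jet0 uj w (christoffel_form (metric M j) uj w w)).
    by near=> s; rewrite distrC; near: s; exact: cvgr_dist_lt.
  by near=> s; split; near: s.
have /nbhs_ballP[r' /= r'0 Hr'] := near1.
exists (Num.min r r'); first by rewrite lt_min r0.
move=> s /andP[s0]; rewrite lt_min => /andP[sr sr'].
have [Es qd cd] : [/\ E s, `|q s - uj| < d & `|c s - uj| < d].
  by apply: Hr'; rewrite /ball/= sub0r normrN gtr0_norm.
have ds k : `|(c s - q s) 0 k| <= s ^+ 2 * (e / C) by apply: Hr; rewrite s0.
have [l Hl le] := Hseg _ _ _ (mulr_ge0 (sqr_ge0 s) (ltW eC)) qd cd ds.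
exists l; last first.
  apply: le_trans le _; by rewrite mulrCA [C * _]mulrC divfK// gt_eqF.
have -> : jet_point i x v s = inv M j (q s); last exact: Hl.
have [y [yi yj] e1] := Es.
rewrite /jet_point -/ui -/p /q /= /trans /= -e1 (rm_toK HM yi) (rm_toK HM yj)//.
Unshelve. all: by end_near.
Qed.

End Junction.

(** * The second variation inequality *)

Section Plane.
Context {R : realType}.

Definition ds : R * R := (1, 0).
Definition dt : R * R := (0, 1).

Lemma dir_ds (W : normedModType R) (F : R * R -> W) s t :
  dir ds F (s, t) = dir (1 : R) (fun x => F (x, t)) s.
Proof.
have E : (fun h : R => h^-1 *: ((F \o shift (s, t)) (h *: ds) - F (s, t))) =
    (fun h => h^-1 *: (((fun x => F (x, t)) \o shift s) (h *: (1 : R)) - F (s, t))).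
  apply/funext => h /=; congr (_ *: (F _ - _)).
  by rewrite /ds; apply: injective_projections => /=; rewrite ?scaler0 ?add0r.
by rewrite !dirE /derive E.
Qed.

Lemma dir_dt (W : normedModType R) (F : R * R -> W) s t :
  dir dt F (s, t) = dir (1 : R) (fun y => F (s, y)) t.
Proof.
have E : (fun h : R => h^-1 *: ((F \o shift (s, t)) (h *: dt) - F (s, t))) =
    (fun h => h^-1 *: (((fun x => F (s, x)) \o shift t) (h *: (1 : R)) - F (s, t))).
  apply/funext => h /=; congr (_ *: (F _ - _)).
  by rewrite /dt; apply: injective_projections => /=; rewrite ?scaler0 ?add0r.
by rewrite !dirE /derive E.
Qed.

Lemma differentiable_ds (F : R * R -> R) s t : differentiable F (s, t) ->
  is_derive s 1 (fun x => F (x, t)) (dir ds F (s, t)).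
Proof.
move=> dF; apply: DeriveDef; last by rewrite dir_ds dirE.
apply/derivable1_diffP.
apply: (@differentiable_comp _ _ _ _ (fun x : R => (x, t)) F) => //.
Qed.

Lemma fst_cont : continuous (@fst R R). Proof. by move=> z; exact: cvg_fst. Qed.
Lemma snd_cont : continuous (@snd R R). Proof. by move=> z; exact: cvg_snd. Qed.

Lemma open_snd (D : set R) : open D -> open [set z : R * R | D z.2].
Proof. by move=> oD; apply: (@open_comp _ _ (@snd R R)) => // z _; exact: snd_cont. Qed.

Lemma smooth_on_snd (W : normedModType R) (D : set R) (F : R -> W) : open D -> smooth_on D F ->
  smooth_on [set z : R * R | D z.2] (fun z => F z.2).
Proof.
move=> oD sF k; apply: (Ck_on_comp1 (open_snd oD) oD) => //.
by apply: Ck_on_linear; [exact: open_snd|exact: snd_cont].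
Qed.

End Plane.

Section SecondVariation.
Context {R : realType} {m : nat} (M : atlas_metric R m).
Hypothesis HM : riemannian_manifold M.
Variable j : idx M.
Local Notation g := (metric M j).
Local Notation Gam := (christoffel_form g).
Variables (D : set R) (u V : R -> 'rV[R]_m).
Hypothesis oD : open D.
Hypothesis uj : forall t, D t -> cod j (u t).
Hypothesis su : smooth_on D u.
Hypothesis sV : smooth_on D V.
Hypothesis geo : forall t, D t -> cov g u (dir (1 : R) u) (1 : R) t = 0.

(** The Hessian of the energy at a geodesic, up to normalization. The tangential part of the fields
    is not projected away. *)
Definition index_form (X Y : R -> 'rV[R]_m) t :=
  inner (g (u t)) (cov g u X (1 : R) t) (cov g u Y (1 : R) t)
  - inner (g (u t)) (riem_op g (u t) (X t) (dir (1 : R) u t) (dir (1 : R) u t)) (Y t).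

Definition tangential t := inner (g (u t)) (V t) (dir (1 : R) u t).

Let Hg := metric_on_chart HM j.

(** Each transverse curve [s |-> f (s, t)] has zero covariant acceleration at [s = 0], which removes
    the acceleration term from the second variation formula. *)
Definition vari (z : R * R) : 'rV[R]_m := jet (u z.2) (V z.2) (Gam (u z.2) (V z.2) (V z.2)) z.1.

Local Notation f := vari.

Definition vari_dom : set (R * R) := [set z : R * R | D z.2] `&` f @^-1` cod j.

Let sGam : smooth_on D (fun t => Gam (u t) (V t) (V t)).
Proof.
apply: (smooth_on_bilin_along Hg oD uj su (B := Gam)) => //.
- by move=> y; exact: Gam_expand.
- exact: (smooth_on_Gam Hg).
Qed.

Let sf0 : smooth_on [set z : R * R | D z.2] f.
Proof.
have oS := open_snd oD.
move=> k; apply: Ck_onD => //.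
  apply: Ck_onD => //; first exact: (smooth_on_snd oD su).
  apply: Ck_on_scale => //; last exact: (smooth_on_snd oD sV).
  by apply: Ck_on_linear => //; exact: fst_cont.
apply: Ck_onN => //; apply: Ck_on_scale => //; last exact: (smooth_on_snd oD sGam).
by apply: Ck_on_sqr2 => //; apply: Ck_on_linear => //; exact: fst_cont.
Qed.

Lemma open_vari_dom : open vari_dom.
Proof.
apply: open_preimage_on; first exact: open_snd.
  by move=> z Dz; exact: smooth_on_continuous sf0 Dz.
exact: metric_on_open Hg.
Qed.

Lemma smooth_vari : smooth_on vari_dom f.
Proof. by move=> k; apply: Ck_on_sub (sf0 k) => z []. Qed.

Lemma vari_cod z : vari_dom z -> cod j (f z).
Proof. by case. Qed.

Let T := vari_dom.
Let oT : open T := open_vari_dom.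
Let sf : smooth_on T f := smooth_vari.
Let fj := vari_cod.

Lemma vari0 t : f (0, t) = u t.
Proof. by rewrite /vari jet0. Qed.

Lemma vari_dom0 t : D t -> T (0, t).
Proof. by move=> Dt; split=> //=; rewrite vari0; exact: uj. Qed.

Lemma dt_vari0 t : dir dt f (0, t) = dir (1 : R) u t.
Proof. by rewrite dir_dt; congr (dir _ _ _); apply/funext => x; exact: vari0. Qed.

Lemma ds_vari s t : dir ds f (s, t) = V t - s *: Gam (u t) (V t) (V t).
Proof. by rewrite dir_ds -[fun x => _]/(jet (u t) (V t) (Gam (u t) (V t) (V t))) dir_jet. Qed.

Lemma ds_vari0 t : dir ds f (0, t) = V t.
Proof. by rewrite ds_vari scale0r subr0. Qed.

Lemma dsds_vari t : dir ds (dir ds f) (0, t) = - Gam (u t) (V t) (V t).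
Proof.
rewrite dir_ds.
rewrite (_ : (fun x => dir ds f (x, t)) = dir (1 : R) (jet (u t) (V t) (Gam (u t) (V t) (V t)))).
  by rewrite dir2_jet.
by apply/funext => s; rewrite ds_vari dir_jet.
Qed.

Lemma cov_dsds_vari0 t : cov g f (dir ds f) ds (0, t) = 0.
Proof. by rewrite covxE dsds_vari vari0 ds_vari0 addNr. Qed.

Lemma cov_dtds_vari0 t : cov g f (dir ds f) dt (0, t) = cov g u V (1 : R) t.
Proof.
rewrite !covxE vari0 ds_vari0 dt_vari0 dir_dt; congr (dir _ _ _ + _).
by apply/funext => y; rewrite ds_vari0.
Qed.

(** The squared speed of the curves with [s] fixed, followed by its first two [s] derivatives on the
    whole domain; away from [s = 0] the second is used only through its continuity. *)
Definition speed2 z := inner (g (f z)) (dir dt f z) (dir dt f z).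
Definition dspeed2 z := 2 * inner (g (f z)) (cov g f (dir dt f) ds z) (dir dt f z).
Definition ddspeed2 z :=
  2 * (inner (g (f z)) (cov g f (cov g f (dir dt f) ds) ds z) (dir dt f z)
    + inner (g (f z)) (cov g f (dir dt f) ds z) (cov g f (dir dt f) ds z)).

Let sdt : smooth_on T (dir dt f) := smooth_on_dir dt sf.
Let scdt : smooth_on T (cov g f (dir dt f) ds) := smooth_on_cov Hg oT fj sf ds sdt.
Let sccdt : smooth_on T (cov g f (cov g f (dir dt f) ds) ds) := smooth_on_cov Hg oT fj sf ds scdt.

Lemma smooth_speed2 : smooth_on T speed2.
Proof. exact: (smooth_on_inner_along Hg oT fj sf sdt sdt). Qed.

Lemma smooth_dspeed2 : smooth_on T dspeed2.
Proof.
move=> k; apply: Ck_onM => //; first exact: Ck_on_cst.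
exact: (smooth_on_inner_along Hg oT fj sf scdt sdt).
Qed.

Lemma smooth_ddspeed2 : smooth_on T ddspeed2.
Proof.
move=> k; apply: Ck_onM => //; first exact: Ck_on_cst.
apply: Ck_onD => //; first exact: (smooth_on_inner_along Hg oT fj sf sccdt sdt).
exact: (smooth_on_inner_along Hg oT fj sf scdt scdt).
Qed.

Lemma dir_speed2 z : T z -> dir ds speed2 z = dspeed2 z.
Proof.
move=> Tz; have d1 := smooth_on_diff sdt Tz.
rewrite /speed2 (cov_compat Hg fj sf ds Tz d1 d1) /dspeed2.
have -> : inner (g (f z)) (dir dt f z) (cov g f (dir dt f) ds z) =
    inner (g (f z)) (cov g f (dir dt f) ds z) (dir dt f z).
  by rewrite innerC ?(metric_on_sym Hg (fj Tz)).
have gen (x : R) : x + x = 2 * x by ring.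
exact: gen.
Qed.

Lemma dir_dspeed2 z : T z -> dir ds dspeed2 z = ddspeed2 z.
Proof.
move=> Tz; have d1 := smooth_on_diff sdt Tz; have d2 := smooth_on_diff scdt Tz.
rewrite /dspeed2 dirM//; last first.
  exact: smooth_on_diff (smooth_on_inner_along Hg oT fj sf scdt sdt) Tz.
by rewrite dir_cst mul0r add0r (cov_compat Hg fj sf ds Tz d2 d1).
Qed.

Lemma speed2_0 t : speed2 (0, t) = inner (g (u t)) (dir (1 : R) u t) (dir (1 : R) u t).
Proof. by rewrite /speed2 vari0 dt_vari0. Qed.

(** The first variation: [<nabla_t V, u'>] is the derivative of [<V, u'>] because [u] is a geodesic,
    so it integrates to boundary terms. *)
Lemma dspeed2_0 t : D t -> dspeed2 (0, t) = 2 * dir (1 : R) tangential t.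
Proof.
move=> Dt; rewrite /dspeed2 (cov_sym Hg oT fj sf ds dt (vari_dom0 Dt)).
rewrite cov_dtds_vari0 vari0 dt_vari0; congr (_ * _).
have d1 := smooth_on_diff sV Dt; have d2 := smooth_on_diff (smooth_on_dir (1 : R) su) Dt.
by rewrite /tangential (cov_compat Hg uj su _ Dt d1 d2) geo// inner0r addr0.
Qed.

(** Commuting the [s] and [t] derivatives produces the curvature term. What remains is
    [nabla_t (nabla_s d_s f)], zero because [nabla_s d_s f] vanishes all along [s = 0]. *)
Lemma ddspeed2_0 t : D t -> ddspeed2 (0, t) = 2 * index_form V V t.
Proof.
move=> Dt; have T0 := vari_dom0 Dt.
have sds : smooth_on T (dir ds f) := smooth_on_dir ds sf.
have cE z : T z -> cov g f (dir dt f) ds z = cov g f (dir ds f) dt z.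
  by move=> Tz; exact: (cov_sym Hg oT fj sf ds dt Tz).
have e1 : cov g f (cov g f (dir dt f) ds) ds (0, t) = cov g f (cov g f (dir ds f) dt) ds (0, t).
  by rewrite [LHS]covxE (dir_near_eq _ oT T0 cE) (cE _ T0) -covxE.
have e2 : cov g f (cov g f (dir ds f) ds) dt (0, t) = 0.
  rewrite covxE cov_dsds_vari0 (bilin_expand0r (Gam_expand _ _)) addr0 dir_dt.
  rewrite (_ : (fun y => _) = fun=> 0) ?dir_cst//.
  by apply/funext => y; exact: cov_dsds_vari0.
have e3 := cov_commutator Hg oT fj sf ds dt T0 sds.
rewrite e2 subr0 vari0 ds_vari0 dt_vari0 in e3.
rewrite /ddspeed2 e1 e3 (cE _ T0) cov_dtds_vari0 vari0 dt_vari0 (riem_antisym Hg _ _ _ _ (uj Dt)).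
rewrite /index_form; congr (_ * _).
have gen (x y : R) : - x + y = y - x by ring.
exact: gen.
Qed.

(* Taylor's formula in [s] applied to the squared speed [q], followed by
   [sqrt q <= (1 + q) / 2]. *)
Lemma second_variation a b e w eps : a <= b -> 0 < e -> 0 < eps ->
  (forall t, a - e < t < b + e -> D t) ->
  (forall t, a <= t <= b -> inner (g (u t)) (dir (1 : R) u t) (dir (1 : R) u t) = 1) ->
  (forall t, a <= t <= b -> index_form V V t <= w) ->
  exists2 r, 0 < r & forall s, 0 < s < r ->
    exists2 l, path_length (inv M j (f (s, a))) (inv M j (f (s, b))) l &
      l <= (b - a) + s * (tangential b - tangential a) + s ^+ 2 / 2 * ((b - a) * (w + eps)).
Proof.
move=> ab e0 eps0 iD unit_speed iw.
have Iab t : a <= t <= b -> D t.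
  by move=> /andP[at_ tb]; apply: iD; rewrite (lt_le_trans _ at_) ?gtrBl// (le_lt_trans tb)// ltrDl.
have e20 : 0 < e / 2 by rewrite divr_gt0.
(* The curves must stay in the chart slightly beyond [[a, b]], as [chart_path] requires; the closed
   interval with margin [e / 2] is compact and still inside the margin [e]. *)
have [r1 r10 H1] : exists2 r, 0 < r & forall s t, `|s| < r -> a - e / 2 <= t <= b + e / 2 -> T (s, t).
  apply: tube => t /andP[t1 t2]; apply: open_nbhs_nbhs; split=> //; apply: vari_dom0; apply: iD.
  move: t1 t2 e20; have ee : e = e / 2 + e / 2 by exact: splitr.
  by move: ee; set x := e / 2 => ee t1 t2 x0; lra.
(* The slack [eps] absorbs the change of the second derivative between [s = 0] and small [s],
   uniformly in [t]. *)
have [r2 r20 H2] : exists2 r, 0 < r & forall s t, `|s| < r -> a <= t <= b ->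
    ddspeed2 (s, t) <= 2 * (w + eps).
  apply: (tube (P := fun z => ddspeed2 z <= 2 * (w + eps))) => t tab.
  have Dt := Iab _ tab.
  have c0 : {for (0, t), continuous ddspeed2} := smooth_on_continuous smooth_ddspeed2 (vari_dom0 Dt).
  have : \forall z \near ((0 : R), t), ddspeed2 z < 2 * (w + eps).
    have := @cvgr_lt _ _ _ _ _ _ c0 (2 * (w + eps)); apply.
    by rewrite ddspeed2_0// ltr_pM2l// ltr_pwDr// iw.
  by apply: filterS => z /ltW.
exists (Num.min r1 r2); first by rewrite lt_min r10.
move=> s /andP[s0]; rewrite lt_min => /andP[sr1 sr2].
pose c t := f (s, t).
pose E : set R := [set t | T (s, t)].
have oE : open E.
  apply: (@open_comp _ _ (fun t : R => (s, t))) => // t _.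
  by have : differentiable (fun x : R => (s, x)) t by []; move=> /differentiable_continuous.
have sc : smooth_on E c.
  have sub : E `<=` D by move=> t [].
  move=> k; apply: Ck_onD => //.
    apply: Ck_onD => //; first exact: Ck_on_sub sub (su k).
    by apply: Ck_on_scale => //; [exact: Ck_on_cst|exact: Ck_on_sub sub (sV k)].
  apply: Ck_onN => //; apply: (Ck_on_scale (a := fun=> s ^+ 2 / 2)) => //; first exact: Ck_on_cst.
  by have := sGam; move=> /(_ k); exact: Ck_on_sub.
have dtang t : D t -> is_derive t 1 tangential (dir (1 : R) tangential t).
  move=> Dt; apply: is_derive_dir; apply: smooth_on_diff Dt.
  by apply: (smooth_on_inner_along Hg oD uj su sV); exact: smooth_on_dir.
pose W := s ^+ 2 / 2 * (w + eps).
have := @chart_path R m M HM j E c (fun t => t + (s * tangential t + t * W))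
  (fun t => 1 + (s * dir (1 : R) tangential t + W)) a b (e / 2) oE sc
  (fun t (Et : E t) => fj Et) ab e20.
move=> H; have [||t tab|l Hl le] := H.
- by move=> t /andP[t1 t2]; apply: H1; rewrite ?gtr0_norm// (ltW t1) (ltW t2).
- move=> t tab; have dT := dtang _ (Iab _ tab).
  have d2 : is_derive t 1 (id * cst W) W.
    have : is_derive t 1 (id * cst W) (t *: (0 : R) + W *: (1 : R)) by apply: is_deriveM.
    by rewrite scaler0 add0r [_ *: _]mulr1.
  have d3 : is_derive t 1 (s *: tangential) (s *: dir (1 : R) tangential t) by apply: is_deriveZ.
  have d4 : is_derive t 1 (s *: tangential + id * cst W) (s *: dir (1 : R) tangential t + W).
    by apply: is_deriveD.
  have : is_derive t 1 (id + (s *: tangential + id * cst W)) (1 + (s *: dir (1 : R) tangential t + W)).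
    by apply: is_deriveD.
  exact.
- have Dt := Iab _ tab.
  have q_le : speed2 (s, t) <= 1 + s * (2 * dir (1 : R) tangential t) + s ^+ 2 / 2 * (2 * (w + eps)).
    have Tx x : 0 <= x <= s -> `|x| < r1 /\ `|x| < r2.
      by move=> /andP[x0 xs]; rewrite ger0_norm// !(le_lt_trans xs).
    have tab' : a - e / 2 <= t <= b + e / 2.
      move: tab => /andP[t1 t2].
      by rewrite (le_trans _ t1) ?gerBl ?(ltW e20)// (le_trans t2)// lerDl ltW.
    have := @taylor2_le R (fun x => speed2 (x, t)) (fun x => dspeed2 (x, t)) (fun x => ddspeed2 (x, t))
      (2 * (w + eps)) s (ltW s0).
    rewrite speed2_0 unit_speed// dspeed2_0//; apply.
    + move=> x /Tx[x1 _]; have Txt := H1 _ _ x1 tab'.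
      by rewrite -dir_speed2//; apply: differentiable_ds; exact: smooth_on_diff smooth_speed2 Txt.
    + move=> x /Tx[x1 _]; have Txt := H1 _ _ x1 tab'.
      by rewrite -dir_dspeed2//; apply: differentiable_ds; exact: smooth_on_diff smooth_dspeed2 Txt.
    + by move=> x /Tx[_ x2]; exact: H2.
  have eqs : inner (g (c t)) (dir (1 : R) c t) (dir (1 : R) c t) = speed2 (s, t).
    by rewrite /speed2 dir_dt.
  rewrite eqs.
  have sq0 : 0 <= speed2 (s, t) by rewrite -eqs; apply: posdef_ge0; apply: (metric_on_pos Hg);
    apply: (fj (z := (s, t))); apply: H1; rewrite ?gtr0_norm//; move: tab => /andP[t1 t2];
    rewrite (le_trans _ t1) ?gerBl ?(ltW e20)// (le_trans t2)// lerDl ltW.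
  have sqr_le (x : R) : 0 <= x -> Num.sqrt x <= (1 + x) / 2.
    move=> x0; rewrite -{2}(sqr_sqrtr x0); move: (Num.sqrt x) => y.
    by have := sqr_ge0 (y - 1); rewrite sqrrB1 -mulr_natl; lra.
  apply: le_trans (sqr_le _ sq0) _.
  have gen (q x y : R) : q <= 1 + s * (2 * x) + s ^+ 2 / 2 * (2 * y) ->
    (1 + q) / 2 <= 1 + (s * x + s ^+ 2 / 2 * y) by move: (s ^+ 2 / 2) => s2; nra.
  exact: gen q_le.
exists l => //; apply: le_trans le _; rewrite /W.
have gen (x y k v : R) : b + (s * y + b * (k * v)) - (a + (s * x + a * (k * v))) <=
   b - a + s * (y - x) + k * ((b - a) * v).
  by rewrite le_eqVlt; apply/orP; left; apply/eqP; ring.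
exact: gen.
Qed.

End SecondVariation.

Lemma rdist_ge0 (R : realType) m (M : atlas_metric R m) (x y : M) : 0 <= rdist x y.
Proof.
rewrite /rdist; have [->|/set0P ne] := eqVneq [set l | path_length x y l] set0.
  by rewrite inf0.
by apply: lb_le_inf => // l; exact: path_length_ge0.
Qed.

(** The straddle lemma of gauge integration: a lower bound on the derivative at the single point [t]
    controls increments over all short intervals containing [t]. It matches the hypothesis of
    [cousin]. *)
Lemma straddle (R : realType) (K : R -> R) (t k k' : R) : is_derive t 1 K k -> k' < k ->
  exists2 d, 0 < d & forall a b, a <= t <= b -> t - d < a -> b < t + d ->
    (b - a) * k' <= K b - K a.
Proof.
move=> [dK eK] kk.
have : \forall h \near (0 : R)^', k' < h^-1 *: ((K \o shift t) (h *: 1) - K t).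
  by have := @cvgr_gt _ _ _ _ _ _ dK k'; rewrite -/(derive K t 1) eK; apply.
move=> /nbhs_ballP[d /= d0 Hd]; exists d => // a b /andP[at_ tb] ta bt.
have Hr : (b - t) * k' <= K b - K t.
  have [->|bt'] := eqVneq b t; first by rewrite !subrr mul0r.
  have h0 : 0 < b - t by rewrite subr_gt0 lt_neqAle eq_sym bt'.
  have := Hd (b - t); rewrite /ball/= sub0r normrN gtr0_norm// ltrBlDl => /(_ bt).
  rewrite gt_eqF// => /(_ isT); rewrite [_ *: 1]mulr1 subrK.
  by rewrite [_ *: _]mulrC ltr_pdivlMr// mulrC => /ltW.
have Hl : (t - a) * k' <= K t - K a.
  have [->|at'] := eqVneq a t; first by rewrite !subrr mul0r.
  have h0 : 0 < t - a by rewrite subr_gt0 lt_neqAle at'.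
  have := Hd (a - t); rewrite /ball/= sub0r normrN distrC gtr0_norm//.
  have -> : t - a < d by lra.
  move=> /(_ isT); rewrite subr_eq0 => /(_ at').
  rewrite [_ *: 1]mulr1 subrK -[a - t]opprB invrN scaleNr -scalerN opprB.
  by rewrite [_ *: _]mulrC ltr_pdivlMr// mulrC => /ltW.
lra.
Qed.

Section RiemSmooth.
Context {R : realType} {n : nat} (U : set 'rV[R]_n) (G : 'rV[R]_n -> 'M[R]_n).
Hypothesis HG : metric_on U G.

Lemma smooth_on_christoffel i j k : smooth_on U (christoffel G i j k).
Proof.
move=> q; rewrite christoffelE.
by have /(Ck_on_mx q _ (metric_on_open HG)) := smooth_on_Gam HG (delta_mx 0 i) (delta_mx 0 j) q; exact.
Qed.

Lemma smooth_on_riem i j k l : smooth_on U (riem G i j k l).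
Proof.
have oU := metric_on_open HG; move=> q; apply: Ck_onD => //.
  apply: Ck_onD => //; last apply: Ck_onN => //.
    exact: (smooth_on_derive _ (smooth_on_christoffel j k l)).
  exact: (smooth_on_derive _ (smooth_on_christoffel i k l)).
apply: Ck_on_sum => // a; apply: Ck_onD => //; last apply: Ck_onN => //.
  by apply: Ck_onM => //; exact: smooth_on_christoffel.
by apply: Ck_onM => //; exact: smooth_on_christoffel.
Qed.

Lemma smooth_on_riem_along (V : normedModType R) (D : set V) (p a b c : V -> 'rV[R]_n) :
  open D -> (forall x, D x -> U (p x)) -> smooth_on D p ->
  smooth_on D a -> smooth_on D b -> smooth_on D c ->
  smooth_on D (fun x => riem_op G (p x) (a x) (b x) (c x)).
Proof.
move=> oD pU sp sa sb sc q; apply/(Ck_on_mx q _ oD) => i0 l.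
have C (f : V -> 'rV[R]_n) i : smooth_on D f -> Ck_on q D (fun x => f x 0 i).
  by move=> /(_ q) /(Ck_on_mx q _ oD); exact.
suff H : Ck_on q D (fun x => \sum_i \sum_j \sum_k
    riem G i j k l (p x) * a x 0 i * b x 0 j * c x 0 k).
  by apply: (Ck_on_ext oD _ H) => x _; rewrite mxE.
apply: Ck_on_sum => // i; apply: Ck_on_sum => // j; apply: Ck_on_sum => // k.
apply: Ck_onM => //; last exact: C.
apply: Ck_onM => //; last exact: C.
apply: Ck_onM => //; last exact: C.
apply: (Ck_on_comp oD (metric_on_open HG) pU) => //; exact: smooth_on_riem.
Qed.

End RiemSmooth.

Section CurveCharts.
Context {R : realType} {m : nat} (M : atlas_metric R m).
Hypothesis HM : riemannian_manifold M.
Variables (J : set R) (gamma : R -> M).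
Hypothesis oJ : open J.
Hypothesis Hgeo : geodesic J gamma.

Definition coords i : R -> 'rV[R]_m := to M i \o gamma.
Definition chart_times i : set R := J `&` gamma @^-1` dom M i.

Lemma open_chart_times i : open (chart_times i).
Proof. by apply: open_preimage_on => //; [exact: (Hgeo.1 0%N).1|exact: rm_dom_open HM i]. Qed.

Lemma smooth_coords i : smooth_on (chart_times i) (coords i).
Proof. by move=> k; exact: (Hgeo.1 k).2. Qed.

Lemma coords_cod i t : chart_times i t -> cod i (coords i t).
Proof. by move=> [_ d]; exact: cod_to. Qed.

Lemma geodesic_coords i t : chart_times i t ->
  cov (metric M i) (coords i) (dir (1 : R) (coords i)) (1 : R) t = 0.
Proof.
by move=> [Jt di]; have := Hgeo.2 i t Jt di; rewrite /= !derive1_dir covxE.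
Qed.

Lemma dir_coords i j t : chart_times i t -> chart_times j t ->
  dir (1 : R) (coords j) t = dir (dir (1 : R) (coords i) t) (trans i j) (coords i t).
Proof.
move=> [Jt di] [_ dj].
have oE : open (chart_times i `&` chart_times j).
  by apply: openI; exact: open_chart_times.
have Et : (chart_times i `&` chart_times j) t by [].
rewrite -dir_comp; last 2 first.
- exact: smooth_on_diff (@smooth_coords i) Et.1.
- by apply: smooth_on_diff (smooth_trans HM i j) _; exact: overlap_to.
by apply: (dir_near_eq _ oE Et) => s [[_ d] _]; rewrite /= /coords /= trans_to.
Qed.

Lemma inner_trans i j x v w : dom M i x -> dom M j x ->
  inner (metric M i (to M i x)) v w =
  inner (metric M j (to M j x)) (dir v (trans i j) (to M i x)) (dir w (trans i j) (to M i x)).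
Proof.
move=> di dj; have Ov := overlap_to di dj.
rewrite (pullback_inner (smooth_trans HM i j) (@pullback_trans _ _ _ HM i j) _ _ Ov).
by rewrite trans_to.
Qed.

Lemma unit_coords i t : chart_times i t -> speed gamma t = 1 ->
  inner (metric M i (coords i t)) (dir (1 : R) (coords i) t) (dir (1 : R) (coords i) t) = 1.
Proof.
move=> Dt; have Dc : chart_times (chart_at M (gamma t)) t.
  by split; [case: Dt|exact: rm_cover HM _].
rewrite (inner_trans _ _ Dt.2 Dc.2) -dir_coords//.
rewrite /speed derive1_dir; set q := inner _ _ _ => e.
have q0 : 0 < q by rewrite -sqrtr_gt0 e.
by rewrite -[LHS](sqr_sqrtr (ltW q0)) e expr1n.
Qed.

Lemma frame_trans i j x (E : 'M[R]_m) : dom M i x -> dom M j x ->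
  orthonormal_frame (metric M i (to M i x)) E ->
  orthonormal_frame (metric M j (to M j x)) (E *m 'J (trans i j) (to M i x)).
Proof.
move=> di dj; have Ov := overlap_to di dj.
move=> /(frame_push (@pullback_trans _ _ _ HM i j) Ov).
by rewrite trans_to.
Qed.

Lemma row_trans i j x (E : 'M[R]_m) k a : dom M i x -> dom M j x ->
  dir (a *: row k E) (trans i j) (to M i x) = a *: row k (E *m 'J (trans i j) (to M i x)).
Proof.
move=> di dj; have Ov := overlap_to di dj.
rewrite dir_jacobian; last exact: smooth_on_diff (smooth_trans HM i j) Ov.
by rewrite -scalemxAl row_mul.
Qed.

End CurveCharts.

Section IndexForm.
Context {R : realType} {m : nat} (M : atlas_metric R m) (j : idx M) (u : R -> 'rV[R]_m).
Local Notation g := (metric M j).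

(** Constant coefficients pass through [cov]. This computes the index form of a frame rotated by a
    constant matrix. *)
Lemma index_form_comb (o : 'I_m -> R) (X : 'I_m -> R -> 'rV[R]_m) t :
  (forall k, differentiable (X k) t) ->
  index_form j u (fun t => \sum_k o k *: X k t) (fun t => \sum_k o k *: X k t) t =
  \sum_k \sum_l o k * o l * index_form j u (X k) (X l) t.
Proof.
move=> dX.
have cE : cov g u (fun t => \sum_k o k *: X k t) (1 : R) t = \sum_k o k *: cov g u (X k) (1 : R) t.
  have bl a : bilin_expand (christoffel_form g a) by exact: Gam_expand.
  rewrite covxE dir_sumf; last by move=> k; apply: (@differentiable_scale R R _ (fun=> o k) (X k)).
  rewrite (big_morph (christoffel_form g (u t) _) (fun x y => bilin_expandDr _ x y (bl _))
    (bilin_expand0r (bl _) _)).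
  rewrite -big_split; apply: eq_bigr => k _ /=.
  by rewrite covxE dirZ// (bilin_expandZr (bl _)) scalerDr.
rewrite /index_form cE !inner_suml.
have rE : riem_op g (u t) (\sum_k o k *: X k t) (dir (1 : R) u t) (dir (1 : R) u t) =
   \sum_k o k *: riem_op g (u t) (X k t) (dir (1 : R) u t) (dir (1 : R) u t).
  rewrite riem_op_mulmx mulmx_suml; apply: eq_bigr => k _.
  by rewrite -scalemxAl -riem_op_mulmx.
rewrite rE !inner_suml -sumrB; apply: eq_bigr => k _.
rewrite !inner_sumr -sumrB; apply: eq_bigr => l _.
by rewrite !innerZl !innerZr !mulrA mulrBr.
Qed.

End IndexForm.

Section TracedSecondVariation.
Context {R : realType} {m : nat} (M : atlas_metric R m).
Hypothesis HM : riemannian_manifold M.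
Variables (J : set R) (gamma : R -> M) (r : R) (phi : R -> R).
Hypothesis oJ : open J.
Hypothesis Hgeo : geodesic J gamma.
Hypothesis Jr : forall t, 0 <= t <= r -> J t.
Hypothesis unit : forall t, 0 <= t <= r -> speed gamma t = 1.
Hypothesis sphi : smooth_on J phi.

Local Notation u := (coords gamma).
Local Notation times := (chart_times J gamma).

Definition base_chart t : idx M := chart_at M (gamma t).
Local Notation gc t := (metric M (base_chart t) (u (base_chart t) t)).

(** The boundary term of the first variation. It depends only on the time and on the frame there, so
    it cancels between consecutive arcs. *)
Definition frame_momentum t (E : 'M[R]_m) k : R :=
  inner (gc t) (phi t *: row k E) (dir (1 : R) (u (base_chart t)) t).

(** The end points are those of the moved frame vectors, expressed in a chart fixed by the time
    alone, so that paths over adjacent arcs meet exactly. The coefficient of [s^2 / 2] is bounded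
    only up to an arbitrary [e], which leaves room for the joining segments. *)
Definition variation_bound a b (E E' : 'M[R]_m) (kap : 'I_m -> R) : Prop :=
  forall k e, 0 < e -> exists2 d, 0 < d & forall s, 0 < s < d ->
    exists2 l, path_length (jet_point (base_chart a) (gamma a) (phi a *: row k E) s)
        (jet_point (base_chart b) (gamma b) (phi b *: row k E') s) l &
      l <= (b - a) + s * (frame_momentum b E' k - frame_momentum a E k) + s ^+ 2 / 2 * (kap k + e).

(** An arbitrary frame at [a] is transported to some frame at [b]; this is what lets bounds be
    chained. A single [kap k] depends on the frame chosen, so only the sum is compared with the
    increment of [K]. *)
Definition traced_bound (K : R -> R) a b : Prop :=
  forall E, orthonormal_frame (gc a) E -> exists E' kap,
    [/\ orthonormal_frame (gc b) E', \sum_k kap k <= K b - K a & variation_bound a b E E' kap].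

Lemma traced_bound_trans K a b c : traced_bound K a b -> traced_bound K b c -> traced_bound K a c.
Proof.
move=> H1 H2 E /H1[E1 [k1 [hE1 s1 v1]]]; have [E2 [k2 [hE2 s2 v2]]] := H2 _ hE1.
exists E2, (fun k => k1 k + k2 k); split=> //.
  rewrite big_split/=; apply: le_trans (lerD s1 s2) _.
  by rewrite addrC addrA subrK.
move=> k e e0; have e20 : 0 < e / 2 by rewrite divr_gt0.
have [d1 d10 P1] := v1 k _ e20; have [d2 d20 P2] := v2 k _ e20.
exists (Num.min d1 d2) => [|s /andP[s0]]; first by rewrite lt_min d10.
rewrite lt_min => /andP[sd1 sd2].
have [|l1 p1 le1] := P1 s; first by rewrite s0.
have [|l2 p2 le2] := P2 s; first by rewrite s0.
exists (l1 + l2); first exact: path_length_trans p1 p2.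
apply: le_trans (lerD le1 le2) _.
have gen (p q w x y z : R) : (b - a) + s * (q - p) + s ^+ 2 / 2 * (x + e / 2) +
   (c - b + s * (w - q) + s ^+ 2 / 2 * (y + e / 2)) <= c - a + s * (w - p) + s ^+ 2 / 2 * (x + y + e).
  by rewrite le_eqVlt; apply/orP; left; apply/eqP; field.
exact: gen.
Qed.

Let base t : J t -> times (base_chart t) t.
Proof. by split=> //; exact: rm_cover HM _. Qed.

(* Within one chart the bound holds for the frames constant with respect to a
   reference frame that is parallel at the tag, since the trace of the index
   form does not depend on the choice of the constant orthogonal matrix. *)
Lemma traced_bound_local K k t : 0 <= t <= r -> is_derive t 1 K k ->
  let i := base_chart t in let du := dir (1 : R) (u i) t in
  m%:R * derive1 phi t ^+ 2 - phi t ^+ 2 * ricci (metric M i) (u i t) du du < k ->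
  exists2 d, 0 < d & forall a b, 0 <= a <= t -> t <= b <= r -> t - d < a -> b < t + d ->
    traced_bound K a b.
Proof.
move=> tr dK i du lt_k; set g := metric M i.
have Hg := metric_on_chart HM i.
have Jt := Jr tr; have Dt := base Jt.
set D := times i; have oD : open D := @open_chart_times _ _ _ HM _ _ oJ Hgeo i.
have su : smooth_on D (u i) := @smooth_coords _ _ _ _ _ Hgeo i.
have uj s : D s -> cod i (u i s) by exact: coords_cod.
have geo s : D s -> cov g (u i) (dir (1 : R) (u i)) (1 : R) s = 0 by exact: geodesic_coords.
have [e [se he pe]] := parallel_frame_at Hg oD uj su Dt.
pose X k s := phi s *: row k (e s).
have srow k' : smooth_on D (fun s => row k' (e s)) by exact: smooth_on_row.
have DJ : D `<=` J by move=> s [].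
have sX k' : smooth_on D (X k').
  move=> n; apply: Ck_on_scale => //; last exact: srow.
  exact: Ck_on_sub DJ (sphi n).
pose w p q s := index_form i (u i) (X p) (X q) s.
have wc p q : {for t, continuous (w p q)}.
  have sc p' : smooth_on D (cov g (u i) (X p') (1 : R)) by exact: (smooth_on_cov Hg oD uj su).
  have sw : smooth_on D (w p q).
    move=> n; apply: Ck_onD => //; first exact: (smooth_on_inner_along Hg oD uj su (sc p) (sc q)).
    apply: Ck_onN => //.
    have sdu := smooth_on_dir (1 : R) su.
    exact: (smooth_on_inner_along Hg oD uj su (smooth_on_riem_along Hg oD uj su (sX p) sdu sdu) (sX q)).
  exact: smooth_on_continuous sw Dt.
have wt p q : w p q t = derive1 phi t ^+ 2 * (p == q)%:R
    - phi t ^+ 2 * inner (g (u i t)) (riem_op g (u i t) (row p (e t)) du du) (row q (e t)).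
  have cX p' : cov g (u i) (X p') (1 : R) t = derive1 phi t *: row p' (e t).
    rewrite covxE dir_scale; [|exact: smooth_on_diff sphi Jt|exact: smooth_on_diff (srow p') Dt].
    rewrite (bilin_expandZr (Gam_expand _ _)) -addrA -scalerDr -covxE pe scaler0 addr0.
    by rewrite derive1_dir.
  rewrite /w /index_form !cX innerZl innerZr (frame_inner (he _ Dt)) mulrA -expr2; congr (_ - _).
  by rewrite /X riem_opZl innerZl innerZr mulrA -expr2.
have trw : \sum_p w p p t = m%:R * derive1 phi t ^+ 2 - phi t ^+ 2 * ricci g (u i t) du du.
  under eq_bigr do rewrite wt eqxx mulr1.
  rewrite sumrB; congr (_ - _); first by rewrite sumr_const card_ord mulr_natl.
  by rewrite -mulr_sumr (ricci_frame (he _ Dt)).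
set S := \sum_p w p p t in trw; rewrite -trw in lt_k.
(* Each of the [m] rotated vectors has an index form with [m^2] terms, each term perturbed by at
   most [eps1]: the total error [m^3 eps1] must stay below [k - S]. The added [1] avoids division by
   zero. *)
pose eps1 := (k - S) / (m%:R ^+ 3 + 1).
have m31 : 0 < m%:R ^+ 3 + 1 :> R by rewrite ltr_wpDl// exprn_ge0.
have eps10 : 0 < eps1 by rewrite divr_gt0// subr_gt0.
pose k' := S + m%:R ^+ 3 * eps1.
have k'k : k' < k.
  rewrite /k' -ltrBrDl /eps1 mulrA ltr_pdivrMr// mulrC ltr_pM2l ?subr_gt0//.
  by rewrite ltrDl.
have [d2 d20 Hd2] := straddle dK k'k.
have near1 : \forall s \near t, forall pq : 'I_m * 'I_m, `|w pq.1 pq.2 s - w pq.1 pq.2 t| < eps1.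
  have H pq : \forall s \near t, `|w pq.1 pq.2 s - w pq.1 pq.2 t| < eps1.
    near=> s; rewrite distrC; near: s.
    by apply: cvgr_dist_lt => //; exact: wc.
  exact: (@filter_forall R ('I_m * 'I_m)%type (fun pq s => `|w pq.1 pq.2 s - w pq.1 pq.2 t| < eps1) (nbhs t) _ H).
have near2 : \forall s \near t, D s by exact: open_nbhs_nbhs.
have /nbhs_ballP[d1 /= d10 Hd1] : \forall s \near t, D s /\
    forall pq : 'I_m * 'I_m, `|w pq.1 pq.2 s - w pq.1 pq.2 t| < eps1.
  by apply: filterS2 near2 near1.
have d120 : 0 < d1 / 2 by rewrite divr_gt0.
have d1E : d1 = d1 / 2 + d1 / 2 by exact: splitr.
exists (Num.min (d1 / 2) d2); first by rewrite lt_min d120.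
move=> a b /andP[a0 at_] /andP[tb br]; rewrite !ltrBlDr -!ltrBlDl lt_min => /andP[ta1 ta2].
rewrite lt_min => /andP[bt1 bt2] E hE.
have ab : a <= b by exact: le_trans at_ tb.
have inb s : a - d1 / 2 < s < b + d1 / 2 -> ball t d1 s.
  rewrite /ball/= => /andP[s1 s2]; rewrite ltr_norml.
  by move: d1E ta1 bt1 s1 s2 d120; set x := d1 / 2 => *; lra.
have iD s : a - d1 / 2 < s < b + d1 / 2 -> D s by move=> /inb /Hd1[].
have inab s : a <= s <= b -> a - d1 / 2 < s < b + d1 / 2.
  by move=> /andP[s1 s2]; move: d120; set x := d1 / 2 => *; lra.
have Da : D a by apply/iD/inab; rewrite lexx.
have Db : D b by apply/iD/inab; rewrite ab lexx.
have abr s : a <= s <= b -> 0 <= s <= r.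
  by move=> /andP[s1 s2]; rewrite (le_trans a0 s1) (le_trans s2 br).
set ja := base_chart a; set jb := base_chart b.
have dja : dom M ja (gamma a) := rm_cover HM _.
have djb : dom M jb (gamma b) := rm_cover HM _.
set Ei := E *m 'J (trans ja i) (u ja a).
have hEi : orthonormal_frame (g (u i a)) Ei := frame_trans HM dja Da.2 hE.
(* The prescribed frame, brought into chart [i], differs from the reference frame at [a] by an
   orthogonal matrix; the same matrix is then applied at [b]. *)
have [Q Qe] : exists Q, Q *m e a = Ei.
  by exists (Ei *m invmx (e a)); rewrite mulmxKV// (frame_unit (he _ Da)).
have QQ : Q *m Q^T = 1%:M.
  move: hEi; rewrite /orthonormal_frame -Qe trmx_mul !mulmxA -(mulmxA Q) -(mulmxA Q).
  by rewrite he// mulmx1.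
have QQ' : Q^T *m Q = 1%:M := mulmx1C QQ.
have Q1 p q : `|Q p q| <= 1.
  have := congr1 (fun A : 'M[R]_m => A p p) QQ; rewrite !mxE eqxx mulr1n (bigD1 q)//= mxE -expr2 => e1.
  rewrite -(@expr_le1 _ 2)// real_normK ?num_real// -e1 lerDl.
  by apply: sumr_ge0 => q' _; rewrite mxE -expr2 sqr_ge0.
set Ei' := Q *m e b.
have hEi' : orthonormal_frame (g (u i b)) Ei'.
  rewrite /orthonormal_frame /Ei' trmx_mul !mulmxA -(mulmxA Q) -(mulmxA Q).
  by rewrite he// mulmx1.
pose E' := Ei' *m 'J (trans i jb) (u i b).
(* The index form at the tag [t] of the rotated vector, plus the error over the arc; entries of an
   orthogonal matrix are at most [1] in absolute value. *)
pose wk p := \sum_q \sum_q' Q p q * Q p q' * w q q' t + m%:R ^+ 2 * eps1.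
exists E', (fun p => (b - a) * wk p); split.
- exact: (frame_trans HM Db.2 djb hEi').
- rewrite -mulr_sumr; apply: le_trans (Hd2 a b _ _ _); last 3 first.
  + by rewrite at_ tb.
  + by rewrite ltrBlDr -ltrBlDl.
  + by rewrite -ltrBlDl.
  rewrite ler_wpM2l ?subr_ge0// /wk big_split/= sumr_const card_ord.
  have -> : \sum_p \sum_q \sum_q' Q p q * Q p q' * w q q' t = S.
    rewrite exchange_big /S; apply: eq_bigr => q _ /=; rewrite exchange_big/=.
    rewrite (bigD1 q)//= [X in _ + X]big1 ?addr0; last first.
      move=> q' qq'; rewrite -mulr_suml.
      have := congr1 (fun A : 'M[R]_m => A q q') QQ'; rewrite !mxE eq_sym (negbTE qq').
      under eq_bigr do rewrite mxE.
      by move=> ->; rewrite mul0r.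
    rewrite -mulr_suml.
    have := congr1 (fun A : 'M[R]_m => A q q) QQ'; rewrite !mxE eqxx.
    under eq_bigr do rewrite mxE.
    by move=> ->; rewrite mul1r.
  rewrite /k' lerD2l -[_ *+ m]mulr_natl mulrA -exprS//.
move=> p e0 e00.
pose V s := \sum_q Q p q *: X q s.
have sV : smooth_on D V.
  by move=> n; apply: Ck_on_sum => // q; apply: Ck_on_scale => //; [exact: Ck_on_cst|exact: sX].
have VE s : V s = phi s *: row p (Q *m e s).
  rewrite row_mul mulmx_sum_row scaler_sumr; apply: eq_bigr => q _.
  by rewrite mxE /X !scalerA mulrC.
have Iw s : a <= s <= b -> index_form i (u i) V V s <= wk p.
  move=> sab; have [Ds Hs] := Hd1 _ (inb _ (inab _ sab)).
  rewrite (@index_form_comb _ _ M i (u i) (Q p) X); last by move=> q; exact: smooth_on_diff (sX q) Ds.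
  rewrite -lerBlDl -sumrB.
  have -> : m%:R ^+ 2 * eps1 = \sum_(q < m) \sum_(q' < m) eps1.
    rewrite !sumr_const !card_ord -mulrnA -[_ *+ (m * m)]mulr_natl natrM expr2//.
  apply: ler_sum => q _; rewrite -sumrB; apply: ler_sum => q' _.
  rewrite -mulrBr; apply: le_trans (ler_norm _) _; rewrite !normrM.
  rewrite -[leRHS]mul1r; apply: ler_pM; rewrite ?mulr_ge0//; last exact: ltW (Hs (q, q')).
  by rewrite -[leRHS]mul1r; apply: ler_pM.
have ba1 : 0 < b - a + 1 by rewrite ltr_wpDl// subr_ge0.
(* The allowance [s^2 / 2 * e0] is split in halves: one for the slack of the second variation over
   the arc, the other for the two junctions, each of length at most [s^2 * (e0 / 8)]. The
   denominator stays positive when [a = b]. *)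
have eps20 : 0 < e0 / 2 / (b - a + 1) by rewrite !divr_gt0.
have e80 : 0 < e0 / 8 by rewrite divr_gt0.
have [r1 r10 H1] := second_variation HM oD uj su sV geo ab d120 eps20 iD
  (fun s sab => unit_coords HM oJ Hgeo (iD _ (inab _ sab)) (unit (abr _ sab))) Iw.
have [r2 r20 H2] := jet_point_junction HM (phi a *: row p E) dja Da.2 e80.
have [r3 r30 H3] := jet_point_junction HM (V b) Db.2 djb e80.
exists (Num.min r1 (Num.min r2 r3)); first by rewrite !lt_min r10 r20.
move=> s /andP[s0]; rewrite !lt_min => /and3P[sr1 sr2 sr3].
have [|l1 p1 le1] := H1 s; first by rewrite s0.
have [|l2 p2 le2] := H2 s; first by rewrite s0.
have [|l3 p3 le3] := H3 s; first by rewrite s0.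
have Va : dir (phi a *: row p E) (trans ja i) (to M ja (gamma a)) = V a.
  by rewrite (row_trans HM _ _ _ dja Da.2) VE Qe.
have Vb : dir (V b) (trans i jb) (to M i (gamma b)) = phi b *: row p E'.
  by rewrite VE (row_trans HM _ _ _ Db.2 djb).
rewrite Va in p2; rewrite Vb in p3.
exists (l2 + (l1 + l3)); first exact: path_length_trans p2 (path_length_trans p1 p3).
have ta : tangential i (u i) V a = frame_momentum a E p.
  rewrite /frame_momentum (inner_trans HM _ _ dja Da.2) Va.
  by rewrite -(dir_coords HM oJ Hgeo (base Da.1) Da).
have tb' : tangential i (u i) V b = frame_momentum b E' p.
  rewrite /tangential (inner_trans HM _ _ Db.2 djb) Vb.
  by rewrite -(dir_coords HM oJ Hgeo Db (base Db.1)).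
rewrite ta tb' in le1.
apply: le_trans (lerD le2 (lerD le1 le3)) _.
have ba0 : (b - a) * (e0 / 2 / (b - a + 1)) <= e0 / 2.
  rewrite mulrA ler_pdivrMr// mulrC ler_wpM2l ?divr_ge0 ?(ltW e00)//.
  by rewrite lerDl.
move: ba0; set y := _ / (b - a + 1) => ba0.
have s20 : 0 <= s ^+ 2 by exact: sqr_ge0.
have gen (q x z : R) : s ^+ 2 * (e0 / 8) + (b - a + s * q + s ^+ 2 / 2 * ((b - a) * (x + y)) + s ^+ 2 * (e0 / 8))
   <= b - a + s * q + s ^+ 2 / 2 * ((b - a) * x + e0).
  rewrite -subr_ge0 (_ : _ - _ = s ^+ 2 / 2 * (e0 / 2 - (b - a) * y)); last by field.
  by rewrite mulr_ge0 ?subr_ge0// divr_ge0.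
exact: gen.
Unshelve. all: by end_near.
Qed.

(** As [phi] vanishes at both ends, the varied paths join the ends of a minimizing geodesic, so
    their lengths are at least [r]. The first order terms vanish for the same reason, which forces
    every [kap p] to be nonnegative, and their sum is at most the increment of [K]. *)
Lemma traced_second_variation K k : rdist (gamma 0) (gamma r) = r -> phi 0 = 0 -> phi r = 0 ->
  (forall t, 0 <= t <= r -> is_derive t 1 K (k t)) ->
  (forall t, 0 <= t <= r ->
    let i := base_chart t in let du := dir (1 : R) (u i) t in
    m%:R * derive1 phi t ^+ 2 - phi t ^+ 2 * ricci (metric M i) (u i t) du du <= k t) ->
  K 0 <= K r.
Proof.
move=> rr phi0 phir dK le_k.
have r0 : 0 <= r by rewrite -rr; exact: rdist_ge0.
rewrite -subr_ge0; apply/ler_addgt0Pr => eps eps0.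
have r10 : 0 < r + 1 by rewrite ltr_wpDl.
pose d := eps / (r + 1).
have d0 : 0 < d by rewrite divr_gt0.
pose K1 t := K t + t * d.
have dK1 t : 0 <= t <= r -> is_derive t 1 K1 (k t + d).
  move=> tr; have := dK t tr => dKt.
  have d2 : is_derive t 1 (id * cst d) d.
    have : is_derive t 1 (id * cst d) (t *: (0 : R) + d *: (1 : R)) by apply: is_deriveM.
    by rewrite scaler0 add0r [_ *: _]mulr1.
  have : is_derive t 1 (K + id * cst d) (k t + d) by apply: is_deriveD.
  exact.
have : traced_bound K1 0 r.
  apply: cousin => // [x y z _ _|t tr]; first exact: traced_bound_trans.
  have [|d1 d10 Hd] := @traced_bound_local K1 (k t + d) t tr (dK1 _ tr).
    by apply: le_lt_trans (le_k t tr) _; rewrite ltrDl.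
  exists d1 => // x y xt ty tx yt; apply: Hd => //.
have J0 : times (base_chart 0) 0 by apply/base/Jr; rewrite lexx.
have Hg := metric_on_chart HM (base_chart 0).
have [E hE] := orthonormal_frame_exists (metric_on_sym Hg (coords_cod J0)) (metric_on_pos Hg (coords_cod J0)).
move=> /(_ E hE)[E' [kap [hE' skap vb]]].
have kap0 p : 0 <= kap p.
  apply/ler_addgt0Pr => e e0; rewrite -lerBlDr sub0r.
  have [d1 d10 H] := vb p e e0.
  have d120 : 0 < d1 / 2 by rewrite divr_gt0.
  (* A single positive [s] suffices for given [e]: after cancelling [r], the factor [s^2 / 2] can be
     divided out. *)
  have [|l pl le] := H (d1 / 2).
    by rewrite d120 gtr_pMr// invf_lt1// ltr1n.
  have jet0E j x s v : dom M j x -> jet_point j x (0 *: v) s = x.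
    move=> dx; rewrite /jet_point scale0r (bilin_expand0l (Gam_expand _ _)) /jet !scaler0 addr0 subr0.
    by rewrite (rm_toK HM).
  have m0 t (F : 'M[R]_m) : phi t = 0 -> frame_momentum t F p = 0.
    by move=> e1; rewrite /frame_momentum e1 scale0r inner0l.
  rewrite phi0 phir !jet0E in pl; [|exact: rm_cover HM _|exact: rm_cover HM _].
  have := le_trans (rdist_le pl) le; rewrite rr !m0// !subr0 mulr0 addr0.
  rewrite -lerBlDl subrr pmulr_rge0 ?divr_gt0 ?exprn_gt0//.
  by rewrite -lerBlDr sub0r.
have := le_trans (sumr_ge0 _ (fun p _ => kap0 p)) skap.
rewrite /K1 mul0r addr0 => H.
have rd : r * d <= eps.
  by rewrite /d mulrA ler_pdivrMr// mulrC ler_wpM2l ?(ltW eps0)// lerDl.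
lra.
Qed.

End TracedSecondVariation.

(** * The gradient estimate *)

Section Cutoff.
Context {R : realType} (r : R).

Lemma smooth_on_expR (D : set R) : open D -> smooth_on D expR.
Proof.
move=> oD; elim=> [|k IH]; first by move=> x _; exact: continuous_expR.
split=> [x _|v]; first by apply/derivable1_diffP; exact: derivable_expR.
have H : Ck_on k D (fun x => v *: expR x) by apply: Ck_on_scale => //; exact: Ck_on_cst.
apply: (Ck_on_ext oD _ H) => x _.
rewrite derive_scal1; last by apply/derivable1_diffP; exact: derivable_expR.
by rewrite derive1E; congr (_ *: _); apply/esym; exact: derive_val.
Qed.

(* Both [derive1 cutoff t ^+ 2] and [1 - cutoff t ^+ 2] are at most a constant
   times [exp (- t) + exp (t - r)], whose integral over [[0, r]] is bounded
   independently of [r]. *)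
Definition cutoff (t : R) : R := (1 - expR (- t)) * (1 - expR (t - r)).

Lemma is_derive_expRN (t : R) : is_derive t 1 (fun t : R => expR (- t)) (- expR (- t)).
Proof.
apply: (is_derive_eq (is_derive1_comp _ _)).
by rewrite mulrN1.
Qed.

Lemma is_derive_expRB (t : R) : is_derive t 1 (fun t : R => expR (t - r)) (expR (t - r)).
Proof.
apply: (is_derive_eq (is_derive1_comp (f := expR) (g := fun t => t - r) _ _)).
by rewrite oppr0 addr0 mulr1.
Qed.

Lemma derive_cutoff t :
  derive1 cutoff t = expR (- t) * (1 - expR (t - r)) - (1 - expR (- t)) * expR (t - r).
Proof.
have d1 := is_derive_expRN t; have d2 := is_derive_expRB t.
have d3 : is_derive t 1 (fun t : R => 1 - expR (- t)) (expR (- t)).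
  have : is_derive t 1 (cst 1 - (fun t : R => expR (- t))) (0 - - expR (- t)) by apply: is_deriveB.
  by rewrite sub0r opprK.
have d4 : is_derive t 1 (fun t : R => 1 - expR (t - r)) (- expR (t - r)).
  have : is_derive t 1 (cst 1 - (fun t : R => expR (t - r))) (0 - expR (t - r)) by apply: is_deriveB.
  by rewrite sub0r.
have : is_derive t 1 ((fun t : R => 1 - expR (- t)) * (fun t : R => 1 - expR (t - r)))
    ((1 - expR (- t)) *: (- expR (t - r)) + (1 - expR (t - r)) *: expR (- t)) by apply: is_deriveM.
move=> [_ d5]; rewrite derive1E; apply: etrans d5 _.
have gen (a b : R) : (1 - a) *: (- b) + (1 - b) *: a = a * (1 - b) - (1 - a) * b.
  by rewrite /GRing.scale/=; ring.
exact: gen.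
Qed.

Lemma smooth_cutoff (D : set R) : open D -> smooth_on D cutoff.
Proof.
move=> oD k.
have C (f : R -> R) : Ck_on k D f -> Ck_on k D (fun t => 1 - expR (f t)).
  move=> Cf; apply: Ck_onD => //; first exact: Ck_on_cst.
  apply: Ck_onN => //; apply: (Ck_on_comp1 (U' := setT) (g := expR) oD openT) => //.
  by apply: smooth_on_expR; exact: openT.
apply: Ck_onM => //; apply: C.
  by apply: Ck_onN => //; exact: Ck_on_id.
by apply: Ck_onD => //; [exact: Ck_on_id|exact: Ck_on_cst].
Qed.

Lemma cutoff0 : cutoff 0 = 0.
Proof. by rewrite /cutoff oppr0 expR0 subrr mul0r. Qed.

Lemma cutoffr : cutoff r = 0.
Proof. by rewrite /cutoff subrr expR0 subrr mulr0. Qed.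

(** Only an upper bound on [rho] is available, so [- phi^2 rho] is written as
    [- rho + (1 - phi^2) rho], and the factor [1 - phi^2] is nonnegative. With [a = exp (- t)] and
    [b = exp (t - r)], both at most [1], one has [phi' = a - b], whose square is at most [a + b],
    and [1 - phi^2 <= 2 (1 - phi) <= 2 (a + b)]. *)
Lemma cutoff_bound (t k L rho : R) : 0 <= t <= r -> 0 <= k -> 0 <= L -> rho <= L ->
  k * derive1 cutoff t ^+ 2 - cutoff t ^+ 2 * rho <=
    (k + 2 * L) * (expR (t - r) + expR (- t)) - rho.
Proof.
move=> /andP[t0 tr] k0 L0 rL; rewrite derive_cutoff /cutoff.
have a0 : 0 < expR (- t) := expR_gt0 _.
have a1 : expR (- t) <= 1 by rewrite -expR0 ler_expR oppr_le0.
have b0 : 0 < expR (t - r) := expR_gt0 _.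
have b1 : expR (t - r) <= 1 by rewrite -expR0 ler_expR subr_le0.
move: (expR (- t)) (expR (t - r)) a0 a1 b0 b1 => a b a0 a1 b0 b1.
set p := a * (1 - b) - (1 - a) * b; set q := (1 - a) * (1 - b).
have pE : p = a - b by rewrite /p; ring.
have p2 : p ^+ 2 <= a + b by rewrite pE; nra.
have q0 : 0 <= q by rewrite mulr_ge0// subr_ge0.
have q1 : 1 - q <= a + b by rewrite /q; nra.
have q2 : q <= 1 by rewrite /q; nra.
have q3 : 0 <= 1 - q ^+ 2 by rewrite subr_ge0 expr_le1.
have q4 : 1 - q ^+ 2 <= 2 * (a + b) by nra.
have e1 : k * p ^+ 2 <= k * (a + b) by rewrite ler_wpM2l.
have e2 : (1 - q ^+ 2) * rho <= (1 - q ^+ 2) * L by rewrite ler_wpM2l.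
have e3 : (1 - q ^+ 2) * L <= 2 * (a + b) * L by rewrite ler_wpM2r.
lra.
Qed.

End Cutoff.

Theorem proposition6p6 (R : realType) (m n : nat) (I : set R) (h : R -> R)
    (P : atlas_metric R n) (M : atlas_metric R m) (psi : M -> warped I h P)
    (kappa c Lambda t0 : R) (o : M) :
  (2 <= m)%N ->
  open I -> is_interval I -> I t0 ->
  smooth_on I h -> (forall t, I t -> 0 < h t) ->
  riemannian_manifold P -> riemannian_manifold M ->
  connected [set: M] -> complete_manifold M ->
  (forall x, I (psi x).1) ->
  isometric_immersion psi ->
  c < 0 -> mcf_soliton psi (warped_field I h P) c ->
  constant_sectional_curvature P kappa ->
  ricci_le M Lambda ->
  let F := fun x : M =>
    normsq_II psi x - (m - 1)%:R * varkappa h kappa (psi x).1 in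
  let eta := fun x : M => oint h t0 (psi x).1 in
  has_ubound (range F) ->
  exists A : R, forall (x : M) (gamma : R -> M),
    unit_minimizing_geodesic o x gamma ->
    c^-1 * sup (range F) * rdist o x
      + \int[lebesgue_measure]_(t in `[0, rdist o x]) derive1 h (psi (gamma t)).1
      + A
    <= norm_grad eta x.
Proof.
move=> m2 oI iI It0 sh hpos HP HM _ _ psiI Hiso c0 Hsol Hsec Hric F eta ubF.
have m1 : (1 <= m)%N := ltnW m2.
(* The first term is the integrated cutoff error [2 C] divided by [c]; the second bounds the flux at
   the starting point [o]. *)
exists (2 * (m%:R + 2 * `|Lambda|) / c - norm_grad eta o) => x gamma.
set r := rdist o x; have r0 : 0 <= r := rdist_ge0 o x.
move=> [g0 gr [e e0 Hgeo] unit _].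
have J0 (t : R) : `]- e, r + e[%classic t <-> - e < t < r + e by rewrite /= in_itv.
set J : set R := `]- e, r + e[%classic in Hgeo J0.
have oJ : open J by exact: interval_open.
have iJ : is_interval J by exact: interval_is_interval.
have Jr t : 0 <= t <= r -> J t.
  by move=> /andP[t1 t2]; apply/J0; rewrite (lt_le_trans _ t1) ?oppr_lt0// (le_lt_trans t2)// ltrDl.
have unit' t : 0 <= t <= r -> speed gamma t = 1.
  by move=> tr; apply: unit; rewrite /= in_itv.
have z0r : 0 <= (0 : R) <= r by rewrite lexx.
have zrr : 0 <= r <= r by rewrite r0 lexx.
pose y := height_flux psi gamma.
have sy : smooth_on J y by exact: smooth_height_flux.
pose H t := derive1 h (height psi gamma t).
have sH : smooth_on J H.
  move=> k; apply: (Ck_on_comp1 oJ oI) => [t _||]; first exact: psiI.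
    exact: smooth_height.
  exact: (smooth_on_derive1 sh).
pose S := sup (range F).
(* A lower bound for [Ric (u', u')] that is smooth along the whole geodesic and does not refer to
   charts, so that the integrand [k] has a primitive; its own primitive involves only the flux, the
   integral of [H] and a linear term. *)
pose rho t := c * (derive1 y t - H t) - S.
pose i t := chart_at M (gamma t); pose du t := dir (1 : R) (coords gamma (i t)) t.
have unit_u t : 0 <= t <= r -> inner (metric M (i t) (to M (i t) (gamma t))) (du t) (du t) = 1.
  move=> tr; apply: (unit_coords HM oJ Hgeo (i := i t) (t := t)); last exact: unit'.
  by split; [exact: Jr|exact: rm_cover HM _].
have rho_ricci t : 0 <= t <= r ->
    rho t <= ricci (metric M (i t)) (to M (i t) (gamma t)) (du t) (du t).
  move=> tr; have u1 := unit_u t tr.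
  have di : dom M (i t) (gamma t) := rm_cover HM _.
  have Dt : curve_dom psi J gamma (i t) (chart_at (warped I h P) (psi (gamma t))) t.
    by apply: curve_dom_chart => //; exact: Jr.
  have e1 := derive1_height_flux oI sh hpos HP HM psiI Hiso oJ Hgeo Dt u1.
  have := soliton_le_ricci m1 oI sh hpos HP HM psiI Hiso Hsol Hsec di u1.
  have FS : F (gamma t) <= S by apply: ub_le_sup => //; exists (gamma t).
  rewrite /rho /y e1 /H.
  have gen (a s f q : R) : c * s <= q + f -> f <= S -> c * (a + s - a) - S <= q by lra.
  by move=> le; exact: gen le FS.
have rhoL t : 0 <= t <= r -> rho t <= `|Lambda|.
  move=> tr; apply: le_trans (rho_ricci t tr) _.
  apply: le_trans (Hric _ _ _ (rm_cover HM (gamma t))) _.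
  by rewrite unit_u// mulr1 ler_norm.
pose phi := cutoff r.
have sphi : smooth_on J phi := smooth_cutoff r oJ.
pose k t := m%:R * derive1 phi t ^+ 2 - phi t ^+ 2 * rho t.
have sk : smooth_on J k.
  move=> q; apply: Ck_onD => //; last apply: Ck_onN => //.
    apply: Ck_onM => //; first exact: Ck_on_cst.
    by apply: Ck_onM => //; exact: (smooth_on_derive1 sphi).
  apply: Ck_onM => //; first by apply: Ck_onM.
  apply: Ck_onD => //; last exact: Ck_on_cst.
  apply: Ck_onM => //; first exact: Ck_on_cst.
  by apply: Ck_onD => //; [exact: (smooth_on_derive1 sy)|apply: Ck_onN].
have J00 : J 0 := Jr _ z0r.
have dK t : 0 <= t <= r -> is_derive t 1 (oint k 0) (k t).
  move=> tr; apply: (is_derive_oint oJ iJ J00 (Jr _ tr)) => s Js.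
  exact: smooth_on_continuous sk Js.
have dH t : 0 <= t <= r -> is_derive t 1 (oint H 0) (H t).
  move=> tr; apply: (is_derive_oint oJ iJ J00 (Jr _ tr)) => s Js.
  exact: smooth_on_continuous sH Js.
have rr : rdist (gamma 0) (gamma r) = r by rewrite g0 gr.
have K0 : oint k 0 0 <= oint k 0 r.
  apply: (traced_second_variation HM oJ Hgeo Jr unit' sphi rr (cutoff0 r) (cutoffr r) dK) => t tr.
  by rewrite /k lerB// ler_wpM2l ?sqr_ge0//; exact: rho_ricci.
pose C := m%:R + 2 * `|Lambda|.
(* An explicit primitive of the bound given by [cutoff_bound]. The exponential part grows by
   [2 C (1 - exp (- r))] over [[0, r]], at most [2 C] whatever [r] is. *)
pose G t := C * (expR (t - r) - expR (- t)) - (c * (y t - oint H 0 t) - t * S).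
have dG t : 0 <= t <= r -> is_derive t 1 G (C * (expR (t - r) + expR (- t)) - rho t).
  move=> tr; have d1 : is_derive t 1 y (derive1 y t).
    by rewrite derive1_dir; apply: is_derive_dir; exact: smooth_on_diff sy (Jr _ tr).
  have d2 := dH t tr; have d3 := is_derive_expRN t; have d4 := is_derive_expRB r t.
  have d5 : is_derive t 1 (id * cst S) S.
    have : is_derive t 1 (id * cst S) (t *: (0 : R) + S *: (1 : R)) by apply: is_deriveM.
    by rewrite scaler0 add0r [_ *: _]mulr1.
  have d6 : is_derive t 1 (C *: ((fun s => expR (s - r)) - (fun s => expR (- s))))
    (C *: (expR (t - r) - - expR (- t))) by apply: is_deriveZ.
  have d7 : is_derive t 1 (c *: (y - oint H 0)) (c *: (derive1 y t - H t)) by apply: is_deriveZ.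
  have d8 : is_derive t 1 (c *: (y - oint H 0) - id * cst S) (c *: (derive1 y t - H t) - S).
    by apply: is_deriveB.
  have : is_derive t 1 (C *: ((fun s => expR (s - r)) - (fun s => expR (- s)))
      - (c *: (y - oint H 0) - id * cst S))
    (C *: (expR (t - r) - - expR (- t)) - (c *: (derive1 y t - H t) - S)) by apply: is_deriveB.
  move=> d9; apply: is_derive_eq d9 _.
  have gen (a b z w : R) : C *: (a - - b) - (c *: z - w) = C * (a + b) - (c * z - w).
    by rewrite opprK.
  exact: gen.
have : oint k 0 r - oint k 0 0 <= G r - G 0.
  apply: (is_derive_le r0 dK dG) => t tr.
  by apply: cutoff_bound => //; exact: rhoL.
have HE : oint H 0 r = \int[lebesgue_measure]_(t in `[0, r]) derive1 h (psi (gamma t)).1.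
  by rewrite /oint r0.
have H00 : oint H 0 0 = 0 by rewrite /oint lexx set_itv1 Rintegral_set1.
rewrite -HE /G H00 sub0r subrr oppr0 expR0 => dKG.
have yr : y r <= norm_grad eta x.
  have := height_flux_le_norm_grad oI iI sh HP HM psiI Hiso oJ Hgeo It0 (Jr _ zrr) (unit_u _ zrr).
  by rewrite gr; exact: le_trans (ler_norm _).
have y0 : - norm_grad eta o <= y 0.
  have := height_flux_le_norm_grad oI iI sh HP HM psiI Hiso oJ Hgeo It0 J00 (unit_u _ z0r).
  by rewrite g0 ler_norml => /andP[].
have C0 : 0 <= C by rewrite addr_ge0// mulr_ge0.
have er : 0 < expR (- r) := expR_gt0 _.
have key : 0 <= 2 * C - c * (y r - y 0 - oint H 0 r) + r * S.
  have gen (K1 K2 E Y Y0 Hr : R) : K1 <= K2 -> 0 < E ->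
      K2 - K1 <= C * (1 - E) - (c * (Y - Hr) - r * S) - (C * (E - 1) - (c * (Y0 + 0) - 0 * S)) ->
      0 <= 2 * C - c * (Y - Y0 - Hr) + r * S.
    by move=> K12 E0 le; have := mulr_ge0 C0 (ltW E0); lra.
  exact: gen K0 er dKG.
(* Since [c] is negative, multiplying by its inverse turns the nonnegative quantity of [key] into
   the required lower bound for [y r]. *)
have cV : c^-1 < 0 by rewrite invr_lt0.
have : c^-1 * (2 * C - c * (y r - y 0 - oint H 0 r) + r * S) <= 0 by rewrite nmulr_rle0.
have -> : c^-1 * (2 * C - c * (y r - y 0 - oint H 0 r) + r * S) =
    2 * C / c - (y r - y 0 - oint H 0 r) + c^-1 * S * r.
  have gen (a b d : R) : c^-1 * (a - c * b + r * d) = a / c - b + c^-1 * d * r.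
    by field; rewrite lt_eqF.
  exact: gen.
have gen (a b d p q Nx No : R) : p <= Nx -> - No <= q -> a - (p - q - d) + b <= 0 ->
  b + d + (a - No) <= Nx by lra.
exact: gen.
Qed.
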